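(* Let $\mathbb{H}=\{z\in\mathbb{C}:\operatorname{Im}z>0\}$ and $\widehat{\mathbb{C}}=\mathbb{C}\cup\{\infty\}$. There exists a nonconstant meromorphic function $F\colon\mathbb{C}\to\widehat{\mathbb{C}}$ such that $F(z)\notin\{0,1,\infty\}$ for every $z\in\mathbb{H}$, but $F|_{\mathbb{H}}\notin N(\mathbb{H})$. In fact, $F$ can be chosen so that, moreover, $F^{-1}(\{0,1,\infty\})\subset\mathbb{R}$.
   Context: The Nevanlinna class $N(\mathbb{H})$ consists of the meromorphic functions in $\mathbb{H}$ that can be represented as a quotient $h_1/h_2$ of two bounded analytic functions $h_1,h_2$ on $\mathbb{H}$ ($h_2\not\equiv0$). *)

(* Defs.v *)
(* Stdlib reals, with the complex numbers and filters of Coquelicot. *)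
From Stdlib Require Import Reals.
From Coquelicot Require Import Coquelicot.

Open Scope R_scope.

Inductive Chat : Set :=
  | CFinite : C -> Chat
  | CInfinity : Chat.

Definition zero_one_infty (w : Chat) : Prop :=
  w = CFinite (RtoC 0) \/ w = CFinite (RtoC 1) \/ w = CInfinity.

(* The value 0 at infinity is a dummy, only read where [F] is known to be
   finite. *)
Definition finite_part (F : C -> Chat) (z : C) : C :=
  match F z with
  | CFinite w => w
  | CInfinity => RtoC 0
  end.

Definition upper_half_plane (z : C) : Prop := 0 < Im z.

Definition complex_differentiable (f : C -> C) (z : C) : Prop :=
  ex_derive (K := C_AbsRing) (V := C_NormedModule) f z.

(* [U] is meant to be open here and in [meromorphic_on]. *)
Definition holomorphic_on (U : C -> Prop) (f : C -> C) : Prop :=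
  forall z, U z -> complex_differentiable f z.

(* Holomorphic except for poles: a pole is an isolated point at which [F] takes
   the value infinity and where |F(z)| tends to infinity. As stated, the
   function constantly equal to infinity is not meromorphic. *)
Definition meromorphic_on (U : C -> Prop) (F : C -> Chat) : Prop :=
  forall z0, U z0 ->
  match F z0 with
  | CFinite _ =>
      locally z0 (fun z => F z <> CInfinity) /\
      complex_differentiable (finite_part F) z0
  | CInfinity =>
      locally' z0 (fun z => F z <> CInfinity) /\
      filterlim (fun z => Cmod (finite_part F z))
        (locally' z0) (Rbar_locally p_infty)
  end.

Definition bounded_on (U : C -> Prop) (f : C -> C) : Prop :=
  exists M : R, forall z, U z -> Cmod (f z) <= M.

(* Only the values of [F] on the upper half-plane matter, so that
   [nevanlinna_class F] is a statement about the restriction of [F] to it.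
   The quotient h1 / h2 is taken as a meromorphic function: the values of [F]
   at the (isolated) zeros of [h2] are determined by those elsewhere. *)
Definition nevanlinna_class (F : C -> Chat) : Prop :=
  meromorphic_on upper_half_plane F /\
  exists h1 h2 : C -> C,
    holomorphic_on upper_half_plane h1 /\ bounded_on upper_half_plane h1 /\
    holomorphic_on upper_half_plane h2 /\ bounded_on upper_half_plane h2 /\
    (exists z, upper_half_plane z /\ h2 z <> RtoC 0) /\
    (forall z, upper_half_plane z -> h2 z <> RtoC 0 ->
       F z = CFinite (Cdiv (h1 z) (h2 z))).

(* Main.v *)
(* Let G be a function whose points over 0, 1 and infinity are all real. Composing G with
   T + r^2/(T - s), which is branched over the end points s - 2r and s + 2r of a gap between
   two such points, makes these points denser near the gap and hardly changes G away from
   it. Doing this repeatedly inside real intervals that shrink to a point ts, starting from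
   a Chebyshev polynomial, gives a sequence G_n whose limit (after small holomorphic changes
   of variable) is meromorphic outside of ts, and F(z) is its value at ts - 1/z.

   If F = h1/h2 with bounded h1, h2, then h2 yields bounded functions h on the upper
   half-plane with h G_n bounded too. On the real line |G(1-G)/G'| / max(1,|G|) is at most
   of the order of the distance to the nearest end points of the gap, so h G_n (1-G_n)/G_n'
   is small where the gaps of G_n are short. By a two-constant estimate it is small in the
   half-plane, so tends to 0, which forces h2 = 0. *)
Require Import Defs.
From Stdlib Require Import Reals Lra Lia List Classical ClassicalEpsilon
  FunctionalExtensionality.
From Coquelicot Require Import Coquelicot.
Open Scope R_scope.

(** * Complex differentiability *)

(** A doubling turns a gap of length 4r into two gaps of length r, but it stretches the gaps beside
    it, so it is not clear that all gaps of a zone can become short while the zone survives. Each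
    zone is therefore swept from left to right, and comparison functions pay for the stretching: a
    sweep lowers the bound D on the gaps by the factor 97/100 and costs a zone of length L at most a
    multiple of sqrt (D L). These losses form a geometric series, so any number of sweeps leaves
    half of the zone. Hence length times ln (1 / gap) can be made as large as desired in any zone,
    however short. This product is the exponent gained in the two-constant estimate, which is why
    the zones may shrink to a point. Each change of variable has a right inverse on the whole upper
    half-plane; through it the multiplier h is carried from the limit back to every G_n, where the
    estimate applies. The complex analysis does without Cauchy's formula: Goursat's theorem gives a
    maximum principle, this gives a form of Schwarz' lemma, and from it follows that uniform limits
    are holomorphic. *)

Definition ccont (f : C -> C) (z : C) : Prop :=
  forall eps, 0 < eps -> exists d, 0 < d /\
    forall w, Cmod (w - z) < d -> Cmod (f w - f z) < eps.

(* Caratheodory's formulation of the derivative. *)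
Definition cderiv (f : C -> C) (z l : C) : Prop :=
  exists phi, ccont phi z /\ phi z = l /\
    forall w, f w = (f z + phi w * (w - z))%C.

Definition cdiff (f : C -> C) (z : C) : Prop := exists l, cderiv f z l.

Lemma Cmod_minus_sym (z w : C) : Cmod (z - w) = Cmod (w - z).
Proof. replace (z - w)%C with (- (w - z))%C by ring. apply Cmod_opp. Qed.

Lemma Cmod_tri_minus (x y z : C) : Cmod (x - z) <= Cmod (x - y) + Cmod (y - z).
Proof.
  replace (x - z)%C with ((x - y) + (y - z))%C by ring. apply Cmod_triangle.
Qed.

Lemma Cmod_lower (x y : C) : Cmod x - Cmod y <= Cmod (x + y).
Proof.
  assert (H := Cmod_triangle (x + y) (- y)).
  replace (x + y + - y)%C with x in H by ring.
  rewrite Cmod_opp in H. lra.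
Qed.

Lemma Cmod_lower_minus (x y : C) : Cmod x - Cmod y <= Cmod (x - y).
Proof. assert (H := Cmod_lower x (- y)). rewrite Cmod_opp in H. exact H. Qed.

Lemma Cmod_minus_le (x y : C) : Cmod (x - y) <= Cmod x + Cmod y.
Proof. assert (H := Cmod_triangle x (- y)). rewrite Cmod_opp in H. exact H. Qed.

Lemma Cminus_neq_0 (x y : C) : x <> y -> (x - y)%C <> 0%C.
Proof.
  intros H E. apply H. replace x with ((x - y) + y)%C by ring. rewrite E. ring.
Qed.

Lemma Cmod_minus_pos (x y : C) : x <> y -> 0 < Cmod (x - y).
Proof. intros H. apply Cmod_gt_0, Cminus_neq_0, H. Qed.

Lemma Cminus_Re (z w : C) : Re (z - w)%C = Re z - Re w.
Proof. destruct z, w. reflexivity. Qed.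

Lemma Cminus_Im (z w : C) : Im (z - w)%C = Im z - Im w.
Proof. destruct z, w. reflexivity. Qed.

Lemma im_le_Cmod (z : C) : Rabs (Im z) <= Cmod z.
Proof. apply Rle_trans with (2 := Rmax_Cmod z). apply Rmax_r. Qed.

Lemma Cmod_le_abs (z : C) : Cmod z <= Rabs (Re z) + Rabs (Im z).
Proof.
  replace z with (RtoC (Re z) + Ci * RtoC (Im z))%C at 1.
  - eapply Rle_trans; [apply Cmod_triangle|].
    rewrite Cmod_mult, Cmod_Ci, !Cmod_R. lra.
  - destruct z as [x y]. unfold RtoC, Ci, Cmult, Cplus; simpl. f_equal; ring.
Qed.

Lemma ccont_ext (f g : C -> C) (z : C) (r : R) :
  0 < r -> (forall w, Cmod (w - z) < r -> f w = g w) -> ccont f z -> ccont g z.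
Proof.
  intros Hr E H eps He. destruct (H eps He) as [d [Hd K]].
  exists (Rmin d r). split; [now apply Rmin_glb_lt|]. intros w Hw.
  assert (A := Rmin_l d r). assert (B := Rmin_r d r).
  rewrite <- (E w) by lra. rewrite <- (E z); [apply K; lra|].
  replace (z - z)%C with (RtoC 0) by ring. rewrite Cmod_0. exact Hr.
Qed.

Lemma ccont_const (c z : C) : ccont (fun _ => c) z.
Proof.
  intros eps He. exists 1. split; [lra|]. intros w _.
  replace (c - c)%C with (RtoC 0) by ring. now rewrite Cmod_0.
Qed.

Lemma ccont_id (z : C) : ccont (fun w => w) z.
Proof. intros eps He. exists eps. split; auto. Qed.

Lemma ccont_plus (f g : C -> C) (z : C) :
  ccont f z -> ccont g z -> ccont (fun w => f w + g w)%C z.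
Proof.
  intros Hf Hg eps He.
  destruct (Hf (eps / 2)) as [d1 [D1 K1]]; [lra|].
  destruct (Hg (eps / 2)) as [d2 [D2 K2]]; [lra|].
  exists (Rmin d1 d2). split; [now apply Rmin_glb_lt|]. intros w Hw.
  assert (A := Rmin_l d1 d2). assert (B := Rmin_r d1 d2).
  assert (X1 := K1 w ltac:(lra)). assert (X2 := K2 w ltac:(lra)).
  replace (f w + g w - (f z + g z))%C with ((f w - f z) + (g w - g z))%C by ring.
  eapply Rle_lt_trans; [apply Cmod_triangle|lra].
Qed.

Lemma ccont_comp (f g : C -> C) (z : C) :
  ccont g z -> ccont f (g z) -> ccont (fun w => f (g w)) z.
Proof.
  intros Hg Hf eps He. destruct (Hf eps He) as [d [D K]].
  destruct (Hg d D) as [d' [D' K']]. exists d'. split; auto.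
Qed.

Lemma ccont_mult (f g : C -> C) (z : C) :
  ccont f z -> ccont g z -> ccont (fun w => f w * g w)%C z.
Proof.
  intros Hf Hg eps He.
  set (A := Cmod (f z)). set (B := Cmod (g z)).
  assert (HA : 0 <= A) by apply Cmod_ge_0. assert (gap_bound : 0 <= B) by apply Cmod_ge_0.
  set (e := Rmin 1 (eps / (A + B + 2))).
  assert (He0 : 0 < eps / (A + B + 2)) by (apply Rdiv_lt_0_compat; lra).
  assert (He' : 0 < e) by (apply Rmin_glb_lt; lra).
  destruct (Hf e He') as [d1 [D1 K1]]. destruct (Hg e He') as [d2 [D2 K2]].
  exists (Rmin d1 d2). split; [now apply Rmin_glb_lt|]. intros w Hw.
  assert (X := Rmin_l d1 d2). assert (Y := Rmin_r d1 d2).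
  specialize (K1 w ltac:(lra)). specialize (K2 w ltac:(lra)).
  replace (f w * g w - f z * g z)%C with
    ((f w - f z) * (g w - g z) + f z * (g w - g z) + (f w - f z) * g z)%C by ring.
  eapply Rle_lt_trans; [apply Cmod_triangle|].
  eapply Rle_lt_trans; [apply Rplus_le_compat_r, Cmod_triangle|].
  rewrite !Cmod_mult. fold A B.
  assert (G0 := Cmod_ge_0 (f w - f z)). assert (G1 := Cmod_ge_0 (g w - g z)).
  assert (e1 : e <= 1) by apply Rmin_l.
  assert (e2 : e * (A + B + 2) <= eps).
  { assert (T : e <= eps / (A + B + 2)) by apply Rmin_r.
    apply Rmult_le_compat_r with (r := A + B + 2) in T; [|lra].
    replace (eps / (A + B + 2) * (A + B + 2)) with eps in T by (field; lra). exact T. }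
  nra.
Qed.

Lemma ccont_inv (f : C -> C) (z : C) :
  ccont f z -> f z <> 0%C -> ccont (fun w => / f w)%C z.
Proof.
  intros Hf Hz eps He. set (A := Cmod (f z)).
  assert (HA : 0 < A) by (apply Cmod_gt_0; exact Hz).
  assert (H0 : 0 < Rmin (A / 2) (eps * A * A / 2)).
  { apply Rmin_glb_lt; [lra|]. assert (0 < eps * A * A); [|lra].
    repeat apply Rmult_lt_0_compat; auto. }
  destruct (Hf _ H0) as [d [D K]]. exists d. split; auto. intros w Hw.
  specialize (K w Hw).
  assert (X := Rmin_l (A / 2) (eps * A * A / 2)).
  assert (Y := Rmin_r (A / 2) (eps * A * A / 2)).
  assert (W : A / 2 < Cmod (f w)).
  { assert (Z := Cmod_lower_minus (f z) (f z - f w)).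
    replace (f z - (f z - f w))%C with (f w) in Z by ring.
    rewrite (Cmod_minus_sym (f z)) in Z. fold A in Z. lra. }
  assert (Hw0 : f w <> 0%C) by (apply Cmod_gt_0; lra).
  replace (/ f w - / f z)%C with (- (f w - f z) * / (f w * f z))%C by (field; auto).
  rewrite Cmod_mult, Cmod_opp, Cmod_inv, Cmod_mult by (now apply Cmult_neq_0).
  fold A. apply Rmult_lt_reg_r with (Cmod (f w) * A); [nra|].
  rewrite Rmult_assoc, Rinv_l by nra. nra.
Qed.

Lemma cderiv_eps (f : C -> C) (z l : C) :
  cderiv f z l <->
  forall eps, 0 < eps -> exists d, 0 < d /\ forall w, Cmod (w - z) < d ->
    Cmod (f w - f z - l * (w - z)) <= eps * Cmod (w - z).
Proof.
  split.
  - intros [phi [Hc [<- E]]] eps He. destruct (Hc eps He) as [d [D K]].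
    exists d. split; auto. intros w Hw. rewrite (E w).
    replace (f z + phi w * (w - z) - f z - phi z * (w - z))%C
      with ((phi w - phi z) * (w - z))%C by ring.
    rewrite Cmod_mult. apply Rmult_le_compat_r; [apply Cmod_ge_0|].
    left. auto.
  - intros H.
    set (phi := fun w => match excluded_middle_informative (w = z) with
                         | left _ => l | right _ => ((f w - f z) / (w - z))%C end).
    assert (Pz : phi z = l).
    { unfold phi. destruct (excluded_middle_informative (z = z)); congruence. }
    exists phi. split; [|split]; auto.
    + intros eps He. destruct (H (eps / 2)) as [d [D K]]; [lra|].
      exists d. split; auto. intros w Hw. rewrite Pz. unfold phi.
      destruct (excluded_middle_informative (w = z)) as [->|N].
      * replace (l - l)%C with (RtoC 0) by ring. now rewrite Cmod_0.
      * assert (P := Cmod_minus_pos w z N).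
        replace ((f w - f z) / (w - z) - l)%C
          with ((f w - f z - l * (w - z)) / (w - z))%C
          by (field; now apply Cminus_neq_0).
        rewrite Cmod_div by now apply Cminus_neq_0.
        apply Rlt_div_l; auto. specialize (K w Hw). nra.
    + intros w. unfold phi. destruct (excluded_middle_informative (w = z)) as [->|N].
      * ring.
      * field. now apply Cminus_neq_0.
Qed.

Lemma cdiff_ccont (f : C -> C) (z : C) : cdiff f z -> ccont f z.
Proof.
  intros [l [phi [Hc [_ E]]]].
  apply ccont_ext with (f := fun w => (f z + phi w * (w - z))%C) (r := 1); [lra| |].
  - intros w _. symmetry. apply E.
  - apply ccont_plus; [apply ccont_const|]. apply ccont_mult; auto.
    apply ccont_plus; [apply ccont_id|apply ccont_const].
Qed.

Lemma cderiv_ext_loc (f g : C -> C) (z l : C) (r : R) :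
  0 < r -> (forall w, Cmod (w - z) < r -> f w = g w) ->
  cderiv f z l -> cderiv g z l.
Proof.
  intros Hr E H. apply cderiv_eps. intros eps He.
  destruct (proj1 (cderiv_eps f z l) H eps He) as [d [D K]].
  exists (Rmin d r). split; [now apply Rmin_glb_lt|]. intros w Hw.
  assert (A := Rmin_l d r). assert (B := Rmin_r d r).
  rewrite <- (E w) by lra. rewrite <- (E z); [apply K; lra|].
  replace (z - z)%C with (RtoC 0) by ring. rewrite Cmod_0. exact Hr.
Qed.

Lemma cdiff_ext_loc (f g : C -> C) (z : C) (r : R) :
  0 < r -> (forall w, Cmod (w - z) < r -> f w = g w) -> cdiff f z -> cdiff g z.
Proof. intros Hr E [l H]. exists l. eapply cderiv_ext_loc; eauto. Qed.

Lemma cderiv_const (c z : C) : cderiv (fun _ => c) z 0.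
Proof.
  exists (fun _ => RtoC 0). split; [apply ccont_const|split; auto]. intros w. ring.
Qed.

Lemma cderiv_id (z : C) : cderiv (fun w => w) z 1.
Proof.
  exists (fun _ => RtoC 1). split; [apply ccont_const|split; auto]. intros w. ring.
Qed.

Lemma cderiv_plus (f g : C -> C) (z a b : C) :
  cderiv f z a -> cderiv g z b -> cderiv (fun w => f w + g w)%C z (a + b)%C.
Proof.
  intros [p [P1 [P2 P3]]] [q [Q1 [Q2 Q3]]].
  exists (fun w => p w + q w)%C. split; [now apply ccont_plus|].
  split; [now rewrite P2, Q2|]. intros w. rewrite (P3 w), (Q3 w). ring.
Qed.

Lemma cderiv_mult (f g : C -> C) (z a b : C) :
  cderiv f z a -> cderiv g z b -> cderiv (fun w => f w * g w)%C z (a * g z + f z * b)%C.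
Proof.
  intros Hf Hg. assert (Cg : ccont g z) by (apply cdiff_ccont; now exists b).
  destruct Hf as [p [P1 [P2 P3]]]. destruct Hg as [q [Q1 [Q2 Q3]]].
  exists (fun w => p w * g w + f z * q w)%C. split; [|split].
  - apply ccont_plus; apply ccont_mult; auto. apply ccont_const.
  - now rewrite P2, Q2.
  - intros w. rewrite (P3 w). rewrite (Q3 w). ring.
Qed.

Lemma cderiv_comp (f g : C -> C) (z a b : C) :
  cderiv g z a -> cderiv f (g z) b -> cderiv (fun w => f (g w)) z (b * a)%C.
Proof.
  intros Hg Hf. assert (Cg : ccont g z) by (apply cdiff_ccont; now exists a).
  destruct Hf as [p [P1 [P2 P3]]]. destruct Hg as [q [Q1 [Q2 Q3]]].
  exists (fun w => p (g w) * q w)%C. split; [|split].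
  - apply ccont_mult; auto. now apply ccont_comp.
  - now rewrite P2, Q2.
  - intros w. rewrite (P3 (g w)). rewrite (Q3 w) at 2. ring.
Qed.

Lemma cderiv_inv (f : C -> C) (z a : C) :
  cderiv f z a -> f z <> 0%C -> cderiv (fun w => / f w)%C z (- a / (f z * f z))%C.
Proof.
  intros Hf Hz. assert (Cf : ccont f z) by (apply cdiff_ccont; now exists a).
  destruct (Cf (Cmod (f z))) as [d [D K]]; [now apply Cmod_gt_0|].
  assert (N : forall w, Cmod (w - z) < d -> f w <> 0%C).
  { intros w Hw E. specialize (K w Hw). rewrite E, Cmod_minus_sym in K.
    replace (f z - 0)%C with (f z) in K by ring. lra. }
  destruct Hf as [p [P1 [P2 P3]]]. apply cderiv_eps.
  apply (proj1 (cderiv_eps (fun w => / f w)%C z (- a / (f z * f z))%C)).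
  (* Near [z], where [f] has no zero, [g] agrees with the inverse of [f]; it has Caratheodory's form
     at every point, as the definition of the derivative demands. *)
  set (g := fun w => (/ f z + - p w / (f w * f z) * (w - z))%C).
  assert (Gz : g z = (/ f z)%C) by (unfold g; field; auto).
  apply cderiv_ext_loc with (f := g) (r := d); auto.
  - intros w Hw. unfold g. assert (Hw0 := N w Hw).
    assert (E : (p w * (w - z) = f w - f z)%C) by (rewrite (P3 w); ring).
    replace (- p w / (f w * f z) * (w - z))%C
      with (- (p w * (w - z)) / (f w * f z))%C by (field; auto).
    rewrite E. field; auto.
  - exists (fun w => (- p w / (f w * f z))%C). split; [|split].
    + unfold Cdiv. apply ccont_mult.
      * apply ccont_ext with (f := fun w => (- (1) * p w)%C) (r := 1); [lra| |].
        -- intros. ring.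
        -- apply ccont_mult; auto. apply ccont_const.
      * apply ccont_inv; [|now apply Cmult_neq_0]. apply ccont_mult; auto. apply ccont_const.
    + now rewrite P2.
    + intros w. rewrite Gz. reflexivity.
Qed.

Lemma cdiff_const (c z : C) : cdiff (fun _ => c) z.
Proof. eexists; apply cderiv_const. Qed.

Lemma cdiff_id (z : C) : cdiff (fun w => w) z.
Proof. eexists; apply cderiv_id. Qed.

Lemma cdiff_plus (f g : C -> C) (z : C) :
  cdiff f z -> cdiff g z -> cdiff (fun w => f w + g w)%C z.
Proof. intros [a A] [b B]. eexists. now apply (cderiv_plus f g z a b). Qed.

Lemma cdiff_mult (f g : C -> C) (z : C) :
  cdiff f z -> cdiff g z -> cdiff (fun w => f w * g w)%C z.
Proof. intros [a A] [b B]. eexists. now apply (cderiv_mult f g z a b). Qed.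

Lemma cdiff_opp (f : C -> C) (z : C) : cdiff f z -> cdiff (fun w => - f w)%C z.
Proof.
  intros H. apply cdiff_ext_loc with (f := fun w => (- (1) * f w)%C) (r := 1); [lra| |].
  - intros. ring.
  - apply cdiff_mult; auto. apply cdiff_const.
Qed.

Lemma cdiff_minus (f g : C -> C) (z : C) :
  cdiff f z -> cdiff g z -> cdiff (fun w => f w - g w)%C z.
Proof. intros A B. apply (cdiff_plus f (fun w => - g w)%C); auto. now apply cdiff_opp. Qed.

Lemma cdiff_comp (f g : C -> C) (z : C) :
  cdiff g z -> cdiff f (g z) -> cdiff (fun w => f (g w)) z.
Proof. intros [a A] [b B]. eexists. now apply (cderiv_comp f g z a b). Qed.

Lemma cdiff_inv (f : C -> C) (z : C) :
  cdiff f z -> f z <> 0%C -> cdiff (fun w => / f w)%C z.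
Proof. intros [a A] N. eexists. now apply (cderiv_inv f z a). Qed.

Lemma cdiff_div (f g : C -> C) (z : C) :
  cdiff f z -> cdiff g z -> g z <> 0%C -> cdiff (fun w => f w / g w)%C z.
Proof. intros A B N. apply (cdiff_mult f (fun w => / g w)%C); auto. now apply cdiff_inv. Qed.

Lemma cdiff_pow (f : C -> C) (n : nat) (z : C) :
  cdiff f z -> cdiff (fun w => f w ^ n)%C z.
Proof.
  intros H. induction n as [|n IH]; simpl.
  - apply cdiff_const.
  - now apply (cdiff_mult f (fun w => f w ^ n)%C).
Qed.

Lemma cdiff_complex_differentiable (f : C -> C) (z : C) :
  cdiff f z <-> complex_differentiable f z.
Proof.
  split.
  - intros [l H]. exists l. split.
    + apply is_linear_scal_l.
    + intros x Hx.
      assert (E : z = x) by (apply (@is_filter_lim_locally_unique C_AbsRing (AbsRing_NormedModule C_AbsRing) z x); exact Hx).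
      subst x. intros eps.
      apply (@locally_le_locally_norm C_AbsRing (AbsRing_NormedModule C_AbsRing)).
      destruct (proj1 (cderiv_eps f z l) H eps (cond_pos eps)) as [d [D K]].
      exists (mkposreal d D). intros w Hw.
      unfold ball_norm in Hw. simpl in Hw.
      change (Cmod (w - z) < d) in Hw.
      change (Cmod ((f w - f z) - (w - z) * l) <= eps * Cmod (w - z)).
      rewrite (Cmult_comm (w - z) l). now apply K.
  - intros [l [_ H]]. exists l. apply cderiv_eps. intros eps He.
    specialize (H z (fun P HP => HP) (mkposreal eps He)).
    apply (@locally_norm_le_locally C_AbsRing (AbsRing_NormedModule C_AbsRing)) in H. destruct H as [d K].
    exists d. split; [apply cond_pos|]. intros w Hw.
    specialize (K w Hw).
    change (Cmod ((f w - f z) - (w - z) * l) <= eps * Cmod (w - z)) in K.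
    now rewrite (Cmult_comm (w - z) l) in K.
Qed.

(** * Goursat's theorem and the maximum principle on rectangles *)

Lemma continuous_C (g : R -> C) (x : R) :
  (forall eps, 0 < eps -> exists d, 0 < d /\
     forall x', Rabs (x' - x) < d -> Cmod (g x' - g x) < eps) ->
  continuous (U := C_R_CompleteNormedModule) g x.
Proof.
  intros H. apply filterlim_locally. intros eps.
  destruct (H eps (cond_pos eps)) as [d [D K]].
  exists (mkposreal d D). intros y Hy. specialize (K y Hy).
  assert (M := Rmax_Cmod (g y - g x)%C).
  assert (M1 := Rmax_l (Rabs (fst (g y - g x)%C)) (Rabs (snd (g y - g x)%C))).
  assert (M2 := Rmax_r (Rabs (fst (g y - g x)%C)) (Rabs (snd (g y - g x)%C))).
  split.
  - change (Rabs (fst (g y - g x)%C) < eps). lra.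
  - change (Rabs (snd (g y - g x)%C) < eps). lra.
Qed.

Lemma Cmod_dh (x x' y : R) : Cmod ((x', y) - (x, y))%C = Rabs (x' - x).
Proof.
  replace ((x', y) - (x, y))%C with (RtoC (x' - x)); [apply Cmod_R|].
  unfold Cminus, Cplus, Copp, RtoC; simpl. f_equal; ring.
Qed.

Lemma Cmod_dv (x y y' : R) : Cmod ((x, y') - (x, y))%C = Rabs (y' - y).
Proof.
  replace ((x, y') - (x, y))%C with (Ci * RtoC (y' - y))%C.
  - rewrite Cmod_mult, Cmod_Ci, Cmod_R. ring.
  - unfold Cminus, Cplus, Copp, Cmult, Ci, RtoC; simpl. f_equal; ring.
Qed.

Definition hint (f : C -> C) (y a b : R) : C :=
  RInt (V := C_R_CompleteNormedModule) (fun x => f (x, y)) a b.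

Definition vint (f : C -> C) (x c d : R) : C :=
  RInt (V := C_R_CompleteNormedModule) (fun y => f (x, y)) c d.

(** The contour integral of f dz, counterclockwise around the boundary of the rectangle. *)
Definition rint (f : C -> C) (a b c d : R) : C :=
  (hint f c a b + Ci * vint f b c d - hint f d a b - Ci * vint f a c d)%C.

Definition in_rect (a b c d : R) (z : C) : Prop :=
  a <= Re z <= b /\ c <= Im z <= d.

Definition on_bd (a b c d : R) (z : C) : Prop :=
  in_rect a b c d z /\ (Re z = a \/ Re z = b \/ Im z = c \/ Im z = d).

Lemma ccont_h (f : C -> C) (x y : R) : ccont f (x, y) ->
  continuous (U := C_R_CompleteNormedModule) (fun x => f (x, y)) x.
Proof.
  intros H. apply continuous_C. intros eps He. destruct (H eps He) as [d [D K]].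
  exists d. split; auto. intros x' Hx. apply K. now rewrite Cmod_dh.
Qed.

Lemma ccont_v (f : C -> C) (x y : R) : ccont f (x, y) ->
  continuous (U := C_R_CompleteNormedModule) (fun y => f (x, y)) y.
Proof.
  intros H. apply continuous_C. intros eps He. destruct (H eps He) as [d [D K]].
  exists d. split; auto. intros x' Hx. apply K. now rewrite Cmod_dv.
Qed.

Lemma ex_hint (f : C -> C) (y a b : R) : a <= b ->
  (forall x, a <= x <= b -> ccont f (x, y)) ->
  ex_RInt (V := C_R_CompleteNormedModule) (fun x => f (x, y)) a b.
Proof.
  intros Hab H. apply ex_RInt_continuous. intros x.
  rewrite Rmin_left, Rmax_right by lra. intros Hx. apply ccont_h. auto.
Qed.

Lemma ex_vint (f : C -> C) (x c d : R) : c <= d ->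
  (forall y, c <= y <= d -> ccont f (x, y)) ->
  ex_RInt (V := C_R_CompleteNormedModule) (fun y => f (x, y)) c d.
Proof.
  intros Hab H. apply ex_RInt_continuous. intros y.
  rewrite Rmin_left, Rmax_right by lra. intros Hx. apply ccont_v. auto.
Qed.

Lemma is_RInt_Cmult (g : R -> C) (a b : R) (k l : C) :
  is_RInt (V := C_R_NormedModule) g a b l ->
  is_RInt (V := C_R_NormedModule) (fun x => k * g x)%C a b (k * l)%C.
Proof.
  intros H.
  assert (H1 := is_RInt_fct_extend_fst (U := R_NormedModule) (V := R_NormedModule) g a b l H).
  assert (H2 := is_RInt_fct_extend_snd (U := R_NormedModule) (V := R_NormedModule) g a b l H).
  apply (is_RInt_fct_extend_pair (U := R_NormedModule) (V := R_NormedModule)).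
  - apply (is_RInt_minus (V := R_NormedModule)).
    + apply (is_RInt_scal (V := R_NormedModule)). exact H1.
    + apply (is_RInt_scal (V := R_NormedModule)). exact H2.
  - apply (is_RInt_plus (V := R_NormedModule)).
    + apply (is_RInt_scal (V := R_NormedModule)). exact H2.
    + apply (is_RInt_scal (V := R_NormedModule)). exact H1.
Qed.

Lemma RInt_Cmult (g : R -> C) (a b : R) (k : C) :
  ex_RInt (V := C_R_CompleteNormedModule) g a b ->
  RInt (V := C_R_CompleteNormedModule) (fun x => k * g x)%C a b =
  (k * RInt (V := C_R_CompleteNormedModule) g a b)%C.
Proof.
  intros H. apply is_RInt_unique. apply is_RInt_Cmult.
  exact (RInt_correct (V := C_R_CompleteNormedModule) g a b H).
Qed.

Lemma RInt_Cplus (g h : R -> C) (a b : R) :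
  ex_RInt (V := C_R_CompleteNormedModule) g a b ->
  ex_RInt (V := C_R_CompleteNormedModule) h a b ->
  RInt (V := C_R_CompleteNormedModule) (fun x => g x + h x)%C a b =
  (RInt (V := C_R_CompleteNormedModule) g a b + RInt (V := C_R_CompleteNormedModule) h a b)%C.
Proof. intros G H. exact (RInt_plus (V := C_R_CompleteNormedModule) g h a b G H). Qed.

Definition cont_bd (f : C -> C) (a b c d : R) : Prop :=
  forall z, on_bd a b c d z -> ccont f z.

Section Edges.
Variables (f : C -> C) (a b c d : R).
Hypotheses (Hab : a <= b) (Hcd : c <= d) (Hf : cont_bd f a b c d).

Lemma edge_bottom : ex_RInt (V := C_R_CompleteNormedModule) (fun x => f (x, c)) a b.
Proof. apply ex_hint; auto. intros x Hx. apply Hf. unfold on_bd, in_rect; simpl. lra. Qed.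

Lemma edge_top : ex_RInt (V := C_R_CompleteNormedModule) (fun x => f (x, d)) a b.
Proof. apply ex_hint; auto. intros x Hx. apply Hf. unfold on_bd, in_rect; simpl. lra. Qed.

Lemma edge_left : ex_RInt (V := C_R_CompleteNormedModule) (fun y => f (a, y)) c d.
Proof. apply ex_vint; auto. intros x Hx. apply Hf. unfold on_bd, in_rect; simpl. lra. Qed.

Lemma edge_right : ex_RInt (V := C_R_CompleteNormedModule) (fun y => f (b, y)) c d.
Proof. apply ex_vint; auto. intros x Hx. apply Hf. unfold on_bd, in_rect; simpl. lra. Qed.
End Edges.

Lemma rint_plus (f g : C -> C) (a b c d : R) : a <= b -> c <= d ->
  cont_bd f a b c d -> cont_bd g a b c d ->
  rint (fun z => f z + g z)%C a b c d = (rint f a b c d + rint g a b c d)%C.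
Proof.
  intros Hab Hcd Hf Hg. unfold rint, hint, vint.
  rewrite (RInt_Cplus (fun x => f (x, c)) (fun x => g (x, c)))
    by first [exact (edge_bottom f a b c d Hab Hcd Hf) | exact (edge_bottom g a b c d Hab Hcd Hg)].
  rewrite (RInt_Cplus (fun x => f (x, d)) (fun x => g (x, d)))
    by first [exact (edge_top f a b c d Hab Hcd Hf) | exact (edge_top g a b c d Hab Hcd Hg)].
  rewrite (RInt_Cplus (fun y => f (a, y)) (fun y => g (a, y)))
    by first [exact (edge_left f a b c d Hab Hcd Hf) | exact (edge_left g a b c d Hab Hcd Hg)].
  rewrite (RInt_Cplus (fun y => f (b, y)) (fun y => g (b, y)))
    by first [exact (edge_right f a b c d Hab Hcd Hf) | exact (edge_right g a b c d Hab Hcd Hg)].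
  ring.
Qed.

Lemma rint_Cmult (f : C -> C) (k : C) (a b c d : R) : a <= b -> c <= d ->
  cont_bd f a b c d ->
  rint (fun z => k * f z)%C a b c d = (k * rint f a b c d)%C.
Proof.
  intros Hab Hcd Hf. unfold rint, hint, vint.
  rewrite (RInt_Cmult (fun x => f (x, c))) by exact (edge_bottom f a b c d Hab Hcd Hf).
  rewrite (RInt_Cmult (fun x => f (x, d))) by exact (edge_top f a b c d Hab Hcd Hf).
  rewrite (RInt_Cmult (fun y => f (a, y))) by exact (edge_left f a b c d Hab Hcd Hf).
  rewrite (RInt_Cmult (fun y => f (b, y))) by exact (edge_right f a b c d Hab Hcd Hf).
  ring.
Qed.

Lemma Cmod_RInt_le (g : R -> C) (a b M : R) : a <= b ->
  ex_RInt (V := C_R_CompleteNormedModule) g a b ->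
  (forall x, a <= x <= b -> Cmod (g x) <= M) ->
  Cmod (RInt (V := C_R_CompleteNormedModule) g a b) <= (b - a) * M.
Proof.
  intros Hab He H. rewrite Cmod_norm.
  apply (norm_RInt_le_const (V := C_R_NormedModule) g); auto.
  - intros x Hx. specialize (H x Hx). rewrite Cmod_norm in H. exact H.
  - exact (RInt_correct (V := C_R_CompleteNormedModule) g a b He).
Qed.

Lemma rint_bound (f : C -> C) (a b c d M : R) : a <= b -> c <= d ->
  cont_bd f a b c d -> (forall z, on_bd a b c d z -> Cmod (f z) <= M) ->
  Cmod (rint f a b c d) <= 2 * ((b - a) + (d - c)) * M.
Proof.
  intros Hab Hcd Hf HM. unfold rint.
  assert (B1 : Cmod (hint f c a b) <= (b - a) * M).
  { apply Cmod_RInt_le; [lra|exact (edge_bottom f a b c d Hab Hcd Hf)|].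
    intros x Hx. apply HM. unfold on_bd, in_rect; simpl; lra. }
  assert (B2 : Cmod (hint f d a b) <= (b - a) * M).
  { apply Cmod_RInt_le; [lra|exact (edge_top f a b c d Hab Hcd Hf)|].
    intros x Hx. apply HM. unfold on_bd, in_rect; simpl; lra. }
  assert (B3 : Cmod (vint f a c d) <= (d - c) * M).
  { apply Cmod_RInt_le; [lra|exact (edge_left f a b c d Hab Hcd Hf)|].
    intros x Hx. apply HM. unfold on_bd, in_rect; simpl; lra. }
  assert (B4 : Cmod (vint f b c d) <= (d - c) * M).
  { apply Cmod_RInt_le; [lra|exact (edge_right f a b c d Hab Hcd Hf)|].
    intros x Hx. apply HM. unfold on_bd, in_rect; simpl; lra. }
  eapply Rle_trans; [apply Cmod_minus_le|].
  eapply Rle_trans; [apply Rplus_le_compat_r, Cmod_minus_le|].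
  eapply Rle_trans; [apply Rplus_le_compat_r, Rplus_le_compat_r, Cmod_triangle|].
  rewrite !Cmod_mult, Cmod_Ci. lra.
Qed.

Lemma rint_split_h (f : C -> C) (a m b c d : R) : a <= m <= b -> c <= d ->
  (forall z, in_rect a b c d z -> ccont f z) ->
  rint f a b c d = (rint f a m c d + rint f m b c d)%C.
Proof.
  intros Hm Hcd H.
  assert (E : forall y, c <= y <= d -> hint f y a b = (hint f y a m + hint f y m b)%C).
  { intros y Hy. unfold hint.
    symmetry. apply (RInt_Chasles (V := C_R_CompleteNormedModule)); apply ex_hint; try lra;
      intros x Hx; apply H; unfold in_rect; simpl; lra. }
  unfold rint. rewrite !E by lra. ring.
Qed.

Lemma rint_split_v (f : C -> C) (a b c m d : R) : a <= b -> c <= m <= d ->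
  (forall z, in_rect a b c d z -> ccont f z) ->
  rint f a b c d = (rint f a b c m + rint f a b m d)%C.
Proof.
  intros Hm Hcd H.
  assert (E : forall x, a <= x <= b -> vint f x c d = (vint f x c m + vint f x m d)%C).
  { intros y Hy. unfold vint.
    symmetry. apply (RInt_Chasles (V := C_R_CompleteNormedModule)); apply ex_vint; try lra;
      intros x Hx; apply H; unfold in_rect; simpl; lra. }
  unfold rint. rewrite !E by lra. ring.
Qed.

Lemma is_RInt_Rid (a b : R) : is_RInt (fun x : R => x) a b (b * b / 2 - a * a / 2).
Proof.
  apply (is_RInt_derive (V := R_CompleteNormedModule) (fun x => x * x / 2) (fun x => x)).
  - intros x _. auto_derive; auto. field.
  - intros x _. apply continuous_id.
Qed.

Lemma rint_id (a b c d : R) : rint (fun z => z) a b c d = 0%C.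
Proof.
  assert (H : forall y, hint (fun z => z) y a b = (b * b / 2 - a * a / 2, (b - a) * y)).
  { intros y. apply (is_RInt_unique (V := C_R_CompleteNormedModule)).
    apply (is_RInt_fct_extend_pair (U := R_NormedModule) (V := R_NormedModule)); simpl.
    - apply is_RInt_Rid.
    - apply (is_RInt_const (V := R_NormedModule)). }
  assert (V : forall x, vint (fun z => z) x c d = ((d - c) * x, d * d / 2 - c * c / 2)).
  { intros y. apply (is_RInt_unique (V := C_R_CompleteNormedModule)).
    apply (is_RInt_fct_extend_pair (U := R_NormedModule) (V := R_NormedModule)); simpl.
    - apply (is_RInt_const (V := R_NormedModule)).
    - apply is_RInt_Rid. }
  unfold rint. rewrite !H, !V.
  unfold Cminus, Cplus, Copp, Cmult, Ci, RtoC; simpl. f_equal; field.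
Qed.

Lemma rint_const (k : C) (a b c d : R) : rint (fun _ => k) a b c d = 0%C.
Proof.
  unfold rint, hint, vint. rewrite !(RInt_const (V := C_R_CompleteNormedModule)).
  ring.
Qed.

Lemma rint_affine (k l z0 : C) (a b c d : R) : a <= b -> c <= d ->
  rint (fun z => k + l * (z - z0))%C a b c d = 0%C.
Proof.
  intros Hab Hcd.
  assert (Cc : forall k, cont_bd (fun _ => k) a b c d) by (intros k' z _; apply ccont_const).
  assert (Ci' : cont_bd (fun z => z) a b c d) by (intros z _; apply ccont_id).
  assert (C1 : cont_bd (fun z => z + - z0)%C a b c d).
  { intros z Hz. apply ccont_plus; [apply ccont_id|apply ccont_const]. }
  rewrite (rint_plus (fun _ => k) (fun z => l * (z - z0))%C); auto.
  - rewrite rint_const. rewrite (rint_Cmult (fun z => z - z0)%C l); auto.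
    rewrite (rint_plus (fun z => z) (fun _ => - z0)%C); auto.
    rewrite rint_id, rint_const. ring.
  - intros z Hz. apply ccont_mult; [apply ccont_const|]. now apply C1.
Qed.

Definition ctn (f : C -> C) (a b c d : R) : Prop :=
  forall z, in_rect a b c d z -> ccont f z.

Record rectangle := Rect { xl : R; xr : R; yl : R; yr : R }.

Definition quarter (q1 q2 : bool) (Q : rectangle) : rectangle :=
  let mx := (xl Q + xr Q) / 2 in let my := (yl Q + yr Q) / 2 in
  Rect (if q1 then xl Q else mx) (if q1 then mx else xr Q)
       (if q2 then yl Q else my) (if q2 then my else yr Q).

Definition qint (f : C -> C) (Q : rectangle) : C := rint f (xl Q) (xr Q) (yl Q) (yr Q).

Definition half_perim (Q : rectangle) : R := (xr Q - xl Q) + (yr Q - yl Q).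

(* Comparing with the square of the perimeter keeps the ratio constant under bisection. *)
Lemma quarter_bad (f : C -> C) (Q : rectangle) (eta : R) :
  xl Q <= xr Q -> yl Q <= yr Q -> ctn f (xl Q) (xr Q) (yl Q) (yr Q) ->
  eta * half_perim Q ^ 2 < Cmod (qint f Q) ->
  exists q1 q2, eta * half_perim (quarter q1 q2 Q) ^ 2 < Cmod (qint f (quarter q1 q2 Q)).
Proof.
  intros Hx Hy Hc H.
  set (I1 := qint f (quarter true true Q)). set (I2 := qint f (quarter true false Q)).
  set (I3 := qint f (quarter false true Q)). set (I4 := qint f (quarter false false Q)).
  assert (E : qint f Q = (I1 + I2 + (I3 + I4))%C).
  { unfold I1, I2, I3, I4, qint, quarter; cbv zeta; simpl.
    rewrite (rint_split_h f (xl Q) ((xl Q + xr Q) / 2) (xr Q)); try lra; auto.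
    rewrite (rint_split_v f (xl Q) ((xl Q + xr Q) / 2) (yl Q) ((yl Q + yr Q) / 2) (yr Q)); try lra.
    - rewrite (rint_split_v f ((xl Q + xr Q) / 2) (xr Q) (yl Q) ((yl Q + yr Q) / 2) (yr Q)); try lra.
      + reflexivity.
      + intros z [Z1 Z2]. apply Hc. unfold in_rect; lra.
    - intros z [Z1 Z2]. apply Hc. unfold in_rect; lra. }
  assert (S : forall q1 q2, half_perim (quarter q1 q2 Q) = half_perim Q / 2).
  { intros [] []; unfold half_perim, quarter; cbv zeta; simpl; field. }
  apply NNPP. intros N.
  assert (K : forall q1 q2, Cmod (qint f (quarter q1 q2 Q)) <= eta * half_perim Q ^ 2 / 4).
  { intros q1 q2. apply Rnot_lt_le. intros L. apply N. exists q1, q2. rewrite S.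
    replace (eta * (half_perim Q / 2) ^ 2) with (eta * half_perim Q ^ 2 / 4) by field.
    exact L. }
  assert (T : Cmod (qint f Q) <= Cmod I1 + Cmod I2 + (Cmod I3 + Cmod I4)).
  { rewrite E. eapply Rle_trans; [apply Cmod_triangle|].
    apply Rplus_le_compat; apply Cmod_triangle. }
  assert (K1 := K true true). assert (K2 := K true false).
  assert (K3 := K false true). assert (K4 := K false false).
  fold I1 in K1. fold I2 in K2. fold I3 in K3. fold I4 in K4. lra.
Qed.

Definition pick_quarter (f : C -> C) (eta : R) (Q : rectangle) : rectangle :=
  epsilon (inhabits Q) (fun Q' => (exists q1 q2, Q' = quarter q1 q2 Q) /\
                        eta * half_perim Q' ^ 2 < Cmod (qint f Q')).

Lemma pick_quarter_spec (f : C -> C) (eta : R) (Q : rectangle) :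
  xl Q <= xr Q -> yl Q <= yr Q -> ctn f (xl Q) (xr Q) (yl Q) (yr Q) ->
  eta * half_perim Q ^ 2 < Cmod (qint f Q) ->
  (exists q1 q2, pick_quarter f eta Q = quarter q1 q2 Q) /\
  eta * half_perim (pick_quarter f eta Q) ^ 2 < Cmod (qint f (pick_quarter f eta Q)).
Proof.
  intros Hx Hy Hc H. unfold pick_quarter. apply epsilon_spec.
  destruct (quarter_bad f Q eta Hx Hy Hc H) as [q1 [q2 Hq]].
  exists (quarter q1 q2 Q). split; auto. now exists q1, q2.
Qed.

Fixpoint bisect (f : C -> C) (eta : R) (Q : rectangle) (n : nat) : rectangle :=
  match n with O => Q | S n => pick_quarter f eta (bisect f eta Q n) end.

Lemma half_pow_small (L eps : R) : 0 < eps -> exists n, L / 2 ^ n < eps.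
Proof.
  intros He. destruct (Rle_or_lt L 0) as [HL|HL].
  { exists O. simpl. lra. }
  destruct (pow_lt_1_zero (/ 2) ltac:(rewrite Rabs_pos_eq; lra) (eps / L)
    ltac:(now apply Rdiv_lt_0_compat)) as [N HN].
  exists N. specialize (HN N (le_n N)).
  rewrite Rabs_pos_eq in HN by (apply pow_le; lra).
  apply Rmult_lt_compat_l with (r := L) in HN; auto.
  rewrite pow_inv in HN. replace (L * (eps / L)) with eps in HN by (field; lra). exact HN.
Qed.

Lemma nested_interval (l r : nat -> R) (L : R) :
  (forall n, l n <= l (S n)) -> (forall n, r (S n) <= r n) -> (forall n, l n <= r n) ->
  exists x, forall n, l n <= x <= r n.
Proof.
  intros Hl Hr Hlr.
  assert (ML : forall n m, l n <= l (n + m)%nat).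
  { intros n m. induction m as [|m IH]; [rewrite Nat.add_0_r; lra|].
    rewrite Nat.add_succ_r. specialize (Hl (n + m)%nat). lra. }
  assert (MR : forall n m, r (n + m)%nat <= r n).
  { intros n m. induction m as [|m IH]; [rewrite Nat.add_0_r; lra|].
    rewrite Nat.add_succ_r. specialize (Hr (n + m)%nat). lra. }
  assert (LR : forall n m, l n <= r m).
  { intros n m. specialize (ML n m). specialize (MR m n). specialize (Hlr (n + m)%nat).
    rewrite Nat.add_comm in MR. lra. }
  destruct (completeness (fun x => exists n, x = l n)) as [x [U1 U2]].
  - exists (r O). intros y [n ->]. apply LR.
  - exists (l O). now exists O.
  - exists x. intros n. split.
    + apply U1. now exists n.
    + apply U2. intros y [m ->]. apply LR.
Qed.

Lemma goursat (f : C -> C) (a b c d : R) : a <= b -> c <= d ->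
  (forall z, in_rect a b c d z -> cdiff f z) -> rint f a b c d = 0%C.
Proof.
  intros Hab Hcd Hf.
  apply NNPP. intros N.
  assert (Hpos : 0 < Cmod (rint f a b c d)) by now apply Cmod_gt_0.
  set (Q0 := Rect a b c d). set (L := half_perim Q0).
  assert (HL : 0 <= L) by (unfold L, half_perim, Q0; simpl; lra).
  (* The shift to [L + 1] keeps the denominator positive for a degenerate rectangle, and the factor
     2 makes the initial inequality strict. *)
  set (eta := Cmod (rint f a b c d) / (2 * (L + 1) ^ 2)).
  assert (P1 : 0 < (L + 1) ^ 2) by (apply pow_lt; lra).
  assert (Heta : 0 < eta) by (unfold eta; apply Rdiv_lt_0_compat; lra).
  assert (Hbad0 : eta * L ^ 2 < Cmod (qint f Q0)).
  { change (qint f Q0) with (rint f a b c d).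
    assert (E : eta * (2 * (L + 1) ^ 2) = Cmod (rint f a b c d)).
    { unfold eta. field. lra. }
    assert (L ^ 2 <= (L + 1) ^ 2) by (apply pow_incr; lra). nra. }
  set (B := bisect f eta Q0).
  assert (I : forall n, (xl (B n) <= xr (B n) /\ yl (B n) <= yr (B n)) /\
     (a <= xl (B n) /\ xr (B n) <= b /\ c <= yl (B n) /\ yr (B n) <= d) /\
     half_perim (B n) = L / 2 ^ n /\ eta * half_perim (B n) ^ 2 < Cmod (qint f (B n))).
  { induction n as [|n IH].
    - change (B O) with Q0. split; [simpl; lra|]. split; [simpl; lra|]. split; auto.
      unfold L. simpl. field.
    - destruct IH as [[X1 X2] [X3 [X4 X5]]].
      assert (Hc : ctn f (xl (B n)) (xr (B n)) (yl (B n)) (yr (B n))).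
      { intros z [Z1 Z2]. apply cdiff_ccont. apply Hf. unfold in_rect. lra. }
      destruct (pick_quarter_spec f eta (B n) X1 X2 Hc X5) as [[q1 [q2 E]] Hb].
      change (pick_quarter f eta (B n)) with (B (S n)) in E, Hb.
      replace (L / 2 ^ S n) with (half_perim (B n) / 2)
        by (rewrite X4; simpl; field; apply pow_nonzero; lra).
      split; [|split; [|split; auto]]; rewrite E; clear -X1 X2 X3; revert X1 X2 X3;
        generalize (B n); intros [p q s t]; simpl; intros;
        destruct q1, q2; unfold half_perim, quarter; simpl; lra. }
  assert (S1 : forall n, exists q1 q2, B (S n) = quarter q1 q2 (B n)).
  { intros n. destruct (I n) as [[X1 X2] [X3 [X4 X5]]].
    apply pick_quarter_spec; auto.
    intros z [Z1 Z2]. apply cdiff_ccont. apply Hf. unfold in_rect. lra. }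
  destruct (nested_interval (fun n => xl (B n)) (fun n => xr (B n)) 0) as [x Hx].
  { intros n. destruct (I n) as [[X1 X2] _]. destruct (S1 n) as [q1 [q2 E]]. rewrite E.
    destruct q1; unfold quarter; cbv zeta; simpl; lra. }
  { intros n. destruct (I n) as [[X1 X2] _]. destruct (S1 n) as [q1 [q2 E]]. rewrite E.
    destruct q1; unfold quarter; cbv zeta; simpl; lra. }
  { intros n. apply I. }
  destruct (nested_interval (fun n => yl (B n)) (fun n => yr (B n)) 0) as [y Hy].
  { intros n. destruct (I n) as [[X1 X2] _]. destruct (S1 n) as [q1 [q2 E]]. rewrite E.
    destruct q2; unfold quarter; cbv zeta; simpl; lra. }
  { intros n. destruct (I n) as [[X1 X2] _]. destruct (S1 n) as [q1 [q2 E]]. rewrite E.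
    destruct q2; unfold quarter; cbv zeta; simpl; lra. }
  { intros n. apply I. }
  set (z := (x, y) : C).
  assert (Hz : in_rect a b c d z).
  { unfold in_rect, z; simpl. specialize (Hx O). specialize (Hy O). simpl in *. lra. }
  destruct (Hf z Hz) as [l Hl].
  destruct (proj1 (cderiv_eps f z l) Hl (eta / 2)) as [dl [Dl K]]; [lra|].
  destruct (half_pow_small L dl Dl) as [n Hn].
  destruct (I n) as [[X1 X2] [X3 [X7 X8]]].
  set (Q := B n) in *.
  assert (Hd : forall w, in_rect (xl Q) (xr Q) (yl Q) (yr Q) w -> Cmod (w - z) <= half_perim Q).
  { intros w [W1 W2]. eapply Rle_trans; [apply Cmod_le_abs|].
    specialize (Hx n). specialize (Hy n). fold Q in Hx, Hy. unfold half_perim.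
    apply Rplus_le_compat; apply Rabs_le; unfold z; destruct w as [w1 w2]; simpl in *; lra. }
  assert (Hc : cont_bd f (xl Q) (xr Q) (yl Q) (yr Q)).
  { intros w [[W1 W2] _]. apply cdiff_ccont, Hf. unfold in_rect. lra. }
  (* The affine part of [f] at the common point [z] integrates to 0. What remains is at most eta / 2
     times the half perimeter, too small for a bad rectangle. *)
  set (g := fun w => (f w + - (1) * (f z + l * (w - z)))%C).
  assert (Ha : cont_bd (fun w => (f z + l * (w - z))%C) (xl Q) (xr Q) (yl Q) (yr Q)).
  { intros w _. apply ccont_plus; [apply ccont_const|]. apply ccont_mult; [apply ccont_const|].
    apply ccont_plus; [apply ccont_id|apply ccont_const]. }
  assert (Ha' : cont_bd (fun w => (- (1) * (f z + l * (w - z)))%C) (xl Q) (xr Q) (yl Q) (yr Q)).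
  { intros w Hw. apply ccont_mult; [apply ccont_const|]. now apply Ha. }
  assert (E : qint f Q = qint g Q).
  { unfold qint, g. rewrite (rint_plus f (fun w => (- (1) * (f z + l * (w - z)))%C)); auto.
    rewrite rint_Cmult; auto. rewrite rint_affine; auto. ring. }
  assert (Bd : Cmod (qint g Q) <= 2 * half_perim Q * (eta / 2 * half_perim Q)).
  { refine (rint_bound g (xl Q) (xr Q) (yl Q) (yr Q) (eta / 2 * half_perim Q) X1 X2 _ _).
    - intros w Hw. unfold g. apply ccont_plus; [now apply Hc|now apply Ha'].
    - intros w [Hw _]. unfold g. assert (D := Hd w Hw).
      replace (f w + - (1) * (f z + l * (w - z)))%C with (f w - f z - l * (w - z))%C by ring.
      eapply Rle_trans; [apply K; lra|]. apply Rmult_le_compat_l; lra. }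
  rewrite <- E in Bd. lra.
Qed.

(** * The maximum principle on rectangles *)

Lemma RInt_C_pos (g : R -> C) (p : C -> R) (a b : R) : p = Re \/ p = Im -> a < b ->
  (forall x, a <= x <= b -> continuous (U := C_R_CompleteNormedModule) g x) ->
  (forall x, a <= x <= b -> 0 < p (g x)) ->
  0 < p (RInt (V := C_R_CompleteNormedModule) g a b).
Proof.
  intros Hp Hab Hc Hg.
  assert (Hi : is_RInt (V := C_R_NormedModule) g a b (RInt (V := C_R_CompleteNormedModule) g a b)).
  { apply (RInt_correct (V := C_R_CompleteNormedModule)), ex_RInt_continuous.
    intros x. rewrite Rmin_left, Rmax_right by lra. auto. }
  destruct Hp as [-> | ->].
  - apply (is_RInt_fct_extend_fst (U := R_NormedModule) (V := R_NormedModule)) in Hi.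
    apply (is_RInt_unique (V := R_CompleteNormedModule)) in Hi.
    change (0 < fst (RInt (V := C_R_CompleteNormedModule) g a b)).
    apply Rlt_le_trans with (RInt (fun t => fst (g t)) a b); [|right; exact Hi].
    apply RInt_gt_0; auto.
    + intros x Hx. apply (Hg x). lra.
    + intros x Hx. apply (continuous_comp g (fun z : C => fst z)); [now apply Hc|].
      apply (continuous_fst (U := R_UniformSpace) (V := R_UniformSpace)).
  - apply (is_RInt_fct_extend_snd (U := R_NormedModule) (V := R_NormedModule)) in Hi.
    apply (is_RInt_unique (V := R_CompleteNormedModule)) in Hi.
    change (0 < snd (RInt (V := C_R_CompleteNormedModule) g a b)).
    apply Rlt_le_trans with (RInt (fun t => snd (g t)) a b); [|right; exact Hi].
    apply RInt_gt_0; auto.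
    + intros x Hx. apply (Hg x). lra.
    + intros x Hx. apply (continuous_comp g (fun z : C => snd z)); [now apply Hc|].
      apply (continuous_snd (U := R_UniformSpace) (V := R_UniformSpace)).
Qed.

Lemma Cinv_Re (z : C) : Re (/ z)%C = Re z / (Re z ^ 2 + Im z ^ 2).
Proof. reflexivity. Qed.

Lemma Cinv_Im (z : C) : Im (/ z)%C = - Im z / (Re z ^ 2 + Im z ^ 2).
Proof. reflexivity. Qed.

Lemma rint_ext (f g : C -> C) (a b c d : R) :
  (forall z, f z = g z) -> rint f a b c d = rint g a b c d.
Proof. intros H. now rewrite (functional_extensionality f g H). Qed.

Lemma sum_sqr_pos_l (x y : R) : x <> 0 -> 0 < x ^ 2 + y ^ 2.
Proof. intros H. assert (0 < x ^ 2) by (simpl; nra). nra. Qed.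

Lemma sum_sqr_pos_r (x y : R) : y <> 0 -> 0 < x ^ 2 + y ^ 2.
Proof. intros H. assert (0 < y ^ 2) by (simpl; nra). nra. Qed.

Definition interior (a b c d : R) (z : C) : Prop := a < Re z < b /\ c < Im z < d.

Lemma on_bd_neq (a b c d : R) (z w : C) :
  interior a b c d z -> on_bd a b c d w -> w <> z.
Proof. intros [H1 H2] [[_ _] H] ->. lra. Qed.

Lemma ccont_inv_minus (z0 z : C) : z <> z0 -> ccont (fun w => / (w - z0))%C z.
Proof.
  intros H. apply ccont_inv; [|now apply Cminus_neq_0].
  apply ccont_plus; [apply ccont_id|apply ccont_const].
Qed.

(** Each of the four edges contributes a positive amount to the imaginary part. Signs suffice here;
    the value of the integral is never computed. *)
Lemma rint_inv_nonzero (a b c d : R) (z0 : C) : interior a b c d z0 ->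
  rint (fun z => / (z - z0))%C a b c d <> 0%C.
Proof.
  intros Hz. assert (Hz' := Hz). destruct Hz as [Hx Hy]. set (k := fun z => (/ (z - z0))%C).
  assert (Cc : forall w, on_bd a b c d w -> ccont k w).
  { intros w Hw. apply ccont_inv_minus. eapply on_bd_neq; eauto. }
  assert (Cn : forall w, on_bd a b c d w -> ccont (fun w => - (1) * k w)%C w).
  { intros w Hw. apply ccont_mult; [apply ccont_const|auto]. }
  assert (O : forall x y, a <= x <= b -> c <= y <= d -> (x = a \/ x = b \/ y = c \/ y = d) ->
     on_bd a b c d (x, y)) by (intros; unfold on_bd, in_rect; simpl; lra).
  assert (P1 : 0 < Im (hint k c a b)).
  { apply RInt_C_pos; [now right|lra| |].
    - intros x Hx'. apply ccont_h, Cc, O; lra.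
    - intros x Hx'. unfold k. rewrite Cinv_Im. apply Rdiv_lt_0_compat.
      + destruct z0; simpl in *; lra.
      + apply sum_sqr_pos_r. destruct z0; simpl in *; lra. }
  assert (P2 : 0 < Re (vint k b c d)).
  { apply RInt_C_pos; [now left|lra| |].
    - intros x Hx'. apply ccont_v, Cc, O; lra.
    - intros x Hx'. unfold k. rewrite Cinv_Re. apply Rdiv_lt_0_compat.
      + destruct z0; simpl in *; lra.
      + apply sum_sqr_pos_l. destruct z0; simpl in *; lra. }
  assert (P3 : 0 < Im (hint (fun z => - (1) * k z)%C d a b)).
  { apply RInt_C_pos; [now right|lra| |].
    - intros x Hx'. apply (ccont_h (fun z => - (1) * k z)%C), Cn, O; lra.
    - intros x Hx'. replace (Im (- (1) * k (x, d))%C) with (- Im (k (x, d))) by (simpl; ring).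
      unfold k. rewrite Cinv_Im. apply Ropp_0_gt_lt_contravar.
      unfold Rdiv. rewrite <- Ropp_0, <- (Ropp_involutive (_ * / _)).
      apply Ropp_lt_contravar. rewrite Ropp_mult_distr_l, Ropp_involutive.
      apply Rdiv_lt_0_compat.
      + destruct z0; simpl in *; lra.
      + apply sum_sqr_pos_r. destruct z0; simpl in *; lra. }
  assert (P4 : 0 < Re (vint (fun z => - (1) * k z)%C a c d)).
  { apply RInt_C_pos; [now left|lra| |].
    - intros x Hx'. apply (ccont_v (fun z => - (1) * k z)%C), Cn, O; lra.
    - intros x Hx'. replace (Re (- (1) * k (a, x))%C) with (- Re (k (a, x))) by (simpl; ring).
      unfold k. rewrite Cinv_Re. unfold Rdiv. rewrite Ropp_mult_distr_l.
      apply Rdiv_lt_0_compat.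
      + destruct z0; simpl in *; lra.
      + apply sum_sqr_pos_l. destruct z0; simpl in *; lra. }
  unfold hint in P3. rewrite RInt_Cmult in P3
    by (apply ex_hint; [lra|]; intros x Hx'; apply Cc, O; lra).
  unfold vint in P4. rewrite RInt_Cmult in P4
    by (apply ex_vint; [lra|]; intros x Hx'; apply Cc, O; lra).
  fold (hint k d a b) in P3. fold (vint k a c d) in P4.
  intros E. apply (f_equal Im) in E. unfold rint in E.
  destruct (hint k c a b), (vint k b c d), (hint k d a b), (vint k a c d).
  simpl in *. lra.
Qed.

(** Squaring the numerator spares a theorem on removable singularities: if phi is the Caratheodory
    quotient of [f] at [z0], the function is phi^2 (w - z0) and so has derivative phi(z0)^2 there.
    Division by zero gives the right value 0 at [z0]. *)
Lemma cdiff_sqr_quot (f : C -> C) (z0 z : C) : cdiff f z -> cdiff f z0 ->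
  cdiff (fun w => (f w - f z0) ^ 2 / (w - z0))%C z.
Proof.
  intros Hf H0. destruct (classic (z = z0)) as [->|N].
  - destruct H0 as [l [phi [P1 [P2 P3]]]].
    exists (l * l)%C. exists (fun w => phi w * phi w)%C. split; [|split].
    + now apply ccont_mult.
    + now rewrite P2.
    + assert (E : forall w, ((f w - f z0) ^ 2 / (w - z0) = phi w * phi w * (w - z0))%C).
      { intros w. destruct (classic (w = z0)) as [->|N].
        - replace (f z0 - f z0)%C with (RtoC 0) by ring. unfold Cdiv. simpl. ring.
        - rewrite (P3 w). field. now apply Cminus_neq_0. }
      intros w. rewrite !E. ring.
  - apply cdiff_div.
    + apply (cdiff_pow (fun w => f w - f z0)%C). apply cdiff_minus; auto. apply cdiff_const.
    + apply cdiff_minus; [apply cdiff_id|apply cdiff_const].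
    + now apply Cminus_neq_0.
Qed.

Lemma interior_dist (a b c d : R) (z : C) : interior a b c d z ->
  exists r, 0 < r /\ forall w, on_bd a b c d w -> r <= Cmod (w - z).
Proof.
  intros [H1 H2].
  exists (Rmin (Rmin (Re z - a) (b - Re z)) (Rmin (Im z - c) (d - Im z))).
  assert (A := Rmin_l (Rmin (Re z - a) (b - Re z)) (Rmin (Im z - c) (d - Im z))).
  assert (B := Rmin_r (Rmin (Re z - a) (b - Re z)) (Rmin (Im z - c) (d - Im z))).
  assert (A1 := Rmin_l (Re z - a) (b - Re z)). assert (A2 := Rmin_r (Re z - a) (b - Re z)).
  assert (B1 := Rmin_l (Im z - c) (d - Im z)). assert (B2 := Rmin_r (Im z - c) (d - Im z)).
  split.
  - repeat apply Rmin_glb_lt; lra.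
  - intros w [_ Hw].
    assert (R1 := re_le_Cmod (w - z)). assert (R2 := im_le_Cmod (w - z)).
    rewrite Cminus_Re in R1.
    rewrite Cminus_Im in R2.
    assert (X1 := Rle_abs (Re w - Re z)). assert (X2 := Rle_abs (- (Re w - Re z))).
    rewrite Rabs_Ropp in X2.
    assert (Y1 := Rle_abs (Im w - Im z)). assert (Y2 := Rle_abs (- (Im w - Im z))).
    rewrite Rabs_Ropp in Y2.
    destruct Hw as [Hw|[Hw|[Hw|Hw]]]; lra.
Qed.

(** Goursat's theorem is applied to (f - F)^2 / (w - z0) with F = f(z0). Since (f - F)^2 = (f - 2F)
    f + F^2, this expresses F^2 times the integral of 1 / (w - z0) by boundary values. The resulting
    inequality x^2 <= B (M + 2x) M for x = |F| forces x <= (2B + 1) M, where B depends on the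
    rectangle and the point only. *)
Lemma weak_maximum (a b c d : R) (z0 : C) : interior a b c d z0 ->
  exists A, 0 <= A /\ forall f M, 0 <= M ->
    (forall z, in_rect a b c d z -> cdiff f z) ->
    (forall z, on_bd a b c d z -> Cmod (f z) <= M) -> Cmod (f z0) <= A * M.
Proof.
  intros Hz. destruct (interior_dist a b c d z0 Hz) as [r [Hr Hd]].
  set (D := Cmod (rint (fun z => / (z - z0))%C a b c d)).
  assert (HD : 0 < D) by (apply Cmod_gt_0; now apply rint_inv_nonzero).
  set (P := 2 * ((b - a) + (d - c))).
  assert (Hab : a <= b) by (destruct Hz; lra). assert (Hcd : c <= d) by (destruct Hz; lra).
  assert (HP : 0 <= P) by (unfold P; lra).
  set (B := P / r / D).
  assert (gap_bound : 0 <= B) by (unfold B; apply Rdiv_le_0_compat; auto; apply Rdiv_le_0_compat; auto).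
  exists (2 * B + 1). split; [lra|]. intros f M HM Hf Hbd.
  set (F := f z0).
  assert (Iz : in_rect a b c d z0) by (destruct Hz; unfold in_rect; lra).
  assert (G0 : rint (fun w => (f w - F) ^ 2 / (w - z0))%C a b c d = 0%C).
  { apply goursat; auto. intros z Hz'. apply cdiff_sqr_quot; auto. }
  set (k := fun z => (/ (z - z0))%C).
  set (u := fun w => ((f w - F - F) * f w * k w)%C).
  assert (Ck : cont_bd k a b c d).
  { intros w Hw. apply ccont_inv_minus. eapply on_bd_neq; eauto. }
  assert (Cf : cont_bd f a b c d) by (intros w [Hw _]; now apply cdiff_ccont, Hf).
  assert (Cu : cont_bd u a b c d).
  { intros w Hw. apply ccont_mult; auto. apply ccont_mult; auto.
    apply ccont_plus; [|apply ccont_const]. apply ccont_plus; [now apply Cf|apply ccont_const]. }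
  assert (CF : cont_bd (fun w => F * F * k w)%C a b c d).
  { intros w Hw. apply ccont_mult; auto. apply ccont_const. }
  assert (E : rint (fun w => (f w - F) ^ 2 / (w - z0))%C a b c d =
              (rint u a b c d + F * F * rint k a b c d)%C).
  { rewrite <- (rint_Cmult k (F * F) a b c d Hab Hcd Ck).
    rewrite <- (rint_plus u (fun w => F * F * k w)%C a b c d Hab Hcd Cu CF).
    apply rint_ext. intros z. unfold u, k, Cdiv. simpl. ring. }
  rewrite E in G0.
  assert (E2 : (F * F * rint k a b c d = - rint u a b c d)%C).
  { replace (F * F * rint k a b c d)%C with
     ((rint u a b c d + F * F * rint k a b c d) - rint u a b c d)%C by ring.
    rewrite G0. ring. }
  apply (f_equal Cmod) in E2. rewrite Cmod_opp, !Cmod_mult in E2. fold D in E2.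
  set (x := Cmod F) in *. assert (Hx : 0 <= x) by apply Cmod_ge_0.
  assert (Bu : Cmod (rint u a b c d) <= P * ((M + 2 * x) * M / r)).
  { refine (rint_bound u a b c d _ Hab Hcd Cu _). intros z Hz'. unfold u. rewrite !Cmod_mult.
    assert (K : Cmod (k z) <= / r).
    { unfold k. rewrite Cmod_inv by (apply Cminus_neq_0; eapply on_bd_neq; eauto).
      apply Rinv_le_contravar; auto. }
    assert (K0 := Cmod_ge_0 (k z)). assert (K1 := Cmod_ge_0 (f z)).
    assert (K2 : Cmod (f z - F - F) <= M + 2 * x).
    { eapply Rle_trans; [apply Cmod_minus_le|]. fold x.
      assert (T := Cmod_minus_le (f z) F). fold x in T. specialize (Hbd z Hz'). lra. }
    unfold Rdiv. apply Rmult_le_compat; auto.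
    - apply Rmult_le_pos; auto. apply Cmod_ge_0.
    - apply Rmult_le_compat; auto. apply Cmod_ge_0. }
  assert (Q : x * x <= B * ((M + 2 * x) * M)).
  { apply Rmult_le_reg_r with D; auto.
    replace (B * ((M + 2 * x) * M) * D) with (P * ((M + 2 * x) * M / r))
      by (unfold B; field; split; apply Rgt_not_eq; assumption). change (Cmod (rint k a b c d)) with D in E2. rewrite E2. exact Bu. }
  apply Rnot_lt_le. intros L.
  assert ((x - B * M) * (x - B * M) <= B * M * M + B * M * (B * M)) by nra.
  assert ((B + 1) * M < x - B * M) by lra.
  assert (0 <= B * M) by now apply Rmult_le_pos. nra.
Qed.

Lemma pow_bound (x A : R) : (forall n, x ^ n <= A) -> x <= 1.
Proof.
  intros H. apply Rnot_lt_le. intros Hx.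
  destruct (Pow_x_infinity x) with (b := A + 1) as [N HN].
  - rewrite Rabs_pos_eq; lra.
  - specialize (HN N (le_n N)). specialize (H N).
    rewrite Rabs_pos_eq in HN by (apply pow_le; lra). lra.
Qed.

(* Landau's trick: the constant of the weak bound disappears when it is applied to powers. *)
Lemma maximum_modulus (f : C -> C) (a b c d M : R) (z0 : C) : interior a b c d z0 ->
  (forall z, in_rect a b c d z -> cdiff f z) ->
  (forall z, on_bd a b c d z -> Cmod (f z) <= M) -> Cmod (f z0) <= M.
Proof.
  intros Hz Hf Hbd. destruct (weak_maximum a b c d z0 Hz) as [A [HA W]].
  assert (HM : 0 <= M).
  { apply Rle_trans with (2 := Hbd (a, c) ltac:(destruct Hz; unfold on_bd, in_rect; simpl; lra)).
    apply Cmod_ge_0. }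
  apply le_epsilon. intros eps He.
  assert (H : forall n, (Cmod (f z0) / (M + eps)) ^ n <= A).
  { intros n. unfold Rdiv. rewrite Rpow_mult_distr, pow_inv.
    assert (P : 0 < (M + eps) ^ n) by (apply pow_lt; lra).
    apply Rmult_le_reg_r with ((M + eps) ^ n); auto.
    rewrite Rmult_assoc, Rinv_l by lra. rewrite Rmult_1_r, <- Cmod_pow.
    apply (W (fun z => f z ^ n)%C); [lra| |].
    - intros z Hz'. now apply cdiff_pow, Hf.
    - intros z Hz'. rewrite Cmod_pow. apply pow_incr. split; [apply Cmod_ge_0|].
      specialize (Hbd z Hz'). lra. }
  apply pow_bound in H. apply Rmult_le_compat_r with (r := M + eps) in H; [|lra].
  unfold Rdiv in H. rewrite Rmult_assoc, Rinv_l in H by lra. lra.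
Qed.

(** * Schwarz' lemma on squares and uniform limits *)

Definition in_square (z0 : C) (r : R) (z : C) : Prop :=
  in_rect (Re z0 - r) (Re z0 + r) (Im z0 - r) (Im z0 + r) z.

Lemma in_square_Cmod (z0 z : C) (r : R) : Cmod (z - z0) <= r -> in_square z0 r z.
Proof.
  intros H. assert (R1 := re_le_Cmod (z - z0)). assert (R2 := im_le_Cmod (z - z0)).
  destruct z as [x y], z0 as [x0 y0]. unfold in_square, in_rect; simpl in *.
  apply Rle_trans with (r3 := r) in R1; auto. apply Rle_trans with (r3 := r) in R2; auto.
  apply Rabs_le_between in R1. apply Rabs_le_between in R2. lra.
Qed.

Lemma in_square_dist (z0 z : C) (r : R) : in_square z0 r z -> Cmod (z - z0) <= 2 * r.
Proof.
  intros [H1 H2]. eapply Rle_trans; [apply Cmod_le_abs|].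
  assert (A : Rabs (Re (z - z0)%C) <= r)
    by (apply Rabs_le; destruct z, z0; simpl in *; lra).
  assert (B : Rabs (Im (z - z0)%C) <= r)
    by (apply Rabs_le; destruct z, z0; simpl in *; lra).
  lra.
Qed.

(** The quotient q = f / (w - z0) is only known to extend continuously to [z0], but f q^n is
    differentiable there because [f] vanishes. The maximum principle for f q^n, with n tending to
    infinity, gives the bound for q. *)
Lemma schwarz_square (f : C -> C) (z0 : C) (r M : R) : 0 < r ->
  (forall z, in_square z0 r z -> cdiff f z) ->
  (forall z, in_square z0 r z -> Cmod (f z) <= M) -> f z0 = 0%C ->
  forall z, Cmod (z - z0) < r -> Cmod (f z) <= M / r * Cmod (z - z0).
Proof.
  intros Hr Hf HM H0 z Hz.
  assert (HM0 : 0 <= M).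
  { eapply Rle_trans; [apply Cmod_ge_0|]. apply (HM z0), in_square_Cmod.
    replace (z0 - z0)%C with (RtoC 0) by ring. rewrite Cmod_0; lra. }
  destruct (classic (z = z0)) as [->|N].
  { rewrite H0, Cmod_0. apply Rmult_le_pos; [|apply Cmod_ge_0].
    apply Rdiv_le_0_compat; auto. }
  assert (Hp := Cmod_minus_pos z z0 N).
  set (q := Cmod (f z) / Cmod (z - z0)).
  assert (Eq : Cmod (f z) = q * Cmod (z - z0)) by (unfold q; field; lra).
  assert (Hq : 0 <= q) by (apply Rdiv_le_0_compat; auto; apply Cmod_ge_0).
  assert (K : forall n, Cmod (f z) * q ^ n <= M * (M / r) ^ n).
  { intros n.
    set (g := fun w => (f w * (f w / (w - z0)) ^ n)%C).
    assert (Eg : Cmod (g z) = Cmod (f z) * q ^ n).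
    { unfold g. rewrite Cmod_mult, Cmod_pow, Cmod_div; auto. now apply Cminus_neq_0. }
    rewrite <- Eg.
    apply maximum_modulus with (a := Re z0 - r) (b := Re z0 + r) (c := Im z0 - r) (d := Im z0 + r).
    - assert (R1 := re_le_Cmod (z - z0)). assert (R2 := im_le_Cmod (z - z0)).
      apply Rle_lt_trans with (2 := Hz) in R1. apply Rle_lt_trans with (2 := Hz) in R2.
      apply Rabs_lt_between in R1. apply Rabs_lt_between in R2.
      destruct z as [x y], z0 as [x0 y0]. unfold interior; simpl in *. lra.
    - intros w Hw. destruct (classic (w = z0)) as [->|Nw].
      + destruct (Hf z0 Hw) as [l [phi [P1 [P2 P3]]]].
        exists (l * l ^ n)%C. exists (fun w => phi w * phi w ^ n)%C. split; [|split].
        * apply ccont_mult; auto. clear -P1. induction n as [|n IH]; simpl.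
          -- apply ccont_const.
          -- now apply (ccont_mult phi (fun w => phi w ^ n)%C).
        * now rewrite P2.
        * intros x. assert (G0 : g z0 = 0%C) by (unfold g; rewrite H0; ring).
          rewrite G0. destruct (classic (x = z0)) as [->|Nx].
          -- rewrite G0. ring.
          -- unfold g. replace (f x / (x - z0))%C with (phi x).
             ++ rewrite (P3 x), H0. ring.
             ++ rewrite (P3 x), H0. field. now apply Cminus_neq_0.
      + apply cdiff_mult; auto.
        apply (cdiff_pow (fun w => f w / (w - z0))%C). apply cdiff_div; auto.
        * apply cdiff_minus; [apply cdiff_id|apply cdiff_const].
        * now apply Cminus_neq_0.
    - intros w [Hw Hb]. unfold g. rewrite Cmod_mult, Cmod_pow.
      assert (Nw : w <> z0) by (intros ->; lra).
      assert (Dw : r <= Cmod (w - z0)).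
      { assert (R1 := re_le_Cmod (w - z0)). assert (R2 := im_le_Cmod (w - z0)).
        rewrite Cminus_Re in R1.
        rewrite Cminus_Im in R2.
        assert (X1 := Rle_abs (Re w - Re z0)). assert (X2 := Rle_abs (- (Re w - Re z0))).
        rewrite Rabs_Ropp in X2.
        assert (Y1 := Rle_abs (Im w - Im z0)). assert (Y2 := Rle_abs (- (Im w - Im z0))).
        rewrite Rabs_Ropp in Y2.
        destruct Hb as [Hb|[Hb|[Hb|Hb]]]; lra. }
      specialize (HM w Hw). assert (G := Cmod_ge_0 (f w)).
      apply Rmult_le_compat; auto; [apply pow_le, Cmod_ge_0|].
      apply pow_incr. split; [apply Cmod_ge_0|].
      rewrite Cmod_div by now apply Cminus_neq_0.
      unfold Rdiv. apply Rmult_le_compat; auto.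
      + left. apply Rinv_0_lt_compat. lra.
      + apply Rinv_le_contravar; auto. }
  rewrite Eq. apply Rmult_le_compat_r; [lra|].
  apply Rnot_lt_le. intros L.
  assert (HMr : 0 <= M / r) by (apply Rdiv_le_0_compat; auto).
  assert (Hqp : 0 < q) by lra.
  assert (Hfz : 0 < Cmod (f z)) by (rewrite Eq; now apply Rmult_lt_0_compat).
  destruct (Req_dec (M / r) 0) as [E0|E0].
  { specialize (K 1%nat). rewrite E0 in K. simpl in K. nra. }
  assert (B : q / (M / r) <= 1).
  { apply (pow_bound _ (M / Cmod (f z))). intros n. unfold Rdiv at 1.
    rewrite Rpow_mult_distr, pow_inv.
    assert (P : 0 < (M / r) ^ n) by (apply pow_lt; lra).
    apply Rmult_le_reg_r with ((M / r) ^ n); auto.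
    rewrite Rmult_assoc, Rinv_l, Rmult_1_r by lra.
    apply Rmult_le_reg_l with (Cmod (f z)); auto.
    replace (Cmod (f z) * (M / Cmod (f z) * (M / r) ^ n)) with (M * (M / r) ^ n)
      by (field; lra). apply K. }
  assert (M / r < q) by lra.
  apply Rmult_le_compat_r with (r := M / r) in B; [|lra].
  unfold Rdiv at 1 in B. rewrite Rmult_assoc, Rinv_l in B by lra. lra.
Qed.

(* Schwarz' lemma makes the difference quotients converge uniformly. *)
Lemma cdiff_limit (f : nat -> C -> C) (g : C -> C) (z0 : C) (r : R) : 0 < r ->
  (forall n z, in_square z0 r z -> cdiff (f n) z) ->
  (forall eps, 0 < eps -> exists N, forall n z, (N <= n)%nat -> in_square z0 r z ->
     Cmod (f n z - g z) <= eps) ->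
  cdiff g z0.
Proof.
  intros Hr Hf Hu.
  assert (I0 : in_square z0 r z0).
  { apply in_square_Cmod. replace (z0 - z0)%C with (RtoC 0) by ring. rewrite Cmod_0; lra. }
  assert (Q : forall eps, 0 < eps -> exists N, forall n m z, (N <= n)%nat -> (N <= m)%nat ->
     Cmod (z - z0) < r ->
     Cmod ((f n z - f n z0) - (f m z - f m z0)) <= eps * Cmod (z - z0)).
  { intros eps He. destruct (Hu (eps * r / 4)) as [N HN].
    { assert (0 < eps * r) by now apply Rmult_lt_0_compat. lra. }
    exists N. intros n m z Hn Hm Hz.
    set (h := fun w => ((f n w - f n z0) - (f m w - f m z0))%C).
    replace (eps * Cmod (z - z0)) with (eps * r / r * Cmod (z - z0)) by (field; lra).
    apply (schwarz_square h z0 r (eps * r)); auto.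
    - intros w Hw. apply cdiff_minus; (apply cdiff_minus; [now apply Hf|apply cdiff_const]).
    - intros w Hw. unfold h.
      replace (f n w - f n z0 - (f m w - f m z0))%C with
        ((f n w - g w) - (f m w - g w) - ((f n z0 - g z0) - (f m z0 - g z0)))%C by ring.
      eapply Rle_trans; [apply Cmod_minus_le|].
      assert (T1 := Cmod_minus_le (f n w - g w) (f m w - g w)).
      assert (T2 := Cmod_minus_le (f n z0 - g z0) (f m z0 - g z0)).
      assert (A1 := HN n w Hn Hw). assert (A2 := HN m w Hm Hw).
      assert (A3 := HN n z0 Hn I0). assert (A4 := HN m z0 Hm I0). lra.
    - unfold h. ring. }
  assert (Q' : forall eps, 0 < eps -> exists N, forall n z, (N <= n)%nat ->
     Cmod (z - z0) < r ->
     Cmod ((f n z - f n z0) - (g z - g z0)) <= eps * Cmod (z - z0)).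
  { intros eps He. destruct (Q eps He) as [N HN]. exists N. intros n z Hn Hz.
    apply le_epsilon. intros e Hee. destruct (Hu (e / 2)) as [N' HN']; [lra|].
    set (m := Nat.max N N'). specialize (HN n m z Hn (Nat.le_max_l _ _) Hz).
    assert (A := HN' m z (Nat.le_max_r _ _) (in_square_Cmod z0 z r ltac:(lra))).
    assert (B := HN' m z0 (Nat.le_max_r _ _) I0).
    replace (f n z - f n z0 - (g z - g z0))%C with
      ((f n z - f n z0 - (f m z - f m z0)) + ((f m z - g z) - (f m z0 - g z0)))%C by ring.
    eapply Rle_trans; [apply Cmod_triangle|].
    assert (T := Cmod_minus_le (f m z - g z) (f m z0 - g z0)). lra. }
  assert (HL : exists L : nat -> C, forall n, cderiv (f n) z0 (L n)).
  { exists (fun n => proj1_sig (constructive_indefinite_description _ (Hf n z0 I0))).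
    intros n. apply proj2_sig. }
  destruct HL as [L HL].
  set (phi := fun w => match excluded_middle_informative (w = z0) with
                       | left _ => RtoC 0 | right _ => ((g w - g z0) / (w - z0))%C end).
  assert (D : forall n eps, 0 < eps -> exists d, 0 < d /\ forall w, Cmod (w - z0) < d ->
    Cmod (f n w - f n z0 - L n * (w - z0)) <= eps * Cmod (w - z0)).
  { intros n. apply cderiv_eps. auto. }
  (* The derivatives form a Cauchy sequence: both are compared with difference quotients at one
     point [w] close to [z0], where [Q] bounds the difference of the quotients. *)
  assert (CL : forall eps, 0 < eps -> exists N, forall n m, (N <= n)%nat -> (N <= m)%nat ->
     Cmod (L n - L m) <= eps).
  { intros eps He. destruct (Q (eps / 2)) as [N HN]; [lra|]. exists N. intros n m Hn Hm.
    destruct (D n (eps / 4)) as [d1 [D1 K1]]; [lra|].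
    destruct (D m (eps / 4)) as [d2 [D2 K2]]; [lra|].
    set (t := Rmin (Rmin d1 d2) r / 2).
    assert (T0 : 0 < Rmin (Rmin d1 d2) r) by (repeat apply Rmin_glb_lt; auto).
    assert (A := Rmin_l (Rmin d1 d2) r). assert (B := Rmin_r (Rmin d1 d2) r).
    assert (A' := Rmin_l d1 d2). assert (B' := Rmin_r d1 d2).
    set (w := (z0 + RtoC t)%C).
    assert (E : Cmod (w - z0) = t).
    { unfold w. replace (z0 + RtoC t - z0)%C with (RtoC t) by ring.
      rewrite Cmod_R. apply Rabs_pos_eq. unfold t; lra. }
    assert (t < d1 /\ t < d2 /\ t < r /\ 0 < t) as [T1 [T2 [T3 T4]]] by (unfold t; lra).
    specialize (HN n m w Hn Hm ltac:(lra)). specialize (K1 w ltac:(lra)).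
    specialize (K2 w ltac:(lra)). rewrite E in HN, K1, K2.
    assert (X : Cmod ((L n - L m) * (w - z0)) <= eps * t).
    { replace ((L n - L m) * (w - z0))%C with
       ((f n w - f n z0 - (f m w - f m z0)) - ((f n w - f n z0 - L n * (w - z0))
          - (f m w - f m z0 - L m * (w - z0))))%C by ring.
      eapply Rle_trans; [apply Cmod_minus_le|].
      assert (T := Cmod_minus_le (f n w - f n z0 - L n * (w - z0))
         (f m w - f m z0 - L m * (w - z0))). lra. }
    rewrite Cmod_mult, E in X. apply Rmult_le_reg_r in X; auto. }
  assert (HC : exists l, forall eps, 0 < eps -> exists N, forall n, (N <= n)%nat ->
     Cmod (L n - l) <= eps).
  { assert (C1 : Cauchy_crit (fun n => Re (L n))).
    { intros eps He. destruct (CL (eps / 2)) as [N HN]; [lra|]. exists N. intros n m Hn Hm.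
      specialize (HN n m Hn Hm). assert (T := re_le_Cmod (L n - L m)).
      unfold R_dist. rewrite Cminus_Re in T. lra. }
    assert (C2 : Cauchy_crit (fun n => Im (L n))).
    { intros eps He. destruct (CL (eps / 2)) as [N HN]; [lra|]. exists N. intros n m Hn Hm.
      specialize (HN n m Hn Hm). assert (T := im_le_Cmod (L n - L m)).
      unfold R_dist. rewrite Cminus_Im in T. lra. }
    destruct (Rcomplete.R_complete _ C1) as [l1 H1]. destruct (Rcomplete.R_complete _ C2) as [l2 H2].
    exists (l1, l2). intros eps He.
    destruct (H1 (eps / 2)) as [N1 K1]; [lra|]. destruct (H2 (eps / 2)) as [N2 K2]; [lra|].
    exists (Nat.max N1 N2). intros n Hn. eapply Rle_trans; [apply Cmod_le_abs|].
    specialize (K1 n ltac:(lia)). specialize (K2 n ltac:(lia)). unfold R_dist in K1, K2.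
    rewrite Cminus_Re.
    rewrite Cminus_Im. simpl. lra. }
  destruct HC as [l Hl]. exists l. apply cderiv_eps. intros eps He.
  destruct (Hl (eps / 3)) as [N1 K1]; [lra|]. destruct (Q' (eps / 3)) as [N2 K2]; [lra|].
  set (n := Nat.max N1 N2). destruct (D n (eps / 3)) as [d [Dd K3]]; [lra|].
  exists (Rmin d r). split; [now apply Rmin_glb_lt|]. intros w Hw.
  assert (A := Rmin_l d r). assert (B := Rmin_r d r).
  specialize (K1 n (Nat.le_max_l _ _)). specialize (K2 n w (Nat.le_max_r _ _) ltac:(lra)).
  specialize (K3 w ltac:(lra)).
  replace (g w - g z0 - l * (w - z0))%C with
    ((f n w - f n z0 - L n * (w - z0)) - (f n w - f n z0 - (g w - g z0)) + (L n - l) * (w - z0))%C by ring.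
  eapply Rle_trans; [apply Cmod_triangle|].
  eapply Rle_trans; [apply Rplus_le_compat_r, Cmod_minus_le|].
  rewrite Cmod_mult. assert (P := Cmod_ge_0 (w - z0)). nra.
Qed.

(** * Real functions with finitely many points over 0, 1 and infinity *)

Definition inE (l : list R) (z : C) : Prop := exists x, In x l /\ z = RtoC x.

(* To be read with Y = G(1-G)/G'. *)
Definition dist_ratio (G : C -> Chat) (Y : C -> C) (z : C) : R :=
  Cmod (Y z) / Rmax 1 (Cmod (finite_part G z)).

(* [v] is at most twice the inverse density at [x] of the hyperbolic metric of the
   component of [R \ l] containing [x]. *)
Definition gap_bound (l : list R) (x v : R) : Prop :=
  (forall a b, In a l -> In b l -> a < x < b -> v * (b - a) <= 2 * ((x - a) * (b - x))) /\
  (forall a, In a l -> (forall b, In b l -> b < x) -> v <= 2 * (x - a)) /\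
  (forall a, In a l -> (forall b, In b l -> x < b) -> v <= 2 * (a - x)).

(* [l] are the finite points over 0, 1, infinity; infinity is a further such point.
   [Y] stands for G(1-G)/G'. *)
Record admissible (G : C -> Chat) (Y : C -> C) (l : list R) : Prop := {
  ok_omit : forall z, ~ inE l z -> ~ zero_one_infty (G z);
  ok_E : forall z, inE l z -> zero_one_infty (G z);
  ok_diff : forall z, G z <> CInfinity -> cdiff (finite_part G) z;
  ok_pole : forall z, G z = CInfinity -> forall M, exists d, 0 < d /\
    forall w, 0 < Cmod (w - z) < d -> M <= Cmod (finite_part G w);
  ok_Y : forall z, ~ inE l z -> cdiff Y z /\ Y z <> 0%C;
  ok_HB : forall x, ~ In x l -> gap_bound l x (dist_ratio G Y (RtoC x));
  ok_near : forall x, In x l -> exists K d, 0 < d /\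
    forall z, 0 < Cmod (z - RtoC x) < d -> dist_ratio G Y z <= K * Cmod (z - RtoC x);
  ok_inf : exists K r, forall z, r <= Cmod z -> dist_ratio G Y z <= K * Cmod z;
  ok_Ginf : forall M, exists r, forall z, r <= Cmod z -> M <= Cmod (finite_part G z);
  ok_l : forall x, In x l -> -1 <= x <= 1
}.

(** G composed with [f]. The poles of [f] are passed separately because [f] takes values in C and
    has a meaningless value there; G is infinite at infinity. *)
Definition pullG (G : C -> Chat) (f : C -> C) (pole : C -> Prop) (z : C) : Chat :=
  match excluded_middle_informative (pole z) with
  | left _ => CInfinity
  | right _ => G (f z)
  end.

(** The chain rule for G(1-G)/G'. Hence [dist_ratio] is transformed by division by |f'|, like an
    inverse density of a conformal metric. *)
Definition pullY (Y f f' : C -> C) (z : C) : C := (Y (f z) / f' z)%C.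

(** What a change of variable must satisfy to preserve [admissible]: critical points and poles occur
    only over [l] and infinity, and at the points of [l'], at poles and at infinity the logarithmic
    derivative of [f] is at least of the order of an inverse distance. *)
Record pullable (f f' : C -> C) (pole : C -> Prop) (l l' : list R) : Prop := {
  pb_pole : forall z, pole z -> inE l' z;
  pb_open : forall z, ~ pole z -> exists d, 0 < d /\
    forall w, Cmod (w - z) < d -> ~ pole w;
  pb_f : forall z, ~ pole z -> cderiv f z (f' z);
  pb_f' : forall z, ~ inE l' z -> cdiff f' z /\ f' z <> 0%C;
  pb_E : forall z, ~ pole z -> (inE l' z <-> inE l (f z));
  pb_HB : forall x, ~ In x l' -> exists y, f (RtoC x) = RtoC y /\
    forall v, gap_bound l y v -> gap_bound l' x (v / Cmod (f' (RtoC x)));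
  pb_near : forall x, In x l' -> ~ pole (RtoC x) -> exists K d, 0 < d /\
    forall z, 0 < Cmod (z - RtoC x) < d ->
      0 < Cmod (f z - f (RtoC x)) <= K * (Cmod (f' z) * Cmod (z - RtoC x));
  pb_pnear : forall z0, pole z0 -> (exists K d, 0 < d /\
    forall z, 0 < Cmod (z - z0) < d -> ~ pole z /\
      Cmod (f z) <= K * (Cmod (f' z) * Cmod (z - z0)));
  pb_pinf : forall z0, pole z0 -> forall M, exists d, 0 < d /\
    forall z, 0 < Cmod (z - z0) < d -> M <= Cmod (f z);
  pb_inf : exists K r, forall z, r <= Cmod z -> ~ pole z /\
      Cmod (f z) <= K * (Cmod (f' z) * Cmod z);
  pb_infinf : forall M, exists r, forall z, r <= Cmod z -> M <= Cmod (f z);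
  pb_l : forall x, In x l' -> -1 <= x <= 1
}.

Lemma mm_ge_0 (G : C -> Chat) (Y : C -> C) (z : C) : 0 <= dist_ratio G Y z.
Proof.
  apply Rdiv_le_0_compat; [apply Cmod_ge_0|].
  apply Rlt_le_trans with (2 := Rmax_l _ _). lra.
Qed.

Lemma pullG_fp (G : C -> Chat) (f : C -> C) (pole : C -> Prop) (z : C) :
  ~ pole z -> finite_part (pullG G f pole) z = finite_part G (f z).
Proof.
  intros H. unfold finite_part, pullG.
  destruct (excluded_middle_informative (pole z)); [contradiction|reflexivity].
Qed.

Lemma pullG_eq (G : C -> Chat) (f : C -> C) (pole : C -> Prop) (z : C) :
  ~ pole z -> pullG G f pole z = G (f z).
Proof.
  intros H. unfold pullG.
  destruct (excluded_middle_informative (pole z)); [contradiction|reflexivity].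
Qed.

Lemma inE_dec_near (l : list R) (z : C) : exists d, 0 < d /\
  forall w, 0 < Cmod (w - z) < d -> ~ inE l w.
Proof.
  induction l as [|x l [d [Hd H]]].
  - exists 1. split; [lra|]. intros w _ [x [[] _]].
  - destruct (classic (RtoC x = z)) as [E|N].
    + exists d. split; auto. intros w Hw [y [[<-|Hy] ->]].
      * rewrite E in Hw. replace (z - z)%C with (RtoC 0) in Hw by ring.
        rewrite Cmod_0 in Hw. lra.
      * apply (H _ Hw). now exists y.
    + exists (Rmin d (Cmod (RtoC x - z))).
      split; [apply Rmin_glb_lt; auto; now apply Cmod_minus_pos|].
      intros w Hw [y [[<-|Hy] ->]].
      * assert (T := Rmin_r d (Cmod (RtoC x - z))). lra.
      * apply (H (RtoC y)); [|now exists y].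
        assert (T := Rmin_l d (Cmod (RtoC x - z))). lra.
Qed.

Section Pullback.
Variables (G : C -> Chat) (Y f f' : C -> C) (pole : C -> Prop) (l l' : list R).
Hypotheses (HG : admissible G Y l) (HP : pullable f f' pole l l').
Let G' := pullG G f pole.
Let Y' := pullY Y f f'.

Lemma pull_mm (z : C) : ~ pole z -> f' z <> 0%C ->
  dist_ratio G' Y' z = dist_ratio G Y (f z) / Cmod (f' z).
Proof.
  intros Hp Hf. unfold dist_ratio, G', Y', pullY. rewrite pullG_fp by auto.
  rewrite Cmod_div by auto. field. split.
  - apply Rgt_not_eq, Rlt_le_trans with (2 := Rmax_l _ _). lra.
  - apply Rgt_not_eq. now apply Cmod_gt_0.
Qed.

Lemma pull_f_cont (z : C) : ~ pole z -> ccont f z.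
Proof. intros H. apply cdiff_ccont. exists (f' z). now apply (pb_f _ _ _ _ _ HP). Qed.

Lemma pull_pole_spec (z : C) : G' z = CInfinity -> forall M, exists d, 0 < d /\
    forall w, 0 < Cmod (w - z) < d -> M <= Cmod (finite_part G' w).
Proof.
  intros Hz M. destruct (classic (pole z)) as [Hp|Hp].
  - destruct (ok_Ginf _ _ _ HG M) as [r Hr].
    destruct (pb_pinf _ _ _ _ _ HP z Hp r) as [d1 [D1 K1]].
    destruct (pb_pnear _ _ _ _ _ HP z Hp) as [K [d2 [D2 K2]]].
    exists (Rmin d1 d2). split; [now apply Rmin_glb_lt|]. intros w Hw.
    assert (A := Rmin_l d1 d2). assert (B := Rmin_r d1 d2).
    unfold G'. rewrite pullG_fp by (apply K2; lra). apply Hr, K1. lra.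
  - unfold G' in Hz. rewrite pullG_eq in Hz by auto.
    assert (Hl : inE l (f z)).
    { apply NNPP. intros N. apply (ok_omit _ _ _ HG _ N). rewrite Hz. unfold zero_one_infty; auto. }
    destruct (ok_pole _ _ _ HG _ Hz M) as [d1 [D1 K1]].
    destruct (pull_f_cont z Hp d1 D1) as [d2 [D2 K2]].
    destruct (pb_open _ _ _ _ _ HP z Hp) as [d3 [D3 K3]].
    apply (pb_E _ _ _ _ _ HP) in Hl; auto. destruct Hl as [x [Hx Ex]]. subst z.
    destruct (pb_near _ _ _ _ _ HP x Hx Hp) as [K [d4 [D4 K4]]].
    exists (Rmin (Rmin d2 d3) d4). split; [repeat apply Rmin_glb_lt; auto|]. intros w Hw.
    assert (A := Rmin_l (Rmin d2 d3) d4). assert (B := Rmin_r (Rmin d2 d3) d4).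
    assert (A' := Rmin_l d2 d3). assert (B' := Rmin_r d2 d3).
    unfold G'. rewrite pullG_fp by (apply K3; lra). apply K1. split.
    + apply K4. lra.
    + apply K2. lra.
Qed.

Lemma pull_diff_spec (z : C) : G' z <> CInfinity -> cdiff (finite_part G') z.
Proof.
  intros Hz. destruct (classic (pole z)) as [Hp|Hp].
  - exfalso. apply Hz. unfold G', pullG.
    destruct (excluded_middle_informative (pole z)); [reflexivity|contradiction].
  - unfold G' in Hz. rewrite pullG_eq in Hz by auto.
    destruct (pb_open _ _ _ _ _ HP z Hp) as [d [D K]].
    apply cdiff_ext_loc with (f := fun w => finite_part G (f w)) (r := d); auto.
    + intros w Hw. unfold G'. rewrite pullG_fp; auto.
    + apply cdiff_comp; [|now apply (ok_diff _ _ _ HG)].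
      exists (f' z). now apply (pb_f _ _ _ _ _ HP).
Qed.

Lemma pull_near_spec (x : R) : In x l' -> exists K d, 0 < d /\
    forall z, 0 < Cmod (z - RtoC x) < d -> dist_ratio G' Y' z <= K * Cmod (z - RtoC x).
Proof.
  intros Hx. destruct (inE_dec_near l' (RtoC x)) as [d0 [D0 K0]].
  (* At a pole of [f] the estimate for [G] at infinity is pulled back, elsewhere the one near the
     point [f x] of [l]. *)
  destruct (classic (pole (RtoC x))) as [Hp|Hp].
  - destruct (ok_inf _ _ _ HG) as [K [r Hr]].
    destruct (pb_pinf _ _ _ _ _ HP _ Hp r) as [d1 [D1 K1]].
    destruct (pb_pnear _ _ _ _ _ HP _ Hp) as [K' [d2 [D2 K2]]].
    exists (Rmax 0 K * K'), (Rmin (Rmin d1 d2) d0). split; [repeat apply Rmin_glb_lt; auto|].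
    intros w Hw.
    assert (A := Rmin_l (Rmin d1 d2) d0). assert (B := Rmin_r (Rmin d1 d2) d0).
    assert (A' := Rmin_l d1 d2). assert (B' := Rmin_r d1 d2).
    destruct (K2 w ltac:(lra)) as [Hpw Hw2].
    assert (Hf0 : f' w <> 0%C) by (apply (pb_f' _ _ _ _ _ HP), K0; lra).
    rewrite pull_mm by auto.
    assert (P := proj1 (Cmod_gt_0 _) Hf0). apply Rle_div_l; auto.
    assert (X := Hr (f w) (K1 w ltac:(lra))).
    apply Rle_trans with (1 := X).
    assert (M0 := Rmax_l 0 K). assert (M1 := Rmax_r 0 K). assert (Q := Cmod_ge_0 (f w)). nra.
  - destruct (pb_near _ _ _ _ _ HP x Hx Hp) as [K' [d2 [D2 K2]]].
    assert (Hl : inE l (f (RtoC x))) by (apply (pb_E _ _ _ _ _ HP); auto; now exists x).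
    destruct Hl as [y [Hy Ey]].
    destruct (ok_near _ _ _ HG y Hy) as [K [d1 [D1 K1]]].
    destruct (pull_f_cont _ Hp d1 D1) as [d3 [D3 K3]].
    destruct (pb_open _ _ _ _ _ HP _ Hp) as [d4 [D4 K4]].
    exists (Rmax 0 K * K'), (Rmin (Rmin d2 d3) (Rmin d4 d0)).
    split; [repeat apply Rmin_glb_lt; auto|]. intros w Hw.
    assert (A := Rmin_l (Rmin d2 d3) (Rmin d4 d0)). assert (B := Rmin_r (Rmin d2 d3) (Rmin d4 d0)).
    assert (A' := Rmin_l d2 d3). assert (B' := Rmin_r d2 d3).
    assert (A'' := Rmin_l d4 d0). assert (B'' := Rmin_r d4 d0).
    assert (Hf0 : f' w <> 0%C) by (apply (pb_f' _ _ _ _ _ HP), K0; lra).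
    rewrite pull_mm by (auto; apply K4; lra).
    assert (P := proj1 (Cmod_gt_0 _) Hf0). apply Rle_div_l; auto.
    destruct (K2 w ltac:(lra)) as [X1 X2]. specialize (K3 w ltac:(lra)).
    rewrite Ey in X1, X2, K3. specialize (K1 (f w) ltac:(lra)).
    apply Rle_trans with (1 := K1).
    assert (M0 := Rmax_l 0 K). assert (M1 := Rmax_r 0 K). nra.
Qed.

Lemma pull_inf_spec : exists K r, forall z, r <= Cmod z -> dist_ratio G' Y' z <= K * Cmod z.
Proof.
  destruct (ok_inf _ _ _ HG) as [K [r Hr]].
  destruct (pb_inf _ _ _ _ _ HP) as [K' [r1 H1]].
  destruct (pb_infinf _ _ _ _ _ HP r) as [r2 H2].
  exists (Rmax 0 K * K'), (Rmax 2 (Rmax r1 r2)). intros w Hw.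
  assert (A := Rmax_l 2 (Rmax r1 r2)). assert (B := Rmax_r 2 (Rmax r1 r2)).
  assert (A' := Rmax_l r1 r2). assert (B' := Rmax_r r1 r2).
  destruct (H1 w ltac:(lra)) as [Hp X].
  assert (Hf0 : f' w <> 0%C).
  { apply (pb_f' _ _ _ _ _ HP). intros [x [Hx ->]].
    apply (pb_l _ _ _ _ _ HP) in Hx. rewrite Cmod_R in *.
    assert (Rabs x <= 1) by (apply Rabs_le; lra). lra. }
  rewrite pull_mm by auto.
  assert (P := proj1 (Cmod_gt_0 _) Hf0). apply Rle_div_l; auto.
  assert (X2 := Hr (f w) (H2 w ltac:(lra))). apply Rle_trans with (1 := X2).
  assert (M0 := Rmax_l 0 K). assert (M1 := Rmax_r 0 K). assert (Q := Cmod_ge_0 (f w)). nra.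
Qed.

Lemma pull_admissible : admissible G' Y' l'.
Proof.
  constructor.
  - intros z Hz. assert (Hp : ~ pole z) by (intros H; now apply Hz, (pb_pole _ _ _ _ _ HP)).
    unfold G'. rewrite pullG_eq by auto. apply (ok_omit _ _ _ HG).
    intros H. now apply Hz, (pb_E _ _ _ _ _ HP).
  - intros z Hz. destruct (classic (pole z)) as [Hp|Hp].
    + unfold G', pullG. destruct (excluded_middle_informative (pole z)); [|contradiction].
      unfold zero_one_infty; auto.
    + unfold G'. rewrite pullG_eq by auto. apply (ok_E _ _ _ HG).
      now apply (pb_E _ _ _ _ _ HP).
  - exact pull_diff_spec.
  - exact pull_pole_spec.
  - intros z Hz. assert (Hp : ~ pole z) by (intros H; now apply Hz, (pb_pole _ _ _ _ _ HP)).
    destruct (pb_f' _ _ _ _ _ HP z Hz) as [Hd Hn].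
    assert (Hl : ~ inE l (f z)) by (intros H; now apply Hz, (pb_E _ _ _ _ _ HP)).
    destruct (ok_Y _ _ _ HG _ Hl) as [Y1 Y2]. split.
    + apply cdiff_div; auto. apply cdiff_comp; auto.
      exists (f' z). now apply (pb_f _ _ _ _ _ HP).
    + unfold Y', pullY. intros E. apply Y2.
      replace (Y (f z)) with (Y (f z) / f' z * f' z)%C by (field; auto). rewrite E. ring.
  - intros x Hx. destruct (pb_HB _ _ _ _ _ HP x Hx) as [y [E H]].
    assert (Hz : ~ inE l' (RtoC x)).
    { intros [x' [H1 H2]]. apply RtoC_inj in H2. now subst. }
    assert (Hp : ~ pole (RtoC x)) by (intros K; now apply Hz, (pb_pole _ _ _ _ _ HP)).
    rewrite pull_mm by (auto; apply (pb_f' _ _ _ _ _ HP); auto).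
    rewrite E. apply H, (ok_HB _ _ _ HG). intros Hy. apply Hz.
    apply (pb_E _ _ _ _ _ HP); auto. rewrite E. now exists y.
  - exact pull_near_spec.
  - exact pull_inf_spec.
  - intros M. destruct (ok_Ginf _ _ _ HG M) as [r Hr].
    destruct (pb_inf _ _ _ _ _ HP) as [K' [r1 H1]].
    destruct (pb_infinf _ _ _ _ _ HP r) as [r2 H2].
    exists (Rmax r1 r2). intros z Hz.
    assert (A' := Rmax_l r1 r2). assert (B' := Rmax_r r1 r2).
    unfold G'. rewrite pullG_fp by (apply H1; lra). apply Hr, H2. lra.
  - exact (pb_l _ _ _ _ _ HP).
Qed.
End Pullback.

(** * Doubling a gap *)

(** [gap_bound] for a predicate instead of a list, so that translations and reflections act by
    composition. For membership in [l] it is [gap_bound l] by conversion. *)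
Definition gap_bound_of (P : R -> Prop) (x v : R) : Prop :=
  (forall a b, P a -> P b -> a < x < b -> v * (b - a) <= 2 * ((x - a) * (b - x))) /\
  (forall a, P a -> (forall b, P b -> b < x) -> v <= 2 * (x - a)) /\
  (forall a, P a -> (forall b, P b -> x < b) -> v <= 2 * (a - x)).

Lemma gap_bound_of_nonpos (P : R -> Prop) (x v : R) : v <= 0 -> gap_bound_of P x v.
Proof.
  intros Hv. split; [|split].
  - intros a b _ _ H. assert (0 <= (x - a) * (b - x)) by nra. nra.
  - intros a Ha H. specialize (H a Ha). lra.
  - intros a Ha H. specialize (H a Ha). lra.
Qed.

Lemma gap_bound_of_affine (P : R -> Prop) (e s x v : R) : e * e = 1 ->
  gap_bound_of P x v -> gap_bound_of (fun c => P (s + e * c)) (e * (x - s)) v.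
Proof.
  intros He [H1 [H2 H3]].
  assert (E : e = 1 \/ e = -1).
  { destruct (Rle_or_lt 0 e); [left; nra|right; nra]. }
  assert (Q : forall b, P b -> P (s + e * (e * (b - s)))).
  { intros b. replace (s + e * (e * (b - s))) with b; auto.
    replace (e * (e * (b - s))) with (e * e * (b - s)) by ring. rewrite He. ring. }
  destruct E as [-> | ->]; (split; [|split]).
  - intros a b Ha Hb H. assert (K := H1 _ _ Ha Hb ltac:(lra)). lra.
  - intros a Ha H. assert (K := H2 _ Ha). apply Rle_trans with (1 := K ltac:(intros b Hb; specialize (H _ (Q b Hb)); lra)). lra.
  - intros a Ha H. assert (K := H3 _ Ha). apply Rle_trans with (1 := K ltac:(intros b Hb; specialize (H _ (Q b Hb)); lra)). lra.
  - intros a b Ha Hb H. assert (K := H1 _ _ Hb Ha ltac:(lra)). lra.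
  - intros a Ha H. assert (K := H3 _ Ha). apply Rle_trans with (1 := K ltac:(intros b Hb; specialize (H _ (Q b Hb)); lra)). lra.
  - intros a Ha H. assert (K := H2 _ Ha). apply Rle_trans with (1 := K ltac:(intros b Hb; specialize (H _ (Q b Hb)); lra)). lra.
Qed.

(** The bound for (a, b) implies v <= 2 (b - x), which pays for moving the left end away. So it
    suffices to treat points close to [x]. *)
Lemma gap_bound_of_mono_l (v x a a1 b : R) : 0 <= v -> a1 <= a < x -> x < b ->
  v * (b - a) <= 2 * ((x - a) * (b - x)) -> v * (b - a1) <= 2 * ((x - a1) * (b - x)).
Proof.
  intros Hv H1 H2 H.
  assert (v <= 2 * (b - x)).
  { assert (v * (x - a) <= 2 * (b - x) * (x - a)) by nra.
    apply Rmult_le_reg_r with (x - a); lra. }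
  assert (v * (a - a1) <= 2 * (b - x) * (a - a1)) by (apply Rmult_le_compat_r; lra). lra.
Qed.

Lemma gap_bound_of_mono_r (v x a b b1 : R) : 0 <= v -> a < x -> x < b <= b1 ->
  v * (b - a) <= 2 * ((x - a) * (b - x)) -> v * (b1 - a) <= 2 * ((x - a) * (b1 - x)).
Proof.
  intros Hv H1 H2 H.
  assert (v <= 2 * (x - a)).
  { assert (v * (b - x) <= 2 * (x - a) * (b - x)) by nra.
    apply Rmult_le_reg_r with (b - x); lra. }
  assert (v * (b1 - b) <= 2 * (x - a) * (b1 - b)) by (apply Rmult_le_compat_r; lra). lra.
Qed.

Section DoublingReal.
Variables (r : R) (P P' : R -> Prop).
Hypothesis Hr : 0 < r.
Hypothesis HP : forall c, P' c <-> c = 0 \/ (c <> 0 /\ P (c + r * r / c)).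
Hypothesis HP2 : P (2 * r).
Hypothesis HPb : forall y, P y -> y <= - 2 * r \/ 2 * r <= y.

Lemma dbl_r : P' r.
Proof.
  apply HP. right. split; [lra|]. replace (r + r * r / r) with (2 * r) by (field; lra). auto.
Qed.

Lemma dbl_roots (y : R) : 2 * r <= y -> exists x1, r <= x1 /\ x1 + r * r / x1 = y /\
  r * r / x1 <= r /\ 0 < r * r / x1 /\ r * r / x1 + r * r / (r * r / x1) = y.
Proof.
  intros Hy. set (q := sqrt (y * y - 4 * (r * r))).
  assert (Hq : q * q = y * y - 4 * (r * r)) by (apply sqrt_sqrt; nra).
  assert (Q0 : 0 <= q) by apply sqrt_pos.
  exists ((y + q) / 2).
  assert (X : r <= (y + q) / 2) by lra.
  assert (Z : (y + q) / 2 + r * r / ((y + q) / 2) = y).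
  { replace (r * r) with (((y + q) / 2) * ((y - q) / 2)) by nra. field. lra. }
  split; [auto|split; [auto|]]. set (x1 := (y + q) / 2) in *.
  split; [|split].
  - apply Rle_div_l; nra.
  - apply Rdiv_lt_0_compat; nra.
  - rewrite <- Z. field. split; nra.
Qed.

Lemma dbl_diff (a b : R) : a <> 0 -> b <> 0 ->
  (b + r * r / b) - (a + r * r / a) = (b - a) * (1 - r * r / (a * b)).
Proof. intros. field. auto. Qed.

(** The two sides differ by r^2 (x - a) (b - x) / (x^2 a b). Together with [dbl_diff] this says that
    the map does not shrink lengths in the metric with density (b - a) / ((x - a) (b - x)). *)
Lemma dbl_XZ (x a b : R) : 0 < x -> 0 < a -> 0 < b -> (x - a) * (x - b) <= 0 ->
  (1 - r * r / (x * a)) * (1 - r * r / (x * b)) <=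
    (1 - r * r / (x * x)) * (1 - r * r / (a * b)).
Proof.
  intros Hx Ha Hb H.
  assert (E : (1 - r * r / (x * x)) * (1 - r * r / (a * b)) -
    (1 - r * r / (x * a)) * (1 - r * r / (x * b)) =
    (r * r) * (- ((x - a) * (x - b)) / (x * x * a * b))) by (field; lra).
  assert (0 <= (r * r) * (- ((x - a) * (x - b)) / (x * x * a * b))).
  { apply Rmult_le_pos; [nra|]. apply Rdiv_le_0_compat; [lra|].
    repeat apply Rmult_lt_0_compat; auto. }
  lra.
Qed.

(** On either side of its critical point [r] the map x + r^2 / x is monotone on the positive axis,
    and by [dbl_XZ] it does not shrink lengths in the metrics of the gaps. Hence the inverse density
    at the image, divided by |f'|, is bounded by the one at [x]. *)
Lemma dbl_HB_pos (x v : R) : 0 < x -> ~ P' x ->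
  gap_bound_of P (x + r * r / x) (v * Rabs (1 - r * r / (x * x))) -> gap_bound_of P' x v.
Proof.
  intros Hx Hn H.
  destruct (Rle_or_lt v 0) as [Hv|Hv]; [now apply gap_bound_of_nonpos|].
  assert (Kp : 0 < r * r) by nra.
  assert (P0 : P' 0) by (apply HP; auto). assert (Pr := dbl_r).
  assert (Hxr : x <> r) by (intros ->; auto).
  assert (Hp : forall c, P' c -> 0 < c -> P (c + r * r / c)).
  { intros c Hc Hc0. apply HP in Hc. destruct Hc as [->|[_ Hc]]; [lra|auto]. }
  assert (Hnx : ~ P (x + r * r / x)) by (intros K; apply Hn, HP; right; split; [lra|auto]).
  destruct H as [H1 [H2 H3]].
  destruct (Rlt_or_le r x) as [Hrx|Hrx].
  - assert (U : forall c, r <= c -> r * r / (c * x) < 1).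
    { intros c Hc. apply Rlt_div_l; nra. }
    assert (Ux := U x ltac:(lra)).
    rewrite Rabs_pos_eq in H1, H2 by lra.
    split; [|split].
    + intros a b Ha Hb Hab.
      (* The critical point [r] belongs to P', so [a] may be moved up to it; on the right of [r] the
         map is increasing. *)
      set (a2 := Rmax a r). assert (A2 : P' a2) by (unfold a2, Rmax; destruct (Rle_dec a r); auto).
      assert (A3 : a <= a2) by apply Rmax_l. assert (A4 : r <= a2) by apply Rmax_r.
      assert (A5 : a2 < x) by (apply Rmax_lub_lt; lra).
      apply gap_bound_of_mono_l with a2; try lra.
      assert (Uab : r * r / (a2 * b) < 1) by (apply Rlt_div_l; nra).
      assert (Ua := U a2 A4). assert (Ub := U b ltac:(lra)).
      assert (Ea := dbl_diff a2 x ltac:(lra) ltac:(lra)).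
      assert (Eb := dbl_diff x b ltac:(lra) ltac:(lra)).
      assert (Eab := dbl_diff a2 b ltac:(lra) ltac:(lra)).
      assert (Z := dbl_XZ x a2 b Hx ltac:(lra) ltac:(lra) ltac:(nra)).
      replace (x * a2) with (a2 * x) in Z by ring. replace (b * x) with (x * b) in Ub by ring.
      assert (K := H1 _ _ (Hp _ A2 ltac:(lra)) (Hp _ Hb ltac:(lra)) ltac:(split; nra)).
      rewrite Ea, Eb, Eab in K.
      apply Rmult_le_reg_r with ((1 - r * r / (x * x)) * (1 - r * r / (a2 * b))); [apply Rmult_lt_0_compat; lra|].
      apply Rle_trans with (2 * ((x - a2) * (b - x)) * ((1 - r * r / (a2 * x)) * (1 - r * r / (x * b)))); [nra|].
      apply Rmult_le_compat_l; nra.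
    + intros a Ha Hall.
      set (a2 := Rmax a r). assert (A2 : P' a2) by (unfold a2, Rmax; destruct (Rle_dec a r); auto).
      assert (A3 : a <= a2) by apply Rmax_l. assert (A4 : r <= a2) by apply Rmax_r.
      assert (A5 : a2 < x) by (apply Rmax_lub_lt; [now apply Hall|lra]).
      assert (Ua := U a2 A4).
      assert (Ea := dbl_diff a2 x ltac:(lra) ltac:(lra)).
      assert (K := H2 _ (Hp _ A2 ltac:(lra))). rewrite Ea in K.
      assert (Kb : forall b, P b -> b < x + r * r / x).
      { intros b Hb. destruct (HPb b Hb) as [Hb2|Hb2].
        - assert (0 < r * r / x) by (apply Rdiv_lt_0_compat; lra). lra.
        - destruct (dbl_roots b Hb2) as [x1 [X1 [X2 _]]].
          assert (X3 : x1 < x) by (apply Hall, HP; right; split; [lra|rewrite X2; auto]).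
          assert (Eb := dbl_diff x1 x ltac:(lra) ltac:(lra)).
          assert (Ub := U x1 X1). nra. }
      specialize (K Kb).
      assert (Uc : r * r / (x * x) <= r * r / (a2 * x)).
      { apply Rmult_le_compat_l; [lra|]. apply Rinv_le_contravar; nra. }
      assert (v <= 2 * (x - a2)).
      { apply Rmult_le_reg_r with (1 - r * r / (x * x)); [lra|].
        apply Rle_trans with (1 := K). rewrite Rmult_assoc.
        apply Rmult_le_compat_l; [lra|]. apply Rmult_le_compat_l; lra. }
      lra.
    + intros a Ha Hall. specialize (Hall _ P0). lra.
  - assert (U : forall c, 0 < c <= r -> 1 < r * r / (c * x)).
    { intros c Hc. apply Rlt_div_r; nra. }
    assert (Ux := U x ltac:(lra)).
    rewrite Rabs_left1 in H1, H2 by lra.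
    split; [|split].
    + intros a b Ha Hb Hab.
      set (b2 := Rmin b r). assert (B2 : P' b2) by (unfold b2, Rmin; destruct (Rle_dec b r); auto).
      assert (B3 : b2 <= b) by apply Rmin_l. assert (B4 : b2 <= r) by apply Rmin_r.
      assert (B5 : x < b2) by (apply Rmin_glb_lt; lra).
      apply gap_bound_of_mono_r with b2; try lra.
      assert (Ub := U b2 ltac:(lra)).
      assert (Eb := dbl_diff x b2 ltac:(lra) ltac:(lra)).
      replace (b2 * x) with (x * b2) in Ub by ring.
      (* If P' has no point between the pole 0 and [x], the image of [x] lies beyond all points of
         P, where only the one-sided bound [H2] is available. *)
      destruct (classic (exists c, P' c /\ 0 < c < x)) as [[c [Hc Hcx]]|Hno].
      * set (a2 := Rmax a c). assert (A2 : P' a2) by (unfold a2, Rmax; destruct (Rle_dec a c); auto).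
        assert (A3 : a <= a2) by apply Rmax_l. assert (A4 : c <= a2) by apply Rmax_r.
        assert (A5 : a2 < x) by (apply Rmax_lub_lt; lra).
        apply gap_bound_of_mono_l with a2; try lra.
        assert (Uab : 1 < r * r / (a2 * b2)) by (apply Rlt_div_r; nra).
        assert (Ua := U a2 ltac:(lra)).
        assert (Ea := dbl_diff a2 x ltac:(lra) ltac:(lra)).
        assert (Eab := dbl_diff a2 b2 ltac:(lra) ltac:(lra)).
        assert (Z := dbl_XZ x a2 b2 Hx ltac:(lra) ltac:(lra) ltac:(nra)).
        replace (x * a2) with (a2 * x) in Z by ring.
        assert (K := H1 _ _ (Hp _ B2 ltac:(lra)) (Hp _ A2 ltac:(lra)) ltac:(split; nra)).
        replace (a2 + r * r / a2 - (b2 + r * r / b2)) with ((b2 - a2) * (r * r / (a2 * b2) - 1)) in K by lra.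
        replace (a2 + r * r / a2 - (x + r * r / x)) with ((x - a2) * (r * r / (a2 * x) - 1)) in K by lra.
        replace (x + r * r / x - (b2 + r * r / b2)) with ((b2 - x) * (r * r / (x * b2) - 1)) in K by lra.
        apply Rmult_le_reg_r with ((1 - r * r / (x * x)) * (1 - r * r / (a2 * b2))); [nra|].
        apply Rle_trans with (2 * ((x - a2) * (b2 - x)) * ((1 - r * r / (a2 * x)) * (1 - r * r / (x * b2)))); [lra|].
        apply Rmult_le_compat_l; [|lra].
        assert (0 <= (x - a2) * (b2 - x)) by (apply Rmult_le_pos; lra). lra.
      * assert (A0 : a <= 0).
        { apply Rnot_lt_le. intros A0. apply Hno. exists a. split; [auto|lra]. }
        apply gap_bound_of_mono_l with 0; try lra.
        assert (K := H2 _ (Hp _ B2 ltac:(lra))).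
        assert (Kb : forall b, P b -> b < x + r * r / x).
        { intros c Hc. apply Rnot_le_lt. intros Hcx.
          assert (Hc2 : 2 * r <= c).
          { destruct (HPb c Hc); auto. assert (0 < r * r / x) by (apply Rdiv_lt_0_compat; lra). lra. }
          destruct (dbl_roots c Hc2) as [x1 [X1 [_ [X2 [X3 X4]]]]].
          set (x2 := r * r / x1) in *.
          assert (X5 : P' x2) by (apply HP; right; split; [lra|rewrite X4; auto]).
          apply Hno. exists x2. split; auto. split; auto.
          apply Rnot_le_lt. intros [X6|X6]; [|now subst x].
          assert (Ec := dbl_diff x x2 ltac:(lra) ltac:(lra)). rewrite X4 in Ec.
          assert (Uc := U x2 ltac:(lra)). replace (x * x2) with (x2 * x) in Ec by ring. nra. }
        specialize (K Kb).
        apply Rmult_le_reg_r with (-(1 - r * r / (x * x))); [lra|].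
        apply Rle_trans with (2 * ((x + r * r / x) - (b2 + r * r / b2)) * b2); [nra|].
        replace (x + r * r / x - (b2 + r * r / b2)) with ((b2 - x) * (r * r / (x * b2) - 1)) by lra.
        replace (2 * ((b2 - x) * (r * r / (x * b2) - 1)) * b2) with
          (2 * (b2 - x) * (r * r / x - b2)) by (field; lra).
        replace (2 * ((x - 0) * (b2 - x)) * - (1 - r * r / (x * x))) with
          (2 * (b2 - x) * (r * r / x - x)) by (field; lra).
        apply Rmult_le_compat_l; lra.
    + intros a Ha Hall. specialize (Hall _ Pr). lra.
    + intros a Ha Hall. specialize (Hall _ P0). lra.
Qed.
End DoublingReal.

Lemma ccont_bounds (g : C -> C) (z : C) : ccont g z -> g z <> 0%C -> exists d, 0 < d /\
  forall w, Cmod (w - z) < d -> Cmod (g z) / 2 <= Cmod (g w) <= 2 * Cmod (g z).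
Proof.
  intros Hc Hz. assert (P := proj1 (Cmod_gt_0 _) Hz).
  destruct (Hc (Cmod (g z) / 2)) as [d [D K]]; [lra|]. exists d. split; auto.
  intros w Hw. specialize (K w Hw).
  assert (A := Cmod_lower (g z) (g w - g z)). replace (g z + (g w - g z))%C with (g w) in A by ring.
  assert (B := Cmod_triangle (g z) (g w - g z)). replace (g z + (g w - g z))%C with (g w) in B by ring.
  lra.
Qed.

Lemma near_of_deriv (f f' : C -> C) (z0 : C) :
  cderiv f z0 (f' z0) -> f' z0 <> 0%C -> ccont f' z0 -> exists K d, 0 < d /\
    forall z, 0 < Cmod (z - z0) < d -> 0 < Cmod (f z - f z0) <= K * (Cmod (f' z) * Cmod (z - z0)).
Proof.
  intros [phi [Pc [Pz E]]] Hn Hc.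
  destruct (ccont_bounds f' z0 Hc Hn) as [d1 [D1 K1]].
  destruct (ccont_bounds phi z0 Pc ltac:(rewrite Pz; auto)) as [d2 [D2 K2]]. rewrite Pz in K2.
  exists 4, (Rmin d1 d2). split; [now apply Rmin_glb_lt|]. intros w Hw.
  assert (A := Rmin_l d1 d2). assert (B := Rmin_r d1 d2).
  specialize (K1 w ltac:(lra)). specialize (K2 w ltac:(lra)).
  assert (P := proj1 (Cmod_gt_0 _) Hn).
  replace (f w - f z0)%C with (phi w * (w - z0))%C by (rewrite (E w); ring).
  rewrite Cmod_mult. split; [apply Rmult_lt_0_compat; lra|].
  rewrite <- Rmult_assoc. apply Rmult_le_compat_r; lra.
Qed.

(* For real z this is at least s + 2r or at most s - 2r; the critical points are s - r and
   s + r. *)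
Definition dmap (s r : R) (z : C) : C := (z + RtoC (r * r) / (z - RtoC s))%C.
Definition dmap' (s r : R) (z : C) : C :=
  (1 - RtoC (r * r) / ((z - RtoC s) * (z - RtoC s)))%C.
Definition dpole (s : R) (z : C) : Prop := z = RtoC s.
(** The preimages of infinity and of [l]: the pole [s], and s + w for both roots w of w^2 - (y - s)
    w + r^2 = 0, which are real because [l] avoids the gap. *)
Definition dlist (s r : R) (l : list R) : list R :=
  s :: flat_map (fun y => (s + ((y - s) + sqrt ((y - s) * (y - s) - 4 * (r * r))) / 2) ::
                          (s + ((y - s) - sqrt ((y - s) * (y - s) - 4 * (r * r))) / 2) :: nil) l.

Lemma dlist_spec (s r : R) (l : list R) (x : R) : 0 < r ->
  (forall y, In y l -> y - s <= - 2 * r \/ 2 * r <= y - s) ->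
  In x (dlist s r l) <-> x = s \/ (x <> s /\ In (x + r * r / (x - s)) l).
Proof.
  intros Hr Hl. unfold dlist. simpl. rewrite in_flat_map. split.
  - intros [->|[y [Hy Hx]]]; auto. right.
    set (q := sqrt ((y - s) * (y - s) - 4 * (r * r))) in *.
    assert (Hq : q * q = (y - s) * (y - s) - 4 * (r * r)).
    { apply sqrt_sqrt. specialize (Hl y Hy). nra. }
    assert (Hxx : (x - s) * (x - s) - (y - s) * (x - s) + r * r = 0).
    { simpl in Hx. destruct Hx as [<-|[<-|[]]]; nra. }
    assert (N : x <> s) by (intros ->; nra).
    split; auto. replace (x + r * r / (x - s)) with y; auto.
    replace (r * r) with ((y - s) * (x - s) - (x - s) * (x - s)) by lra. field. lra.
  - intros [->|[N H]]; auto. right. exists (x + r * r / (x - s)). split; auto.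
    set (y := x + r * r / (x - s)) in *.
    set (q := sqrt ((y - s) * (y - s) - 4 * (r * r))).
    assert (Hq : q * q = (y - s) * (y - s) - 4 * (r * r)).
    { apply sqrt_sqrt. specialize (Hl y H). nra. }
    assert (E : (x - s) * (x - s) - (y - s) * (x - s) + r * r = 0).
    { unfold y. field. lra. }
    assert (E2 : ((x - s) - ((y - s) + q) / 2) * ((x - s) - ((y - s) - q) / 2) = 0) by nra.
    apply Rmult_integral in E2. simpl. destruct E2; [left|right; left]; lra.
Qed.

Lemma dmap_R (s r x : R) : x <> s -> dmap s r (RtoC x) = RtoC (x + r * r / (x - s)).
Proof.
  intros H. unfold dmap. rewrite <- RtoC_minus, <- RtoC_div, <- RtoC_plus; auto. lra.
Qed.

Lemma dmap'_R (s r x : R) : x <> s -> dmap' s r (RtoC x) = RtoC (1 - r * r / ((x - s) * (x - s))).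
Proof.
  intros H. unfold dmap'. rewrite <- RtoC_minus, <- RtoC_mult, <- RtoC_div, <- RtoC_minus; auto.
  apply Rmult_integral_contrapositive_currified; lra.
Qed.

Lemma dmap_cderiv (s r : R) (z : C) : z <> RtoC s -> cderiv (dmap s r) z (dmap' s r z).
Proof.
  intros H. assert (N := Cminus_neq_0 _ _ H).
  assert (D : cderiv (fun w => w + - RtoC s)%C z (1 + 0)%C)
    by (apply cderiv_plus; [apply cderiv_id|apply cderiv_const]).
  apply cderiv_inv in D; auto.
  assert (D2 := cderiv_mult _ _ _ _ _ (cderiv_const (RtoC (r * r)) z) D).
  assert (D3 := cderiv_plus _ _ _ _ _ (cderiv_id z) D2). cbv beta in D3.
  unfold dmap'. replace (1 - RtoC (r * r) / ((z - RtoC s) * (z - RtoC s)))%C with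
   (1 + (0 * / (z + - RtoC s) + RtoC (r * r) *
     (- (1 + 0) / ((z + - RtoC s) * (z + - RtoC s)))))%C; [exact D3|].
  field. exact N.
Qed.

Lemma dmap_two (s r : R) (z w : C) : z <> RtoC s -> w <> RtoC s ->
  (dmap s r z - dmap s r w)%C =
  ((z - w) * (1 - RtoC (r * r) / ((z - RtoC s) * (w - RtoC s))))%C.
Proof.
  intros Hz Hw. unfold dmap. field. split; now apply Cminus_neq_0.
Qed.

Lemma Cmult_zero (z w : C) : (z * w)%C = 0%C -> z = 0%C \/ w = 0%C.
Proof.
  intros H. destruct (classic (z = 0%C)) as [|N]; auto. right.
  replace w with (/ z * (z * w))%C by (field; auto). rewrite H. ring.
Qed.

Lemma Cminus_0_eq (z w : C) : (z - w)%C = 0%C -> z = w.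
Proof. intros H. replace z with ((z - w) + w)%C by ring. rewrite H. ring. Qed.

Section Doubling.
Variables (s r : R) (l : list R).
Hypotheses (Hr : 0 < r) (Hl1 : In (s - 2 * r) l) (Hl2 : In (s + 2 * r) l).
Hypothesis Hl : forall y, In y l -> y - s <= - 2 * r \/ 2 * r <= y - s.
Hypothesis Hb : forall y, In y l -> -1 <= y <= 1.

Lemma dbl_E (z : C) : ~ dpole s z -> (inE (dlist s r l) z <-> inE l (dmap s r z)).
Proof.
  intros Hp. split.
  - intros [x [Hx ->]]. apply dlist_spec in Hx; auto. destruct Hx as [->|[N Hx]].
    + now elim Hp.
    + rewrite dmap_R by auto. now eexists; split; [exact Hx|].
  - intros [y [Hy E]]. assert (N := Cminus_neq_0 _ _ Hp).
    set (q := sqrt ((y - s) * (y - s) - 4 * (r * r))).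
    assert (Hq : q * q = (y - s) * (y - s) - 4 * (r * r)).
    { apply sqrt_sqrt. specialize (Hl y Hy). nra. }
    assert (Hrr : (((y - s) + q) / 2) * (((y - s) - q) / 2) = r * r) by nra.
    assert (E2 : ((z - RtoC (s + ((y - s) + q) / 2)) * (z - RtoC (s + ((y - s) - q) / 2)))%C = 0%C).
    { assert (E3 : (RtoC (((y - s) + q) / 2) * RtoC (((y - s) - q) / 2))%C = RtoC (r * r))
        by (rewrite <- RtoC_mult; now rewrite Hrr).
      assert (E4 : (RtoC (((y - s) + q) / 2) + RtoC (((y - s) - q) / 2))%C = (RtoC y - RtoC s)%C)
        by (rewrite <- RtoC_plus, <- RtoC_minus; f_equal; lra).
      rewrite !RtoC_plus.
      set (R1 := RtoC (((y - s) + q) / 2)) in *. set (R2 := RtoC (((y - s) - q) / 2)) in *.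
      replace ((z - (RtoC s + R1)) * (z - (RtoC s + R2)))%C with
        ((z - RtoC s) * (z - RtoC s) - (R1 + R2) * (z - RtoC s) + R1 * R2)%C by ring.
      rewrite E3, E4, <- E. unfold dmap. field. auto. }
    apply Cmult_zero in E2.
    destruct E2 as [E2|E2]; apply Cminus_0_eq in E2; rewrite E2; (eexists; split; [|reflexivity]);
      right; apply in_flat_map; exists y; (split; [auto|]); unfold q; simpl; auto.
Qed.

(** The critical points s - r and s + r are mapped to the ends s - 2r and s + 2r of the gap. This is
    why the ends of the gap have to belong to [l]. *)
Lemma dbl_crit (z : C) : ~ inE (dlist s r l) z -> dmap' s r z <> 0%C.
Proof.
  intros H E. assert (Hp : z <> RtoC s).
  { intros ->. apply H. exists s. split; auto. now left. }
  assert (N := Cminus_neq_0 _ _ Hp).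
  assert (E2 : ((z - RtoC (s + r)) * (z - RtoC (s - r)))%C = 0%C).
  { rewrite RtoC_plus, RtoC_minus.
    replace ((z - (RtoC s + RtoC r)) * (z - (RtoC s - RtoC r)))%C with
      ((z - RtoC s) * (z - RtoC s) * dmap' s r z)%C; [rewrite E; ring|].
    unfold dmap'. rewrite RtoC_mult. field. auto. }
  apply H, dbl_E; auto. apply Cmult_zero in E2. destruct E2 as [E2|E2].
  - exists (s + 2 * r). split; auto.
    apply Cminus_0_eq in E2. rewrite E2.
    rewrite dmap_R by lra. f_equal. field. lra.
  - exists (s - 2 * r). split; auto.
    apply Cminus_0_eq in E2. rewrite E2.
    rewrite dmap_R by lra. f_equal. field. lra.
Qed.

Lemma dmap'_ccont (z : C) : z <> RtoC s -> cdiff (dmap' s r) z.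
Proof.
  intros H. assert (N := Cminus_neq_0 _ _ H). unfold dmap'.
  apply cdiff_minus; [apply cdiff_const|]. apply cdiff_div.
  - apply cdiff_const.
  - apply cdiff_mult; (apply cdiff_minus; [apply cdiff_id|apply cdiff_const]).
  - now apply Cmult_neq_0.
Qed.

Lemma dbl_HB (x : R) : ~ In x (dlist s r l) -> exists y, dmap s r (RtoC x) = RtoC y /\
    forall v, gap_bound l y v -> gap_bound (dlist s r l) x (v / Cmod (dmap' s r (RtoC x))).
Proof.
  intros Hx. assert (N : x <> s) by (intros ->; apply Hx; now left).
  exists (x + r * r / (x - s)). split; [now apply dmap_R|]. intros v Hv.
  assert (Hd : dmap' s r (RtoC x) <> 0%C).
  { apply dbl_crit. intros [x' [H1 H2]]. apply RtoC_inj in H2. now subst. }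
  assert (Pd := proj1 (Cmod_gt_0 _) Hd). rewrite dmap'_R, Cmod_R in * by auto.
  set (D := Rabs (1 - r * r / ((x - s) * (x - s)))) in *.
  assert (Ev : v = v / D * D) by (field; lra).
  set (v' := v / D) in *. clearbody v'. subst v.
  (* The map is odd about [s], so e = -1 reduces points on the left of [s] to the case treated in
     [dbl_HB_pos]. *)
  assert (T : forall e, e * e = 1 -> 0 < e * (x - s) -> gap_bound (dlist s r l) x v').
  { intros e He H0.
    assert (E2 : e = 1 \/ e = -1) by (destruct (Rle_or_lt 0 e); [left; nra|right; nra]).
    set (P := fun c => In (s + e * c) l). set (P' := fun c => In (s + e * c) (dlist s r l)).
    assert (M : gap_bound_of P' (e * (x - s)) v').
    { apply dbl_HB_pos with (r := r) (P := P); auto.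
      - intros c. unfold P, P'. rewrite dlist_spec by auto.
        replace (s + e * c - s) with (e * c) by ring.
        destruct (Req_dec c 0) as [->|Nc].
        + split; [auto|]. intros _. left. ring.
        + assert (e * c <> 0) by (destruct E2 as [-> | ->]; lra).
          replace (s + e * c + r * r / (e * c)) with (s + e * (c + r * r / c)).
          * split; [intros [K|[_ K]]; [exfalso; lra|now right]|].
            intros [K|[_ K]]; [lra|right; split; [lra|auto]].
          * destruct E2 as [-> | ->]; field; lra.
      - unfold P. destruct E2 as [-> | ->]; [now rewrite Rmult_1_l|].
        now replace (s + -1 * (2 * r)) with (s - 2 * r) by ring.
      - intros y Hy. unfold P in Hy. apply Hl in Hy. destruct E2 as [-> | ->]; lra.
      - unfold P'. replace (s + e * (e * (x - s))) with x; auto.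
        rewrite <- Rmult_assoc, He. ring.
      - replace (e * (x - s) * (e * (x - s))) with ((e * e) * ((x - s) * (x - s))) by ring.
        rewrite He, Rmult_1_l. fold D.
        replace (e * (x - s) + r * r / (e * (x - s))) with (e * (x + r * r / (x - s) - s)).
        + exact (gap_bound_of_affine (fun c => In c l) e s _ _ He Hv).
        + destruct E2 as [-> | ->]; field; lra. }
    apply (gap_bound_of_affine P' e (- (e * s)) (e * (x - s)) v' He) in M.
    replace (e * (e * (x - s) - - (e * s))) with ((e * e) * x) in M by ring.
    rewrite He, Rmult_1_l in M.
    replace (fun c => P' (- (e * s) + e * c)) with (fun c => In c (dlist s r l)) in M; [exact M|].
    apply functional_extensionality. intros c. unfold P'. f_equal.
    replace (s + e * (- (e * s) + e * c)) with (s - (e * e) * s + (e * e) * c) by ring.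
    rewrite He. ring. }
  destruct (Rlt_or_le s x).
  - apply (T 1); lra.
  - apply (T (-1)); lra.
Qed.

(** At a critical point X^2 = r^2 for X = x - s, and with W = z - s the increment is (W - X)^2 / W
    and the derivative (W - X) (W + X) / W^2. The claim becomes |W| <= 2 |W + X|. *)
Lemma dbl_near (x : R) : In x (dlist s r l) -> ~ dpole s (RtoC x) -> exists K d, 0 < d /\
    forall z, 0 < Cmod (z - RtoC x) < d ->
      0 < Cmod (dmap s r z - dmap s r (RtoC x)) <= K * (Cmod (dmap' s r z) * Cmod (z - RtoC x)).
Proof.
  intros Hx Hp. destruct (classic (dmap' s r (RtoC x) = 0%C)) as [E|E].
  2:{ apply near_of_deriv; auto; [now apply dmap_cderiv|now apply cdiff_ccont, dmap'_ccont]. }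
  assert (N := Cminus_neq_0 _ _ Hp). set (X := (RtoC x - RtoC s)%C) in *.
  assert (EX : RtoC (r * r) = (X * X)%C).
  { replace (RtoC (r * r)) with ((1 - dmap' s r (RtoC x)) * (X * X))%C.
    - rewrite E. ring.
    - unfold dmap'. fold X. field. auto. }
  assert (PX := proj1 (Cmod_gt_0 _) N).
  exists 2, (Cmod X). split; auto. intros z Hz.
  assert (Nz : z <> RtoC s).
  { intros ->. unfold X in Hz. rewrite Cmod_minus_sym in Hz. lra. }
  rewrite dmap_two by auto. fold X. rewrite Cmod_mult.
  assert (NW := Cminus_neq_0 _ _ Nz). set (W := (z - RtoC s)%C) in *.
  assert (EW : (W - X)%C = (z - RtoC x)%C) by (unfold W, X; ring).
  replace (1 - RtoC (r * r) / (W * X))%C with ((W - X) / W)%C by (rewrite EX; field; auto).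
  unfold dmap'. fold W.
  replace (1 - RtoC (r * r) / (W * W))%C with ((W - X) / W * ((W + X) / W))%C by (rewrite EX; field; auto).
  rewrite EW, Cmod_mult, !Cmod_div by auto.
  assert (PW := proj1 (Cmod_gt_0 _) NW).
  set (e := Cmod (z - RtoC x)) in *.
  assert (Q : 0 < e / Cmod W) by (apply Rdiv_lt_0_compat; lra).
  split; [apply Rmult_lt_0_compat; lra|].
  replace (2 * (e / Cmod W * (Cmod (W + X) / Cmod W) * e)) with
    (e * (e / Cmod W) * (2 * (Cmod (W + X) / Cmod W))) by ring.
  rewrite <- (Rmult_1_r (e * (e / Cmod W))) at 1.
  apply Rmult_le_compat_l; [apply Rmult_le_pos; lra|].
  replace (2 * (Cmod (W + X) / Cmod W)) with (2 * Cmod (W + X) / Cmod W) by (field; lra).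
  apply Rle_div_r; auto. rewrite Rmult_1_l.
  assert (A := Cmod_lower (2 * X) (W - X)). replace (2 * X + (W - X))%C with (W + X)%C in A by ring.
  assert (B := Cmod_triangle X (W - X)). replace (X + (W - X))%C with W in B by ring.
  rewrite Cmod_mult, Cmod_R, Rabs_pos_eq, EW in A by lra. rewrite EW in B. fold e in A, B. lra.
Qed.

Lemma dmap_pole_bounds (z : C) : 0 < Cmod (z - RtoC s) -> Cmod (z - RtoC s) <= r / 2 ->
  3 / 4 * (r * r) <= Cmod (dmap' s r z) * (Cmod (z - RtoC s) * Cmod (z - RtoC s)) /\
  r * r / Cmod (z - RtoC s) - Cmod z <= Cmod (dmap s r z) /\
  Cmod (dmap s r z) <= Cmod z + r * r / Cmod (z - RtoC s).
Proof.
  intros H0 H1. assert (N : (z - RtoC s)%C <> 0%C) by (now apply Cmod_gt_0).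
  set (W := (z - RtoC s)%C) in *. assert (Kp : 0 < r * r) by nra.
  assert (E : Cmod (RtoC (r * r) / W) = r * r / Cmod W).
  { rewrite Cmod_div, Cmod_R, Rabs_pos_eq by (auto; lra). reflexivity. }
  split; [|split].
  - rewrite <- !Cmod_mult.
    replace (dmap' s r z * (W * W))%C with (W * W - RtoC (r * r))%C
      by (unfold dmap'; fold W; field; auto).
    assert (A := Cmod_lower_minus (RtoC (r * r)) (W * W)).
    rewrite Cmod_minus_sym, Cmod_R, Rabs_pos_eq, Cmod_mult in A by lra. nra.
  - unfold dmap. fold W. rewrite <- E.
    assert (A := Cmod_lower (RtoC (r * r) / W) z). rewrite Cplus_comm in A. exact A.
  - unfold dmap. fold W. rewrite <- E. apply Cmod_triangle.
Qed.

Lemma dmap_far_bounds (z : C) : Rabs s + 2 * r + 1 <= Cmod z ->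
  z <> RtoC s /\ Cmod z - r * r <= Cmod (dmap s r z) <= Cmod z + r * r /\ 3 / 4 <= Cmod (dmap' s r z).
Proof.
  intros H. assert (A := Cmod_lower_minus z (RtoC s)). rewrite Cmod_R in A.
  assert (N : z <> RtoC s).
  { intros ->. rewrite Cmod_R in H. lra. }
  split; auto. assert (NW := Cminus_neq_0 _ _ N). set (W := (z - RtoC s)%C) in *.
  assert (PW := proj1 (Cmod_gt_0 _) NW). assert (Kp : 0 < r * r) by nra.
  assert (E : Cmod (RtoC (r * r) / W) <= r * r).
  { rewrite Cmod_div, Cmod_R, Rabs_pos_eq by (auto; lra). apply Rle_div_l; nra. }
  assert (E2 : Cmod (RtoC (r * r) / (W * W)) <= 1 / 4).
  { rewrite Cmod_div, Cmod_R, Rabs_pos_eq, Cmod_mult by (try apply Cmult_neq_0; auto; lra).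
    apply Rle_div_l; nra. }
  assert (B1 := Cmod_lower z (RtoC (r * r) / W)). assert (B2 := Cmod_triangle z (RtoC (r * r) / W)).
  assert (B3 := Cmod_lower_minus 1 (RtoC (r * r) / (W * W))). rewrite Cmod_1 in B3.
  unfold dmap, dmap'. fold W. lra.
Qed.

Lemma dbl_pullable : pullable (dmap s r) (dmap' s r) (dpole s) l (dlist s r l).
Proof.
  constructor.
  - intros z ->. exists s. split; auto. now left.
  - intros z Hz. exists (Cmod (z - RtoC s)). split; [now apply Cmod_minus_pos|].
    intros w Hw ->. rewrite Cmod_minus_sym in Hw. lra.
  - intros z Hz. now apply dmap_cderiv.
  - intros z Hz. split; [|now apply dbl_crit]. apply dmap'_ccont. intros ->.
    apply Hz. exists s. split; auto. now left.
  - exact dbl_E.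
  - exact dbl_HB.
  - exact dbl_near.
  - intros z0 ->. exists ((Rabs s + r + r * r) / (3 / 4 * (r * r)) * (1 + r)), (r / 2). split; [lra|].
    intros z Hz. destruct (dmap_pole_bounds z ltac:(lra) ltac:(lra)) as [A [B D]].
    split.
    { intros E. unfold dpole in E. apply (proj2 (Cmod_gt_0 _) (proj1 Hz)). rewrite E. ring. }
    assert (Hs : Cmod z <= Rabs s + r / 2).
    { assert (T := Cmod_triangle (RtoC s) (z - RtoC s)).
      replace (RtoC s + (z - RtoC s))%C with z in T by ring. rewrite Cmod_R in T. lra. }
    set (w := Cmod (z - RtoC s)) in *. set (m := Cmod (dmap' s r z)) in *.
    assert (Kp : 0 < r * r) by nra.
    assert (Q : 0 <= Rabs s) by apply Rabs_pos.
    apply Rle_trans with (1 := D).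
    apply Rle_trans with ((Rabs s + r + r * r) * (1 + r) / w).
    + apply Rle_div_r; [lra|]. rewrite Rmult_plus_distr_r.
      replace (r * r / w * w) with (r * r) by (field; lra). nra.
    + replace ((Rabs s + r + r * r) / (3 / 4 * (r * r)) * (1 + r) * (m * w)) with
       ((Rabs s + r + r * r) * (1 + r) / w * (m * (w * w) / (3 / 4 * (r * r)))) by (field; lra).
      rewrite <- (Rmult_1_r (_ / w)) at 1. apply Rmult_le_compat_l.
      * apply Rdiv_le_0_compat; [|lra]. apply Rmult_le_pos; lra.
      * apply Rle_div_r; lra.
  - intros z0 -> M. set (M1 := Rabs M + Rabs s + r + 1).
    assert (Kp : 0 < r * r) by nra. assert (Q : 0 <= Rabs s) by apply Rabs_pos.
    assert (Q2 : 0 <= Rabs M) by apply Rabs_pos. assert (Q3 : M <= Rabs M) by apply Rle_abs.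
    assert (QM : 0 < M1) by (unfold M1; lra).
    assert (X : 0 < r * r / M1) by (apply Rdiv_lt_0_compat; lra).
    exists (Rmin (r / 2) (r * r / M1)). split; [apply Rmin_glb_lt; lra|]. intros z Hz.
    assert (T1 := Rmin_l (r / 2) (r * r / M1)). assert (T2 := Rmin_r (r / 2) (r * r / M1)).
    destruct (dmap_pole_bounds z ltac:(lra) ltac:(lra)) as [A [B D]].
    assert (Hs : Cmod z <= Rabs s + r / 2).
    { assert (T := Cmod_triangle (RtoC s) (z - RtoC s)).
      replace (RtoC s + (z - RtoC s))%C with z in T by ring. rewrite Cmod_R in T. lra. }
    set (w := Cmod (z - RtoC s)) in *.
    assert (Y : M1 <= r * r / w).
    { apply Rle_div_r; [lra|]. replace (r * r) with (M1 * (r * r / M1)) by (field; lra).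
      apply Rmult_le_compat_l; lra. }
    unfold M1 in Y. lra.
  - exists (4 * (1 + r * r)), (Rabs s + 2 * r + 1). intros z Hz.
    destruct (dmap_far_bounds z Hz) as [A [[B1 B2] D]]. split; auto.
    assert (Q : 0 <= Rabs s) by apply Rabs_pos.
    apply Rle_trans with (1 := B2).
    apply Rle_trans with (4 * (1 + r * r) * (3 / 4 * Cmod z)); [nra|].
    apply Rmult_le_compat_l; [nra|]. apply Rmult_le_compat_r; [lra|auto].
  - intros M. exists (Rmax (M + r * r) (Rabs s + 2 * r + 1)). intros z Hz.
    assert (T1 := Rmax_l (M + r * r) (Rabs s + 2 * r + 1)).
    assert (T2 := Rmax_r (M + r * r) (Rabs s + 2 * r + 1)).
    destruct (dmap_far_bounds z ltac:(lra)) as [A [[B1 B2] D]]. lra.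
  - intros x Hx. apply dlist_spec in Hx; auto. assert (B1 := Hb _ Hl1). assert (B2 := Hb _ Hl2).
    destruct Hx as [->|[N Hx]]; [lra|]. assert (Bx := Hb _ Hx).
    destruct (Rlt_or_le s x).
    + assert (0 < r * r / (x - s)) by (apply Rdiv_lt_0_compat; nra). lra.
    + assert (0 < r * r / (s - x)) by (apply Rdiv_lt_0_compat; nra).
      replace (r * r / (x - s)) with (- (r * r / (s - x))) in Bx by (field; lra). lra.
Qed.
End Doubling.

Lemma C_sqrt_exists (z : C) : exists w, (w * w)%C = z.
Proof.
  destruct z as [a b]. set (m := Cmod (a, b)).
  assert (Hm : m * m = a * a + b * b).
  { unfold m, Cmod; simpl. rewrite sqrt_sqrt; nra. }
  assert (Hm0 : 0 <= m) by apply Cmod_ge_0.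
  assert (A : Rabs a <= m) by exact (re_le_Cmod (a, b)).
  apply Rabs_le_between in A.
  set (p := sqrt ((m + a) / 2)). set (q := sqrt ((m - a) / 2)).
  assert (Hp : p * p = (m + a) / 2) by (apply sqrt_sqrt; lra).
  assert (Hq : q * q = (m - a) / 2) by (apply sqrt_sqrt; lra).
  assert (P0 : 0 <= p) by apply sqrt_pos. assert (Q0 : 0 <= q) by apply sqrt_pos.
  assert (PQ : (2 * p * q) * (2 * p * q) = b * b).
  { replace ((2 * p * q) * (2 * p * q)) with (4 * (p * p) * (q * q)) by ring. rewrite Hp, Hq. nra. }
  assert (PQ0 : 0 <= p * q) by nra.
  destruct (Rle_or_lt 0 b).
  - exists (p, q). apply injective_projections; simpl; nra.
  - exists (p, - q). apply injective_projections; simpl; nra.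
Qed.

Lemma Cinv_Im_neg (k : R) (w : C) : 0 < k -> 0 < Im w -> Im (RtoC k / w)%C < 0.
Proof.
  intros Hk Hw. destruct w as [x y]. unfold Im in Hw; simpl in Hw.
  assert (0 < x * x + y * y) by nra.
  replace (Im (RtoC k / (x, y))%C) with (- (k * y / (x * x + y * y)))
    by (unfold Cdiv, Cinv, Im; simpl; field; lra).
  assert (0 < k * y / (x * x + y * y)) by (apply Rdiv_lt_0_compat; nra). lra.
Qed.

Lemma Im_pos_neq_0 (w : C) : 0 < Im w -> w <> 0%C.
Proof. intros H ->. unfold Im in H; simpl in H. lra. Qed.

Lemma Cplus_Im (z w : C) : Im (z + w)%C = Im z + Im w.
Proof. reflexivity. Qed.

Lemma Cminus_R_Im (z : C) (x : R) : Im (z - RtoC x)%C = Im z.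
Proof. rewrite Cminus_Im. unfold Im at 2; simpl. ring. Qed.

Lemma dmap_root (s r : R) (t : C) : 0 < r -> 0 < Im t ->
  exists z, 0 < Im z /\ dmap s r z = t.
Proof.
  intros Hr Ht. assert (Kp : 0 < r * r) by nra. set (u := (t - RtoC s)%C).
  assert (Hu : 0 < Im u) by (unfold u; now rewrite Cminus_R_Im).
  destruct (C_sqrt_exists (u * u - 4 * RtoC (r * r))) as [q Hq].
  set (w := ((u + q) / 2)%C). set (w' := ((u - q) / 2)%C).
  assert (two : RtoC 2 <> 0%C) by (intros E; apply RtoC_inj in E; lra).
  assert (four : RtoC 4 <> 0%C) by (intros E; apply RtoC_inj in E; lra).
  assert (S : (w + w')%C = u) by (unfold w, w'; field; auto).
  assert (M : (w * w')%C = RtoC (r * r)).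
  { replace (w * w')%C with ((u * u - q * q) / 4)%C.
    - rewrite Hq. field.
    - unfold w, w'. field. }
  assert (Nk : RtoC (r * r) <> 0%C) by (intros E; apply RtoC_inj in E; lra).
  assert (T : forall a b, (a + b)%C = u -> (a * b)%C = RtoC (r * r) -> 0 < Im a ->
    exists z, 0 < Im z /\ dmap s r z = t).
  { intros a b Hab Hm Ha. exists (a + RtoC s)%C. split.
    - rewrite Cplus_Im. unfold Im at 2; simpl. lra.
    - unfold dmap. replace (a + RtoC s - RtoC s)%C with a by ring. rewrite <- Hm.
      replace t with (u + RtoC s)%C by (unfold u; ring). rewrite <- Hab. field.
      now apply Im_pos_neq_0. }
  destruct (Rlt_or_le 0 (Im w)) as [Hw|Hw]; [now apply (T w w')|].
  apply (T w' w); [rewrite <- S; ring|rewrite <- M; ring|].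
  rewrite <- S, Cplus_Im in Hu. lra.
Qed.

(** On the upper half-plane r^2 / (z - s) has negative imaginary part, so [dmap] lowers the
    imaginary part. Hence |z - s| >= Im t. *)
Lemma dmap_inverse_bounds (s r : R) (z t : C) : 0 < r -> 0 < Im t -> 0 < Im z -> dmap s r z = t ->
  Im t <= Im z /\ Cmod (z - t) <= r * r / Im t.
Proof.
  intros Hr Ht Hz E. assert (Kp : 0 < r * r) by nra.
  assert (Hw : 0 < Im (z - RtoC s)) by (now rewrite Cminus_R_Im).
  assert (Hi := Cinv_Im_neg (r * r) _ Kp Hw).
  assert (A : Im t <= Im z).
  { rewrite <- E. unfold dmap. rewrite Cplus_Im. lra. }
  split; auto.
  replace (z - t)%C with (- (RtoC (r * r) / (z - RtoC s)))%C by (rewrite <- E; unfold dmap; ring).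
  rewrite Cmod_opp, Cmod_div, Cmod_R, Rabs_pos_eq by (try lra; now apply Im_pos_neq_0).
  apply Rmult_le_compat_l; [lra|]. apply Rinv_le_contravar; auto.
  apply Rle_trans with (1 := A). rewrite <- (Cminus_R_Im z s).
  apply Rle_trans with (2 := im_le_Cmod _). apply Rle_abs.
Qed.

(** By [dmap_two] an increment of the inverse is x - t divided by a factor that stays away from 0.
    This gives continuity and then the derivative, without an inverse function theorem. *)
Lemma dmap_inverse (s r : R) : 0 < r -> exists J : C -> C, forall t, 0 < Im t ->
  dmap s r (J t) = t /\ Im t <= Im (J t) /\ Cmod (J t - t) <= r * r / Im t /\ cdiff J t.
Proof.
  intros Hr. assert (Kp : 0 < r * r) by nra.
  set (J := fun t => epsilon (inhabits t) (fun z => 0 < Im z /\ dmap s r z = t)).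
  assert (HJ : forall t, 0 < Im t -> 0 < Im (J t) /\ dmap s r (J t) = t).
  { intros t Ht. apply (epsilon_spec (inhabits t) (fun z => 0 < Im z /\ dmap s r z = t)).
    now apply dmap_root. }
  assert (HJs : forall t, 0 < Im t -> 0 < Im (J t - RtoC s)%C).
  { intros t Ht. rewrite Cminus_R_Im. now apply HJ. }
  exists J. intros t Ht. destruct (HJ t Ht) as [J1 J2].
  destruct (dmap_inverse_bounds s r _ t Hr Ht J1 J2) as [B1 B2].
  split; [auto|split; [auto|split; [auto|]]].
  assert (W0p := HJs t Ht). set (w0 := (J t - RtoC s)%C) in *.
  assert (N0 := Im_pos_neq_0 _ W0p). assert (M0 := proj1 (Cmod_gt_0 _) N0).
  (* the reflected point k/w lies in the lower half-plane, away from w0 *)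
  assert (Q : forall x, 0 < Im x -> let w := (J x - RtoC s)%C in
     w <> 0%C /\ Im w0 / Cmod w0 <= Cmod (1 - RtoC (r * r) / (w * w0)) /\
     (J x - J t)%C = ((x - t) / (1 - RtoC (r * r) / (w * w0)))%C).
  { intros x Hx w. assert (Wp := HJs x Hx). fold w in Wp.
    assert (N := Im_pos_neq_0 _ Wp). split; auto.
    assert (L : Im w0 / Cmod w0 <= Cmod (1 - RtoC (r * r) / (w * w0))).
    { replace (1 - RtoC (r * r) / (w * w0))%C with ((w0 - RtoC (r * r) / w) / w0)%C by (field; auto).
      rewrite Cmod_div by auto. apply Rmult_le_compat_r; [left; now apply Rinv_0_lt_compat|].
      apply Rle_trans with (2 := im_le_Cmod _). rewrite Cminus_Im.
      assert (H := Cinv_Im_neg _ _ Kp Wp). rewrite Rabs_pos_eq; lra. }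
    split; auto.
    assert (Np : (1 - RtoC (r * r) / (w * w0))%C <> 0%C).
    { apply Cmod_gt_0. apply Rlt_le_trans with (2 := L). now apply Rdiv_lt_0_compat. }
    destruct (HJ x Hx) as [J3 J4].
    assert (E := dmap_two s r (J x) (J t)
      ltac:(intros E; apply N; unfold w; rewrite E; ring)
      ltac:(intros E; apply N0; unfold w0; rewrite E; ring)).
    rewrite J4, J2 in E. fold w w0 in E. rewrite E.
    set (d := (1 - RtoC (r * r) / (w * w0))%C) in *. field. auto. }
  assert (Hd : 0 < Im w0 / Cmod w0) by now apply Rdiv_lt_0_compat.
  assert (comp_J : ccont J t).
  { intros eps He. exists (Rmin (Im t) (eps * (Im w0 / Cmod w0))).
    split; [apply Rmin_glb_lt; nra|]. intros x Hx.
    assert (A := Rmin_l (Im t) (eps * (Im w0 / Cmod w0))).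
    assert (B := Rmin_r (Im t) (eps * (Im w0 / Cmod w0))).
    assert (Hxp : 0 < Im x).
    { assert (T := im_le_Cmod (x - t)). rewrite Cminus_Im in T.
      assert (T2 : Rabs (Im x - Im t) < Im t) by lra. apply Rabs_lt_between in T2. lra. }
    destruct (Q x Hxp) as [_ [L E]]. rewrite E.
    rewrite Cmod_div by (apply Cmod_gt_0; lra).
    apply Rlt_div_l; [lra|]. nra. }
  exists (/ (1 - RtoC (r * r) / (w0 * w0)))%C.
  destruct (Q t Ht) as [_ [L0 _]]. fold w0 in L0.
  set (phi := fun x => (/ (1 - RtoC (r * r) / ((J x - RtoC s) * w0)))%C).
  assert (Pc : ccont phi t).
  { unfold phi. apply ccont_inv.
    - apply ccont_plus; [apply ccont_const|].
      apply ccont_ext with (f := fun x => ((- RtoC (r * r) / w0) * / (J x + - RtoC s))%C) (r := Im t); auto.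
      + intros x Hx. assert (Hxp : 0 < Im x).
        { assert (T := im_le_Cmod (x - t)). rewrite Cminus_Im in T.
          assert (T2 : Rabs (Im x - Im t) < Im t) by lra. apply Rabs_lt_between in T2. lra. }
        destruct (Q x Hxp) as [N _]. field. auto.
      + apply ccont_mult; [apply ccont_const|]. apply ccont_inv; [|exact N0].
        apply ccont_plus; [exact comp_J|apply ccont_const].
    - fold w0. apply Cmod_gt_0. lra. }
  assert (D : cderiv J t (phi t)); [|exact D].
  apply cderiv_eps. intros eps He. destruct (Pc eps He) as [d [Dp K]].
  exists (Rmin (Im t) d). split; [now apply Rmin_glb_lt|]. intros x Hx.
  assert (A := Rmin_l (Im t) d). assert (B := Rmin_r (Im t) d).
  assert (Hxp : 0 < Im x).
  { assert (T := im_le_Cmod (x - t)). rewrite Cminus_Im in T.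
    assert (T2 : Rabs (Im x - Im t) < Im t) by lra. apply Rabs_lt_between in T2. lra. }
  destruct (Q x Hxp) as [_ [L E]]. rewrite E.
  replace ((x - t) / (1 - RtoC (r * r) / ((J x - RtoC s) * w0)) - phi t * (x - t))%C with
    ((phi x - phi t) * (x - t))%C by (unfold phi, Cdiv; ring).
  rewrite Cmod_mult. apply Rmult_le_compat_r; [apply Cmod_ge_0|]. left. apply K. lra.
Qed.

(** * Chebyshev polynomials as initial functions *)

(** The affine map taking -1, 1, infinity to 0, 1, infinity. For it G(1-G)/G' is [baseY]. *)
Definition baseG (z : C) : Chat := CFinite ((1 + z) / 2)%C.
Definition baseY (z : C) : C := ((1 + z) * (1 - z) / 2)%C.

Lemma CFinite_inj (a b : C) : CFinite a = CFinite b -> a = b.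
Proof. now injection 1. Qed.

Lemma base_admissible : admissible baseG baseY (-1 :: 1 :: nil).
Proof.
  assert (two : RtoC 2 <> 0%C) by (intros E; apply RtoC_inj in E; lra).
  (* In the maximum of 1 and |G| the first term is used between and near the two points, the second
     one at infinity and on the right of 1. *)
  assert (Hm : forall z, dist_ratio baseG baseY z <= Cmod (baseY z)).
  { intros z. unfold dist_ratio. assert (A := Rmax_l 1 (Cmod (finite_part baseG z))).
    apply Rle_div_l; [lra|]. assert (B := Cmod_ge_0 (baseY z)). nra. }
  assert (Hm2 : forall z, (1 + z)%C <> 0%C -> dist_ratio baseG baseY z <= Cmod (1 - z)).
  { intros z Hz. unfold dist_ratio, baseY, baseG, finite_part.
    assert (A := Rmax_r 1 (Cmod ((1 + z) / 2))).
    assert (B : 0 < Cmod ((1 + z) / 2)).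
    { apply Cmod_gt_0. intros E. apply Hz. replace (1 + z)%C with ((1 + z) / 2 * 2)%C by (field; auto).
      rewrite E. ring. }
    apply Rle_div_l; [lra|].
    replace ((1 + z) * (1 - z) / 2)%C with ((1 - z) * ((1 + z) / 2))%C by (field; auto).
    rewrite Cmod_mult. apply Rmult_le_compat_l; [apply Cmod_ge_0|auto]. }
  assert (Inl : forall z, inE (-1 :: 1 :: nil) z <-> ((1 + z) * (1 - z))%C = 0%C).
  { intros z. split.
    - intros [x [[<-|[<-|[]]] ->]]; apply injective_projections; simpl; ring.
    - intros H. apply Cmult_zero in H. destruct H as [H|H].
      + exists (-1). split; [simpl; auto|]. replace z with ((1 + z) - 1)%C by ring. rewrite H.
        apply injective_projections; simpl; ring.
      + exists 1. split; [simpl; auto|]. symmetry. now apply Cminus_0_eq. }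
  constructor.
  - intros z Hz [H|[H|H]]; unfold baseG in H; try discriminate; assert (E := CFinite_inj _ _ H);
      apply Hz, Inl.
    + replace (1 + z)%C with ((1 + z) / 2 * 2)%C by (field; auto). rewrite E. ring.
    + replace (1 + z)%C with ((1 + z) / 2 * 2)%C by (field; auto).
      replace (1 - z)%C with ((1 - (1 + z) / 2) * 2)%C by (field; auto). rewrite E. ring.
  - intros z Hz. apply Inl, Cmult_zero in Hz. unfold baseG, zero_one_infty.
    destruct Hz as [H|H].
    + left. apply f_equal. rewrite H. field; auto.
    + right; left. apply f_equal. replace (1 + z)%C with (2 - (1 - z))%C by ring. rewrite H. field; auto.
  - intros z _. apply cdiff_ext_loc with (f := fun z => ((1 + z) / 2)%C) (r := 1); [lra|reflexivity|].
    apply cdiff_div; [|apply cdiff_const|auto].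
    apply cdiff_plus; [apply cdiff_const|apply cdiff_id].
  - intros z H. discriminate.
  - intros z Hz. unfold baseY. split.
    + apply cdiff_div; [|apply cdiff_const|auto]. apply cdiff_mult.
      * apply cdiff_plus; [apply cdiff_const|apply cdiff_id].
      * apply cdiff_minus; [apply cdiff_const|apply cdiff_id].
    + intros E. apply Hz, Inl. replace ((1 + z) * (1 - z))%C with ((1 + z) * (1 - z) / 2 * 2)%C by (field; auto).
      rewrite E. ring.
  - intros x Hx. assert (x <> -1 /\ x <> 1) by (split; intros ->; apply Hx; simpl; auto).
    assert (EY : Cmod (baseY (RtoC x)) = Rabs ((1 + x) * (1 - x) / 2)).
    { unfold baseY. rewrite <- RtoC_minus, <- RtoC_plus, <- RtoC_mult, <- RtoC_div, Cmod_R; auto. }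
    assert (EP : Cmod (1 - RtoC x) = Rabs (1 - x)) by (rewrite <- RtoC_minus; apply Cmod_R).
    assert (A := Hm (RtoC x)).
    assert (A2 := Hm2 (RtoC x) ltac:(rewrite <- RtoC_plus; intros E; apply RtoC_inj in E; lra)).
    rewrite EY in A. rewrite EP in A2.
    split; [|split].
    + intros a b Ha Hb Hab.
      assert (a = -1 /\ b = 1) as [-> ->].
      { simpl in Ha, Hb. destruct Ha as [<-|[<-|[]]], Hb as [<-|[<-|[]]]; split; auto; lra. }
      rewrite Rabs_pos_eq in A by nra. nra.
    + intros a Ha Hall. assert (H1 := Hall 1 ltac:(simpl; auto)).
      rewrite Rabs_left in A2 by lra.
      simpl in Ha; destruct Ha as [<-|[<-|[]]]; lra.
    + intros a Ha Hall. assert (H1 := Hall (-1) ltac:(simpl; auto)).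
      assert (M1 : dist_ratio baseG baseY (RtoC x) <= 2 * (-1 - x)).
      { unfold dist_ratio. rewrite EY. unfold baseG, finite_part.
        replace (Cmod ((1 + RtoC x) / 2)) with ((-1 - x) / 2).
        - assert (U1 := Rmax_l 1 ((-1 - x) / 2)). assert (U2 := Rmax_r 1 ((-1 - x) / 2)).
          apply Rle_div_l; [lra|]. rewrite Rabs_left by nra. nra.
        - rewrite <- RtoC_plus, <- RtoC_div, Cmod_R, Rabs_left; lra. }
      simpl in Ha; destruct Ha as [<-|[<-|[]]]; lra.
  - intros x Hx. exists 2, 1. split; [lra|]. intros z Hz.
    apply Rle_trans with (1 := Hm z). unfold baseY.
    rewrite Cmod_div, Cmod_mult, Cmod_R, (Rabs_pos_eq 2) by (auto; lra).
    simpl in Hx. destruct Hx as [<-|[<-|[]]].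
    + replace (Cmod (1 + z)) with (Cmod (z - RtoC (-1)))
        by (f_equal; apply injective_projections; simpl; ring).
      assert (T := Cmod_minus_le 2 (z - RtoC (-1))).
      replace (2 - (z - RtoC (-1)))%C with (1 - z)%C in T by (apply injective_projections; simpl; ring).
      rewrite Cmod_R, Rabs_pos_eq in T by lra. nra.
    + rewrite (Cmod_minus_sym 1 z).
      assert (T := Cmod_triangle 2 (z - RtoC 1)).
      replace (2 + (z - RtoC 1))%C with (1 + z)%C in T by (apply injective_projections; simpl; ring).
      rewrite Cmod_R, Rabs_pos_eq in T by lra. nra.
  - exists 2, 2. intros z Hz.
    assert (T := Cmod_minus_le 1 z). rewrite Cmod_1 in T.
    assert (N : (1 + z)%C <> 0%C).
    { intros E. assert (T2 := Cmod_lower z 1). rewrite Cplus_comm, E, Cmod_0, Cmod_1 in T2. lra. }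
    apply Rle_trans with (1 := Hm2 z N). lra.
  - intros M. exists (2 * Rabs M + 1). intros z Hz. unfold baseG, finite_part.
    rewrite Cmod_div, Cmod_R, (Rabs_pos_eq 2) by (auto; lra).
    assert (T2 := Cmod_lower z 1). rewrite Cplus_comm, Cmod_1 in T2.
    assert (U := Rle_abs M). lra.
  - intros x [<-|[<-|[]]]; lra.
Qed.

(** The Chebyshev polynomial T_2. Since T_2(cos t) = cos (2t), its iterates are the Chebyshev
    polynomials of degree 2^k. *)
Definition cmap (z : C) : C := (2 * (z * z) - 1)%C.
Definition cmap' (z : C) : C := (4 * z)%C.
Definition clist (l : list R) : list R :=
  flat_map (fun y => sqrt ((1 + y) / 2) :: - sqrt ((1 + y) / 2) :: nil) l.

Lemma gap_bound_of_ext (P Q : R -> Prop) (x v : R) : (forall c, P c <-> Q c) -> gap_bound_of P x v -> gap_bound_of Q x v.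
Proof.
  intros E [H1 [H2 H3]]. split; [|split].
  - intros a b Ha Hb. apply H1; now apply E.
  - intros a Ha Hall. apply H2; [now apply E|]. intros b Hb. now apply Hall, E.
  - intros a Ha Hall. apply H3; [now apply E|]. intros b Hb. now apply Hall, E.
Qed.

Section Chebyshev.
Variable l : list R.
Hypotheses (Hl1 : In (-1) l) (Hl2 : In 1 l) (Hb : forall y, In y l -> -1 <= y <= 1).

Lemma clist_spec (x : R) : In x (clist l) <-> In (2 * (x * x) - 1) l.
Proof.
  unfold clist. rewrite in_flat_map. split.
  - intros [y [Hy Hx]]. assert (Q := Hb y Hy).
    assert (E : sqrt ((1 + y) / 2) * sqrt ((1 + y) / 2) = (1 + y) / 2) by (apply sqrt_sqrt; lra).
    replace (2 * (x * x) - 1) with y; auto.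
    destruct Hx as [<-|[<-|[]]]; lra.
  - intros H. exists (2 * (x * x) - 1). split; auto.
    replace ((1 + (2 * (x * x) - 1)) / 2) with (x * x) by lra.
    change (x * x) with (Rsqr x). rewrite sqrt_Rsqr_abs. simpl.
    unfold Rabs. destruct (Rcase_abs x); [right; left|left]; lra.
Qed.

Lemma cmap_R (x : R) : cmap (RtoC x) = RtoC (2 * (x * x) - 1).
Proof. unfold cmap. now rewrite RtoC_minus, !RtoC_mult. Qed.

Lemma cheb_E (z : C) : inE (clist l) z <-> inE l (cmap z).
Proof.
  split.
  - intros [x [Hx ->]]. apply clist_spec in Hx. exists (2 * (x * x) - 1). split; auto. apply cmap_R.
  - intros [y [Hy E]]. assert (Q := Hb y Hy). set (q := sqrt ((1 + y) / 2)).
    assert (Eq : q * q = (1 + y) / 2) by (apply sqrt_sqrt; lra).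
    assert (E2 : ((z - RtoC q) * (z - RtoC (- q)))%C = 0%C).
    { rewrite RtoC_opp.
      assert (E3 : (RtoC q * RtoC q)%C = ((1 + RtoC y) / 2)%C).
      { rewrite <- RtoC_mult, Eq, RtoC_div, RtoC_plus; auto. }
      replace ((z - RtoC q) * (z - - RtoC q))%C with (z * z - RtoC q * RtoC q)%C by ring.
      rewrite E3, <- E. unfold cmap. field. }
    apply Cmult_zero in E2.
    destruct E2 as [E2|E2]; apply Cminus_0_eq in E2; rewrite E2; (eexists; split; [|reflexivity]);
      apply in_flat_map; exists y; (split; [auto|]); unfold q; simpl; auto.
Qed.

(** As in the case of a doubling; 0, the critical point, lies over -1. The inequality behind it is
    (x + a) (x + b) <= 2 x (a + b), whose sides differ by (x - a) (b - x). *)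
Lemma cheb_HB_pos (x v : R) : 0 < x -> ~ In x (clist l) ->
  gap_bound_of (fun c => In c l) (2 * (x * x) - 1) (v * (4 * x)) -> gap_bound_of (fun c => In c (clist l)) x v.
Proof.
  intros Hx Hn H.
  destruct (Rle_or_lt v 0) as [Hv|Hv]; [now apply gap_bound_of_nonpos|].
  assert (P0 : In 0 (clist l)) by (apply clist_spec; now replace (2 * (0 * 0) - 1) with (-1) by ring).
  destruct H as [H1 [H2 H3]]. split; [|split].
  - intros a b Ha Hb' Hab.
    set (a2 := Rmax a 0). assert (A2 : In a2 (clist l)) by (unfold a2, Rmax; destruct (Rle_dec a 0); auto).
    assert (A3 : a <= a2) by apply Rmax_l. assert (A4 : 0 <= a2) by apply Rmax_r.
    assert (A5 : a2 < x) by (apply Rmax_lub_lt; lra).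
    apply gap_bound_of_mono_l with a2; try lra.
    assert (K := H1 _ _ (proj1 (clist_spec _) A2) (proj1 (clist_spec _) Hb') ltac:(split; nra)).
    apply Rmult_le_reg_r with (x * (a2 + b)); [nra|].
    apply Rle_trans with ((x - a2) * (b - x) * ((x + a2) * (b + x))); [lra|].
    replace (2 * ((x - a2) * (b - x)) * (x * (a2 + b))) with
      ((x - a2) * (b - x) * (2 * (x * (a2 + b)))) by ring.
    apply Rmult_le_compat_l; nra.
  - intros a Ha Hall.
    set (a2 := Rmax a 0). assert (A2 : In a2 (clist l)) by (unfold a2, Rmax; destruct (Rle_dec a 0); auto).
    assert (A3 : a <= a2) by apply Rmax_l. assert (A4 : 0 <= a2) by apply Rmax_r.
    assert (A5 : a2 < x) by (now apply Hall).
    assert (K := H2 _ (proj1 (clist_spec _) A2)).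
    assert (Kb : forall b, In b l -> b < 2 * (x * x) - 1).
    { intros y Hy. apply Rnot_le_lt. intros Hc. assert (Q := Hb y Hy).
      set (q := sqrt ((1 + y) / 2)).
      assert (Eq : q * q = (1 + y) / 2) by (apply sqrt_sqrt; lra).
      assert (q < x).
      { apply Hall, clist_spec. now replace (2 * (q * q) - 1) with y by lra. }
      assert (0 <= q) by apply sqrt_pos. nra. }
    specialize (K Kb). assert (v <= 2 * (x - a2)); [|lra].
    apply Rmult_le_reg_r with (4 * x); nra.
  - intros a Ha Hall. specialize (Hall _ P0). lra.
Qed.

Lemma cmap_cderiv (z : C) : cderiv cmap z (cmap' z).
Proof.
  assert (D := cderiv_mult _ _ _ _ _ (cderiv_id z) (cderiv_id z)).
  assert (D2 := cderiv_mult _ _ _ _ _ (cderiv_const 2 z) D).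
  assert (D3 := cderiv_plus _ _ _ _ _ D2 (cderiv_const (- (1)) z)). cbv beta in D3.
  unfold cmap'. replace (4 * z)%C with (0 * (z * z) + 2 * (1 * z + z * 1) + 0)%C; [exact D3|].
  apply injective_projections; simpl; ring.
Qed.

Lemma cheb_pullable : pullable cmap cmap' (fun _ => False) l (clist l).
Proof.
  assert (four : RtoC 4 <> 0%C) by (intros E; apply RtoC_inj in E; lra).
  assert (P0 : In 0 (clist l)) by (apply clist_spec; now replace (2 * (0 * 0) - 1) with (-1) by ring).
  constructor; try contradiction.
  - intros z _. exists 1. split; [lra|auto].
  - intros z _. apply cmap_cderiv.
  - intros z Hz. split; [apply cdiff_mult; [apply cdiff_const|apply cdiff_id]|].
    apply Cmult_neq_0; auto. intros ->. apply Hz. now exists 0.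
  - intros z _. apply cheb_E.
  - intros x Hx. exists (2 * (x * x) - 1). split; [apply cmap_R|]. intros v Hv.
    assert (N : x <> 0) by (intros ->; auto).
    assert (E : Cmod (cmap' (RtoC x)) = 4 * Rabs x).
    { unfold cmap'. rewrite Cmod_mult, !Cmod_R, (Rabs_pos_eq 4); lra. }
    rewrite E. assert (PA := Rabs_pos_lt x N).
    destruct (Rlt_or_le 0 x).
    + rewrite Rabs_pos_eq in * by lra. apply cheb_HB_pos; auto.
      replace (v / (4 * x) * (4 * x)) with v by (field; lra). exact Hv.
    + assert (S : forall c, In (0 + -1 * c) (clist l) <-> In c (clist l)).
      { intros c. rewrite !clist_spec. now replace ((0 + -1 * c) * (0 + -1 * c)) with (c * c) by ring. }
      assert (K : gap_bound_of (fun c => In c (clist l)) (- x) (v / (4 * Rabs x))).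
      { apply cheb_HB_pos; [lra| |].
        - intros K. apply Hx. apply S. now replace (0 + -1 * x) with (- x) by ring.
        - rewrite Rabs_left by lra. replace (v / (4 * - x) * (4 * - x)) with v by (field; lra).
          replace (- x * - x) with (x * x) by ring. exact Hv. }
      apply (gap_bound_of_affine _ (-1) 0) in K; [|ring].
      replace (-1 * (- x - 0)) with x in K by ring.
      exact (gap_bound_of_ext _ _ _ _ S K).
  - intros x Hx _. destruct (Req_dec x 0) as [->|N].
    + exists 1, 1. split; [lra|]. intros z Hz.
      replace (z - RtoC 0)%C with z in * by ring.
      replace (cmap z - cmap (RtoC 0))%C with (2 * (z * z))%C by (unfold cmap; ring).
      unfold cmap'. rewrite !Cmod_mult, !Cmod_R, !Rabs_pos_eq by lra. nra.
    + apply near_of_deriv; [apply cmap_cderiv| |].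
      * apply Cmult_neq_0; auto. intros E; apply RtoC_inj in E; auto.
      * apply cdiff_ccont, cdiff_mult; [apply cdiff_const|apply cdiff_id].
  - exists 1, 1. intros z Hz. split; auto. unfold cmap, cmap'.
    assert (T := Cmod_minus_le (2 * (z * z)) 1). rewrite !Cmod_mult, Cmod_1 in T.
    rewrite Cmod_mult. rewrite !Cmod_R, !Rabs_pos_eq in * by lra. nra.
  - intros M. exists (Rmax 1 M). intros z Hz.
    assert (A := Rmax_l 1 M). assert (B := Rmax_r 1 M). unfold cmap.
    assert (T := Cmod_lower_minus (2 * (z * z)) 1). rewrite !Cmod_mult, Cmod_1 in T.
    rewrite !Cmod_R, !Rabs_pos_eq in * by lra. nra.
  - intros x Hx. apply clist_spec, Hb in Hx. split; nra.
Qed.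
End Chebyshev.

Definition free (l : list R) (a b : R) : Prop := forall x, In x l -> ~ a < x < b.

Lemma cheb_states (k : nat) : exists G Y l, admissible G Y l /\
  forall t, In (cos t) l <-> (cos (2 ^ k * t) = 1 \/ cos (2 ^ k * t) = -1).
Proof.
  induction k as [|k [G [Y [l [HO HI]]]]].
  - exists baseG, baseY, (-1 :: 1 :: nil). split; [apply base_admissible|].
    intros t. simpl. rewrite Rmult_1_l. split; [intros [H|[H|[]]]; lra|intros [H|H]; lra].
  - exists (pullG G cmap (fun _ => False)), (pullY Y cmap cmap'), (clist l).
    assert (E1 : In 1 l).
    { rewrite <- cos_0. apply HI. rewrite Rmult_0_r, cos_0. auto. }
    assert (E2 : In (-1) l).
    { rewrite <- cos_PI. apply HI.
      destruct k as [|k]; [rewrite pow_O, Rmult_1_l, cos_PI; auto|].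
      left. replace (2 ^ S k * PI) with (0 + 2 * INR (2 ^ k) * PI)
        by (rewrite pow_INR; change (INR 2) with 2; simpl; ring).
      rewrite cos_period. apply cos_0. }
    split.
    + apply pull_admissible with (l := l); auto. apply cheb_pullable; auto. apply (ok_l _ _ _ HO).
    + intros t. rewrite clist_spec by apply (ok_l _ _ _ HO).
      replace (2 * (cos t * cos t) - 1) with (cos (2 * t)) by (rewrite cos_2a_cos; ring).
      rewrite HI. replace (2 ^ S k * t) with (2 ^ k * (2 * t)) by (simpl; ring). reflexivity.
Qed.

(** The points of [l] are the values of cos at the multiples of PI / 2^k. As cos is Lipschitz with
    constant 1, their gaps have length at most PI / 2^k. *)
Lemma initial_state (D : R) : 0 < D -> exists G Y l, admissible G Y l /\ In (-1) l /\ In 1 l /\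
  forall a b, -1 <= a -> a < b -> b <= 1 -> free l a b -> b - a <= D.
Proof.
  intros HD. destruct (Pow_x_infinity 2 ltac:(rewrite Rabs_pos_eq; lra) (PI / D)) as [k Hk].
  specialize (Hk k (le_n k)). rewrite Rabs_pos_eq in Hk by (apply pow_le; lra).
  destruct (cheb_states k) as [G [Y [l [HO HI]]]]. exists G, Y, l. split; auto.
  assert (P := PI_RGT_0). assert (P2 : 0 < 2 ^ k) by (apply pow_lt; lra).
  assert (Hint : forall j : Z, In (cos (IZR j * PI / 2 ^ k)) l).
  { intros j. apply HI. replace (2 ^ k * (IZR j * PI / 2 ^ k)) with (IZR j * PI) by (field; lra).
    assert (S0 : sin (IZR j * PI) = 0) by (apply sin_eq_0_1; eauto).
    assert (S2 := sin2_cos2 (IZR j * PI)). rewrite S0 in S2. unfold Rsqr in S2.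
    assert (S3 : (cos (IZR j * PI) - 1) * (cos (IZR j * PI) + 1) = 0) by lra.
    apply Rmult_integral in S3. destruct S3; [left|right]; lra. }
  split; [|split].
  - rewrite <- cos_PI. replace PI with (IZR (2 ^ Z.of_nat k) * PI / 2 ^ k); [apply Hint|].
    rewrite <- pow_IZR. field. lra.
  - rewrite <- cos_0. replace 0 with (IZR 0 * PI / 2 ^ k); [apply Hint|]. field. lra.
  - intros a b Ha Hab Hb Hf. apply Rnot_lt_le. intros HD2.
    set (al := acos a). set (be := acos b).
    assert (Ea : cos al = a) by (apply cos_acos; lra).
    assert (Eb : cos be = b) by (apply cos_acos; lra).
    assert (Ba := acos_bound a). assert (Bb := acos_bound b). fold al in Ba. fold be in Bb.
    assert (Hlt : be < al).
    { apply Rnot_le_lt. intros H. destruct H as [H| ->]; [|lra].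
      assert (K := cos_decreasing_1 al be ltac:(lra) ltac:(lra) ltac:(lra) ltac:(lra) H). lra. }
    assert (Hlip : b - a <= al - be).
    { destruct (MVT_gen cos be al (fun x => - sin x)) as [c [Hc1 Hc2]].
      - intros x _. auto_derive; auto; ring.
      - intros x _. apply continuity_pt_filterlim, continuous_cos.
      - rewrite Ea, Eb in Hc2. assert (S := SIN_bound c). nra. }
    (* The first multiple of PI / 2^k beyond [be]. An interval longer than D leaves room for it
       before [al]. *)
    set (j := up (be * 2 ^ k / PI)). assert (U := archimed (be * 2 ^ k / PI)). fold j in U.
    set (th := IZR j * PI / 2 ^ k).
    assert (T1 : be < th).
    { unfold th. apply Rlt_div_r; auto. destruct U as [U _]. apply Rgt_lt, Rlt_div_l in U; auto. }
    assert (T2 : th < al).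
    { apply Rle_lt_trans with (be + PI / 2 ^ k).
      - unfold th. replace (be + PI / 2 ^ k) with ((be * 2 ^ k / PI + 1) * PI / 2 ^ k) by (field; lra).
        apply Rmult_le_compat_r; [left; now apply Rinv_0_lt_compat|]. apply Rmult_le_compat_r; lra.
      - assert (PI / 2 ^ k <= D); [|lra]. apply Rle_div_l; auto. apply Rge_le, Rle_div_l in Hk; auto.
        lra. }
    apply (Hf (cos th)); [apply Hint|]. rewrite <- Ea, <- Eb.
    split; apply cos_decreasing_1; lra.
Qed.

(** * Changes of variable close to the identity *)

Definition far (u v d : R) (z : C) : Prop := forall x, u <= x <= v -> d <= Cmod (z - RtoC x).

(* [f] is close to the identity away from the zone [u,v], with errors governed by the
   mass [K]; [J] is a right inverse of [f] on the upper half-plane. The bound on [K] is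
   additive under composition. *)
Record trans (f J : C -> C) (K : R) (G : C -> Chat) (Y : C -> C) (u v : R)
    (G' : C -> Chat) (Y' : C -> C) (u' v' : R) : Prop := {
  tr_zone : u <= u' /\ u' < v' /\ v' <= v;
  tr_K : 0 <= K <= (v - u) * ((v - u) - (v' - u'));
  tr_far : forall e z, 0 < e -> far u v (e + K / e) z ->
    cdiff f z /\ Cmod (f z - z) <= K / e /\ G' z = G (f z) /\
    Cmod (Y (f z)) <= exp (K / (e * e)) * Cmod (Y' z) /\ f (Cconj z) = Cconj (f z);
  tr_two : forall e z w, 0 < e -> far u v (e + K / e) z -> far u v (e + K / e) w ->
    Cmod (f z - f w - (z - w)) <= (exp (K / (e * e)) - 1) * Cmod (z - w);
  tr_J : forall t, 0 < Im t -> Im t <= Im (J t) /\ Cmod (J t - t) <= K / Im t /\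
    cdiff J t /\ G' (J t) = G t /\ f (J t) = t
}.

Lemma far_mono (u v d u' v' d' : R) (z : C) : u <= u' -> v' <= v -> d' <= d ->
  far u v d z -> far u' v' d' z.
Proof. intros A B D H x Hx. apply Rle_trans with (1 := D). apply H. lra. Qed.

Lemma far_move (u v d e : R) (z w : C) : Cmod (w - z) <= e -> far u v (d + e) z -> far u v d w.
Proof.
  intros A H x Hx. specialize (H x Hx).
  assert (T := Cmod_tri_minus z w (RtoC x)). rewrite Cmod_minus_sym in A. lra.
Qed.

Lemma trans_refl (G : C -> Chat) (Y : C -> C) (u v : R) : u < v ->
  trans (fun z => z) (fun z => z) 0 G Y u v G Y u v.
Proof.
  intros H. constructor.
  - lra.
  - lra.
  - intros e z He _. split; [apply cdiff_id|]. replace (z - z)%C with (RtoC 0) by ring.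
    rewrite Cmod_0. unfold Rdiv. rewrite !Rmult_0_l, exp_0.
    split; [lra|split; [auto|split; [lra|auto]]].
  - intros e z w He _ _. replace (z - w - (z - w))%C with (RtoC 0) by ring.
    rewrite Cmod_0. unfold Rdiv. rewrite !Rmult_0_l, exp_0. lra.
  - intros t Ht. replace (t - t)%C with (RtoC 0) by ring. rewrite Cmod_0.
    unfold Rdiv. rewrite Rmult_0_l. split; [lra|split; [lra|split; [apply cdiff_id|auto]]].
Qed.

Lemma div_ge_0 (K e : R) : 0 <= K -> 0 < e -> 0 <= K / e.
Proof. apply Rdiv_le_0_compat. Qed.

Lemma one_plus_le_exp (x : R) : 1 + x <= exp x.
Proof. destruct (Req_dec x 0) as [->|N]; [rewrite exp_0; lra|left; now apply exp_ineq1]. Qed.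

(** The inner map moves a point by at most K2 / e, so a point at distance e + (K1 + K2) / e of the
    zone stays at distance e + K1 / e. The factors exp (K / e^2) multiply when the masses are
    added. *)
Lemma trans_comp (f1 J1 f2 J2 : C -> C) (K1 K2 : R) (G G1 G2 : C -> Chat) (Y Y1 Y2 : C -> C)
  (u v u1 v1 u2 v2 : R) :
  trans f1 J1 K1 G Y u v G1 Y1 u1 v1 -> trans f2 J2 K2 G1 Y1 u1 v1 G2 Y2 u2 v2 ->
  trans (fun z => f1 (f2 z)) (fun z => J2 (J1 z)) (K1 + K2) G Y u v G2 Y2 u2 v2.
Proof.
  intros H1 H2. assert (Z1 := tr_zone _ _ _ _ _ _ _ _ _ _ _ H1).
  assert (Z2 := tr_zone _ _ _ _ _ _ _ _ _ _ _ H2).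
  assert (k1 := tr_K _ _ _ _ _ _ _ _ _ _ _ H1). assert (k2 := tr_K _ _ _ _ _ _ _ _ _ _ _ H2).
  assert (F : forall e z, 0 < e -> far u v (e + (K1 + K2) / e) z ->
    far u1 v1 (e + K2 / e) z /\ far u v (e + K1 / e) (f2 z)).
  { intros e z He Hz. replace ((K1 + K2) / e) with (K1 / e + K2 / e) in Hz by (field; lra).
    assert (A1 := div_ge_0 K1 e (proj1 k1) He). assert (A2 := div_ge_0 K2 e (proj1 k2) He).
    assert (X : far u1 v1 (e + K2 / e) z) by (apply far_mono with (4 := Hz); lra).
    split; auto. destruct (tr_far _ _ _ _ _ _ _ _ _ _ _ H2 e z He X) as [_ [B _]].
    apply far_move with (1 := B). apply far_mono with (4 := Hz); lra. }
  assert (EE : forall e, 0 < e -> exp ((K1 + K2) / (e * e)) = exp (K1 / (e * e)) * exp (K2 / (e * e))).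
  { intros e He. rewrite <- exp_plus. f_equal. field. lra. }
  constructor.
  - lra.
  - split; [lra|]. nra.
  - intros e z He Hz. destruct (F e z He Hz) as [X1 X2].
    destruct (tr_far _ _ _ _ _ _ _ _ _ _ _ H2 e z He X1) as [A1 [A2 [A3 [A4 A5]]]].
    destruct (tr_far _ _ _ _ _ _ _ _ _ _ _ H1 e (f2 z) He X2) as [B1 [B2 [B3 [B4 B5]]]].
    split; [now apply cdiff_comp|]. split; [|split; [|split]].
    + assert (T := Cmod_tri_minus (f1 (f2 z)) (f2 z) z).
      replace ((K1 + K2) / e) with (K1 / e + K2 / e) by (field; lra). lra.
    + now rewrite A3.
    + rewrite EE by auto. apply Rle_trans with (1 := B4). rewrite Rmult_assoc.
      apply Rmult_le_compat_l; [left; apply exp_pos|auto].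
    + now rewrite A5, B5.
  - intros e z w He Hz Hw. destruct (F e z He Hz) as [X1 X2]. destruct (F e w He Hw) as [W1 W2].
    assert (A := tr_two _ _ _ _ _ _ _ _ _ _ _ H2 e z w He X1 W1).
    assert (B := tr_two _ _ _ _ _ _ _ _ _ _ _ H1 e _ _ He X2 W2).
    rewrite EE by auto. set (p := exp (K1 / (e * e))) in *. set (q := exp (K2 / (e * e))) in *.
    assert (P1 : 1 <= p).
    { assert (0 <= K1 / (e * e)) by (apply div_ge_0; [lra|nra]).
      assert (T := one_plus_le_exp (K1 / (e * e))). fold p in T. lra. }
    assert (T := Cmod_triangle (f1 (f2 z) - f1 (f2 w) - (f2 z - f2 w)) (f2 z - f2 w - (z - w))).
    replace (f1 (f2 z) - f1 (f2 w) - (f2 z - f2 w) + (f2 z - f2 w - (z - w)))%C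
      with (f1 (f2 z) - f1 (f2 w) - (z - w))%C in T by ring.
    assert (T2 := Cmod_triangle (f2 z - f2 w - (z - w)) (z - w)).
    replace (f2 z - f2 w - (z - w) + (z - w))%C with (f2 z - f2 w)%C in T2 by ring.
    assert (T3 : (p - 1) * Cmod (f2 z - f2 w) <= (p - 1) * (q * Cmod (z - w)))
      by (apply Rmult_le_compat_l; lra).
    lra.
  - intros t Ht. destruct (tr_J _ _ _ _ _ _ _ _ _ _ _ H1 t Ht) as [A1 [A2 [A3 [A4 A5]]]].
    destruct (tr_J _ _ _ _ _ _ _ _ _ _ _ H2 (J1 t) ltac:(lra)) as [B1 [B2 [B3 [B4 B5]]]].
    split; [lra|split; [|split; [|split]]].
    + assert (T := Cmod_tri_minus (J2 (J1 t)) (J1 t) t).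
      replace ((K1 + K2) / Im t) with (K1 / Im t + K2 / Im t) by (field; lra).
      assert (K2 / Im (J1 t) <= K2 / Im t).
      { apply Rmult_le_compat_l; [lra|]. now apply Rinv_le_contravar. }
      lra.
    + now apply cdiff_comp.
    + now rewrite B4.
    + now rewrite B5.
Qed.

Lemma Cconj_R (x : R) : Cconj (RtoC x) = RtoC x.
Proof. apply injective_projections; simpl; ring. Qed.

Lemma dmap_conj (s r : R) (z : C) : z <> RtoC s -> dmap s r (Cconj z) = Cconj (dmap s r z).
Proof.
  intros H. unfold dmap. rewrite Cplus_conj, Cdiv_conj, Cminus_conj, !Cconj_R; auto.
  now apply Cminus_neq_0.
Qed.

(** The new ends are the preimages of the old ones outside of the doubled gap. The left end alone
    moves by r^2 / (s - u'), which is at least r^2 / (v - u) and thus pays for the mass r^2. *)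
Lemma trans_double (G : C -> Chat) (Y : C -> C) (u v s r u' v' : R) : 0 < r ->
  u <= s - 2 * r -> s + 2 * r <= v -> u' <= s - r -> s + r <= v' ->
  u' - r * r / (s - u') = u -> v' + r * r / (v' - s) = v ->
  exists J, trans (dmap s r) J (r * r) G Y u v
    (pullG G (dmap s r) (dpole s)) (pullY Y (dmap s r) (dmap' s r)) u' v'.
Proof.
  intros Hr Hu Hv Hu' Hv' Eu Ev. assert (Kp : 0 < r * r) by nra.
  destruct (dmap_inverse s r Hr) as [J HJ]. exists J.
  assert (Q1 : r * r / (v - u) <= r * r / (s - u')).
  { apply Rmult_le_compat_l; [lra|]. apply Rinv_le_contravar; [lra|].
    assert (0 < r * r / (s - u')) by (apply Rdiv_lt_0_compat; lra). lra. }
  assert (Q2 : 0 < r * r / (v' - s)) by (apply Rdiv_lt_0_compat; lra).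
  assert (Q0 : 0 < r * r / (v - u)) by (apply Rdiv_lt_0_compat; lra).
  assert (F : forall e z, 0 < e -> far u v (e + r * r / e) z ->
     e <= Cmod (z - RtoC s) /\ z <> RtoC s).
  { intros e z He Hz. assert (0 < r * r / e) by (apply Rdiv_lt_0_compat; lra).
    specialize (Hz s ltac:(lra)). split; [lra|]. intros ->.
    replace (RtoC s - RtoC s)%C with (RtoC 0) in Hz by ring. rewrite Cmod_0 in Hz. lra. }
  constructor.
  - lra.
  - split; [lra|]. replace (r * r) with ((v - u) * (r * r / (v - u))) by (field; lra).
    apply Rmult_le_compat_l; lra.
  - intros e z He Hz. destruct (F e z He Hz) as [A N]. assert (NW := Cminus_neq_0 _ _ N).
    assert (PW := proj1 (Cmod_gt_0 _) NW).
    split; [eexists; now apply dmap_cderiv|]. split; [|split; [|split]].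
    + unfold dmap. replace (z + RtoC (r * r) / (z - RtoC s) - z)%C
        with (RtoC (r * r) / (z - RtoC s))%C by ring.
      rewrite Cmod_div, Cmod_R, Rabs_pos_eq by (auto; lra).
      apply Rmult_le_compat_l; [lra|]. now apply Rinv_le_contravar.
    + now apply pullG_eq.
    + assert (Nd : dmap' s r z <> 0%C).
      { intros E. assert (E2 : ((z - RtoC (s + r)) * (z - RtoC (s - r)))%C = 0%C).
        { rewrite RtoC_plus, RtoC_minus.
          replace ((z - (RtoC s + RtoC r)) * (z - (RtoC s - RtoC r)))%C with
            ((z - RtoC s) * (z - RtoC s) * dmap' s r z)%C; [rewrite E; ring|].
          unfold dmap'. rewrite RtoC_mult. field. auto. }
        assert (0 < r * r / e) by (apply Rdiv_lt_0_compat; lra).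
        apply Cmult_zero in E2; destruct E2 as [E2|E2].
        - specialize (Hz (s + r) ltac:(lra)). rewrite E2, Cmod_0 in Hz. lra.
        - specialize (Hz (s - r) ltac:(lra)). rewrite E2, Cmod_0 in Hz. lra. }
      unfold pullY. rewrite Cmod_div by auto.
      assert (P := proj1 (Cmod_gt_0 _) Nd).
      assert (D : Cmod (dmap' s r z) <= exp (r * r / (e * e))).
      { apply Rle_trans with (2 := one_plus_le_exp _). unfold dmap'.
        apply Rle_trans with (1 := Cmod_minus_le _ _). rewrite Cmod_1. apply Rplus_le_compat_l.
        rewrite Cmod_div, Cmod_R, Rabs_pos_eq, Cmod_mult by (try apply Cmult_neq_0; auto; lra).
        apply Rmult_le_compat_l; [lra|]. apply Rinv_le_contravar; nra. }
      replace (Cmod (Y (dmap s r z))) with (Cmod (dmap' s r z) * (Cmod (Y (dmap s r z)) / Cmod (dmap' s r z)))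
        at 1 by (field; lra).
      apply Rmult_le_compat_r; auto. apply div_ge_0; [apply Cmod_ge_0|auto].
    + now apply dmap_conj.
  - intros e z w He Hz Hw. destruct (F e z He Hz) as [A N]. destruct (F e w He Hw) as [A' N'].
    rewrite dmap_two by auto.
    assert (NW := Cminus_neq_0 _ _ N). assert (NW' := Cminus_neq_0 _ _ N').
    replace ((z - w) * (1 - RtoC (r * r) / ((z - RtoC s) * (w - RtoC s))) - (z - w))%C with
      (- (RtoC (r * r) / ((z - RtoC s) * (w - RtoC s)) * (z - w)))%C by ring.
    rewrite Cmod_opp, Cmod_mult. apply Rmult_le_compat_r; [apply Cmod_ge_0|].
    assert (E := one_plus_le_exp (r * r / (e * e))).
    rewrite Cmod_div, Cmod_R, Rabs_pos_eq, Cmod_mult by (try apply Cmult_neq_0; auto; lra).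
    assert (r * r / (Cmod (z - RtoC s) * Cmod (w - RtoC s)) <= r * r / (e * e)); [|lra].
    apply Rmult_le_compat_l; [lra|]. apply Rinv_le_contravar; nra.
  - intros t Ht. destruct (HJ t Ht) as [J1 [J2 [J3 J4]]]. split; [auto|split; [auto|split; [auto|split; [|auto]]]].
    rewrite pullG_eq; [now rewrite J1|]. unfold dpole. intros E. rewrite E in J2.
    unfold Im in J2 at 2. simpl in J2. lra.
Qed.

(** * One sweep of doublings *)

Lemma le_div (a b c : R) : 0 < c -> a * c <= b -> a <= b / c.
Proof. intros H. now apply Rle_div_r. Qed.

Lemma div_le (a b c : R) : 0 < c -> a <= b * c -> a / c <= b.
Proof. intros H. now apply Rle_div_l. Qed.

Lemma lt_div (a b c : R) : 0 < c -> a * c < b -> a < b / c.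
Proof. intros H. now apply Rlt_div_r. Qed.

Lemma div_lt (a b c : R) : 0 < c -> a < b * c -> a / c < b.
Proof. intros H. now apply Rlt_div_l. Qed.

(* The map T + r^2/(T - s) takes the point at distance w outside of [s - r, s + r] to the one
   at distance [squeeze_dist r w] outside of [s - 2r, s + 2r]. *)
Definition squeeze_dist (r w : R) : R := w * w / (w + r).
Definition stretch_dist (r z : R) : R := (z + sqrt (z * z + 4 * r * z)) / 2.

Lemma stretch_dist_spec (r z : R) : 0 < r -> 0 <= z -> 0 <= stretch_dist r z /\ squeeze_dist r (stretch_dist r z) = z.
Proof.
  intros Hr Hz. unfold stretch_dist, squeeze_dist. set (q := sqrt (z * z + 4 * r * z)).
  assert (Hq : q * q = z * z + 4 * r * z) by (apply sqrt_sqrt; nra).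
  assert (Q0 : 0 <= q) by apply sqrt_pos. split; [lra|].
  apply Rmult_eq_reg_r with ((z + q) / 2 + r); [|lra].
  unfold Rdiv at 1. rewrite Rmult_assoc, Rinv_l by lra. nra.
Qed.

Lemma squeeze_dist_le (r w w' : R) : 0 < r -> 0 <= w <= w' -> squeeze_dist r w <= squeeze_dist r w'.
Proof.
  intros Hr H. unfold squeeze_dist. apply div_le; [lra|].
  replace (w' * w' / (w' + r) * (w + r)) with (w' * w' * (w + r) / (w' + r)) by (field; lra).
  apply le_div; [lra|].
  assert (0 <= (w' - w) * (w * w' + r * (w + w'))) by (apply Rmult_le_pos; nra). lra.
Qed.

Lemma squeeze_dist_lt_inv (r w w' : R) : 0 < r -> 0 <= w' -> squeeze_dist r w < squeeze_dist r w' -> 0 <= w -> w < w'.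
Proof.
  intros Hr H0 H Hw. apply Rnot_le_lt. intros C. assert (T := squeeze_dist_le r w' w Hr ltac:(lra)). lra.
Qed.

Lemma squeeze_dist_eq (r w : R) : 0 < r -> 0 <= w -> squeeze_dist r w = w - r + r * r / (w + r).
Proof. intros. unfold squeeze_dist. field. lra. Qed.

Lemma stretch_dist_kk (r w : R) : 0 < r -> 0 <= w -> stretch_dist r (squeeze_dist r w) = w.
Proof.
  intros Hr Hw. assert (K : 0 <= squeeze_dist r w) by (apply Rdiv_le_0_compat; nra).
  destruct (stretch_dist_spec r _ Hr K) as [A B].
  destruct (Rtotal_order (stretch_dist r (squeeze_dist r w)) w) as [C|[C|C]]; auto; exfalso.
  - assert (squeeze_dist r (stretch_dist r (squeeze_dist r w)) < squeeze_dist r w); [|lra].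
    set (x := stretch_dist r (squeeze_dist r w)) in *. clearbody x. clear B K.
    unfold squeeze_dist. apply div_lt; [lra|].
    replace (w * w / (w + r) * (x + r)) with (w * w * (x + r) / (w + r)) by (field; lra).
    apply lt_div; [lra|].
    assert (0 < (w - x) * (w * x + r * (w + x))) by (apply Rmult_lt_0_compat; nra). lra.
  - assert (squeeze_dist r w < squeeze_dist r (stretch_dist r (squeeze_dist r w))); [|lra].
    set (x := stretch_dist r (squeeze_dist r w)) in *. clearbody x. clear B K.
    unfold squeeze_dist. apply div_lt; [lra|].
    replace (x * x / (x + r) * (w + r)) with (x * x * (w + r) / (x + r)) by (field; lra).
    apply lt_div; [lra|].
    assert (0 < (x - w) * (w * x + r * (w + x))) by (apply Rmult_lt_0_compat; nra). lra.
Qed.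

(* Comparison function for the gaps to the right of the sweep. *)
Definition gap_weight_right (a w : R) : R := w - a * ln (1 + w / a).

Lemma gap_weight_right_0 (a : R) : gap_weight_right a 0 = 0.
Proof. unfold gap_weight_right, Rdiv. rewrite Rmult_0_l, Rplus_0_r, ln_1. ring. Qed.

Lemma mono_of_deriv (f f' : R -> R) (x y : R) : x <= y ->
  (forall t, x <= t <= y -> is_derive f t (f' t)) -> (forall t, x <= t <= y -> 0 <= f' t) ->
  f x <= f y.
Proof.
  intros Hxy Hd Hp. destruct (MVT_gen f x y f') as [c [C1 C2]].
  - intros t. rewrite Rmin_left, Rmax_right by auto. intros Ht. apply Hd. lra.
  - intros t. rewrite Rmin_left, Rmax_right by auto. intros Ht.
    apply continuity_pt_filterlim, (ex_derive_continuous f). exists (f' t). now apply Hd.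
  - rewrite Rmin_left, Rmax_right in C1 by auto. specialize (Hp c C1). nra.
Qed.

Lemma gap_weight_right_derive (a w : R) : 0 < a -> 0 <= w -> is_derive (gap_weight_right a) w (w / (w + a)).
Proof.
  intros Ha Hw. assert (0 <= w / a) by (apply Rdiv_le_0_compat; lra).
  unfold gap_weight_right. auto_derive; [lra|]. field. split; lra.
Qed.

Lemma gap_weight_right_mono (a x y : R) : 0 < a -> 0 <= x <= y -> gap_weight_right a x <= gap_weight_right a y.
Proof.
  intros Ha H. apply mono_of_deriv with (f' := fun w => w / (w + a)); [lra| |].
  - intros t Ht. apply gap_weight_right_derive; lra.
  - intros t Ht. apply Rdiv_le_0_compat; lra.
Qed.

Lemma gap_weight_right_lip (a x y : R) : 0 < a -> 0 <= x <= y -> gap_weight_right a y - gap_weight_right a x <= y - x.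
Proof.
  intros Ha H. unfold gap_weight_right.
  assert (0 <= x / a) by (apply Rdiv_le_0_compat; lra).
  assert (x / a <= y / a) by (apply Rmult_le_compat_r; [left; now apply Rinv_0_lt_compat|lra]).
  assert (ln (1 + x / a) <= ln (1 + y / a)) by (apply ln_le; lra). nra.
Qed.

(** A point at distance w on the right of the doubled gap was at distance [squeeze_dist r w] + 4r of
    the left end of this gap. The condition 4r <= 7a is what the comparison of derivatives requires
    at w = 0. *)
Lemma gap_weight_right_kk (a r x y : R) : 0 < r -> 4 * r <= 7 * a -> 0 <= x <= y ->
  gap_weight_right a y - gap_weight_right a x <= gap_weight_right a (squeeze_dist r y + 4 * r) - gap_weight_right a (squeeze_dist r x + 4 * r).
Proof.
  intros Hr Ha H.
  assert (M := mono_of_deriv (fun w => gap_weight_right a (squeeze_dist r w + 4 * r) - gap_weight_right a w)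
    (fun w => (w * (w + 2 * r) / ((w + r) * (w + r))) * ((squeeze_dist r w + 4 * r) / (squeeze_dist r w + 4 * r + a))
       - w / (w + a)) x y (proj2 H)).
  cbv beta in M. apply Rplus_le_reg_r with (gap_weight_right a x - gap_weight_right a y).
  assert (M' : gap_weight_right a (squeeze_dist r x + 4 * r) - gap_weight_right a x <= gap_weight_right a (squeeze_dist r y + 4 * r) - gap_weight_right a y); [|lra].
  apply M; clear M.
  - intros t Ht. assert (K : 0 <= squeeze_dist r t) by (apply Rdiv_le_0_compat; nra).
    apply (is_derive_minus (fun w => gap_weight_right a (squeeze_dist r w + 4 * r)) (gap_weight_right a)); [|apply gap_weight_right_derive; lra].
    apply (is_derive_comp (gap_weight_right a) (fun w => squeeze_dist r w + 4 * r)).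
    + apply gap_weight_right_derive; lra.
    + unfold squeeze_dist. auto_derive; [lra|]. field. lra.
  - intros t Ht.
    replace (squeeze_dist r t + 4 * r) with ((t + 2 * r) * (t + 2 * r) / (t + r)) by (unfold squeeze_dist; field; lra).
    assert (A1 : 0 < (t + 2 * r) * (t + 2 * r) + a * (t + r)) by nra.
    replace ((t + 2 * r) * (t + 2 * r) / (t + r) / ((t + 2 * r) * (t + 2 * r) / (t + r) + a)) with
      ((t + 2 * r) * (t + 2 * r) / ((t + 2 * r) * (t + 2 * r) + a * (t + r))) by (field; lra).
    replace (t * (t + 2 * r) / ((t + r) * (t + r)) * ((t + 2 * r) * (t + 2 * r) /
      ((t + 2 * r) * (t + 2 * r) + a * (t + r))) - t / (t + a)) with
     (t * r * (a * (3 * (t * t) + 9 * (t * r) + 7 * (r * r)) - r * ((t + 2 * r) * (t + 2 * r))) /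
       ((t + r) * (t + r) * ((t + 2 * r) * (t + 2 * r) + a * (t + r)) * (t + a))) by (field; lra).
    apply Rdiv_le_0_compat.
    + apply Rmult_le_pos; [nra|].
      assert (0 <= (7 * a - 4 * r) * (3 * (t * t) + 9 * (t * r) + 7 * (r * r)))
        by (apply Rmult_le_pos; nra).
      assert (0 <= r * (5 * (t * t) + 8 * (t * r))) by (apply Rmult_le_pos; nra). lra.
    + repeat apply Rmult_lt_0_compat; lra.
Qed.

Lemma ln_2_le : ln 2 <= 3 / 4.
Proof.
  apply Rnot_lt_le. intros H. apply exp_increasing in H. rewrite exp_ln in H by lra.
  assert (E := one_plus_le_exp (3 / 32)).
  assert (X : exp (3 / 4) = exp (3 / 32) ^ 8).
  { simpl. rewrite Rmult_1_r, <- !exp_plus. f_equal. field. }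
  assert (Y : (1 + 3 / 32) ^ 8 <= exp (3 / 32) ^ 8) by (apply pow_incr; lra).
  simpl in Y. rewrite X in H. simpl in H. lra.
Qed.

(** With a = 4/7 rho the logarithm is ln 8, at most 9/4, and 4 - 4/7 * 9/4 = 19/7. *)
Lemma gap_weight_right_4rho (rho : R) : 0 < rho -> 19 / 7 * rho <= gap_weight_right (4 / 7 * rho) (4 * rho).
Proof.
  intros H. unfold gap_weight_right. replace (1 + 4 * rho / (4 / 7 * rho)) with (2 * (2 * 2)) by (field; lra).
  rewrite !ln_mult by lra. assert (L := ln_2_le). nra.
Qed.

(* Comparison function for the gaps to the left of the sweep. *)
Definition gap_weight_left (rho q : R) : R := q + 8 / 5 * sqrt (rho * q).

Lemma gap_weight_left_le (rho x y : R) : 0 < rho -> 0 <= x <= y -> gap_weight_left rho x <= gap_weight_left rho y.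
Proof.
  intros Hr H. unfold gap_weight_left. assert (sqrt (rho * x) <= sqrt (rho * y)) by (apply sqrt_le_1_alt; nra). lra.
Qed.

Lemma gap_weight_left_expand (rho x y : R) : 0 < rho -> 0 <= x <= y -> y - x <= gap_weight_left rho y - gap_weight_left rho x.
Proof.
  intros Hr H. unfold gap_weight_left. assert (sqrt (rho * x) <= sqrt (rho * y)) by (apply sqrt_le_1_alt; nra). lra.
Qed.

Lemma gap_weight_left_sub (rho x y : R) : 0 < rho -> 0 <= x -> 0 <= y -> gap_weight_left rho (x + y) - gap_weight_left rho x <= gap_weight_left rho y.
Proof.
  intros Hr Hx Hy. unfold gap_weight_left.
  assert (sqrt (rho * (x + y)) <= sqrt (rho * x) + sqrt (rho * y)); [|lra].
  assert (A := sqrt_pos (rho * x)). assert (B := sqrt_pos (rho * y)).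
  assert (A2 := sqrt_sqrt (rho * x) ltac:(nra)). assert (B2 := sqrt_sqrt (rho * y) ltac:(nra)).
  rewrite <- (sqrt_Rsqr (sqrt (rho * x) + sqrt (rho * y))) by lra.
  apply sqrt_le_1_alt. unfold Rsqr. nra.
Qed.

Lemma gap_weight_left_rho (rho : R) : 0 < rho -> gap_weight_left rho rho = 13 / 5 * rho.
Proof. intros H. unfold gap_weight_left. rewrite sqrt_square by lra. lra. Qed.

(** A doubling moves a point at distance [squeeze_dist r w] behind the sweep to distance w + 2r. The
    square root in the weight compensates the stretching r^2 / (x + r) - r^2 / (y + r) of the gap;
    in terms of the roots Y of w + r and X of w + 2r the claim reduces to [Z]. *)
Lemma gap_weight_left_kk (rho r x y : R) : 0 < r <= rho -> 0 <= x <= y ->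
  gap_weight_left rho (y + 2 * r) - gap_weight_left rho (x + 2 * r) <= gap_weight_left rho (squeeze_dist r y) - gap_weight_left rho (squeeze_dist r x).
Proof.
  intros Hr H. set (R0 := sqrt rho).
  set (Y1 := sqrt (x + r)). set (Y2 := sqrt (y + r)).
  set (X1 := sqrt (x + 2 * r)). set (X2 := sqrt (y + 2 * r)).
  assert (QR : R0 * R0 = rho) by (apply sqrt_sqrt; lra).
  assert (QY1 : Y1 * Y1 = x + r) by (apply sqrt_sqrt; lra).
  assert (QY2 : Y2 * Y2 = y + r) by (apply sqrt_sqrt; lra).
  assert (QX1 : X1 * X1 = x + 2 * r) by (apply sqrt_sqrt; lra).
  assert (QX2 : X2 * X2 = y + 2 * r) by (apply sqrt_sqrt; lra).
  assert (PR : 0 < R0) by (apply sqrt_lt_R0; lra).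
  assert (PY1 : 0 < Y1) by (apply sqrt_lt_R0; lra).
  assert (PY2 : 0 < Y2) by (apply sqrt_lt_R0; lra).
  assert (PX1 : 0 < X1) by (apply sqrt_lt_R0; lra).
  assert (PX2 : 0 < X2) by (apply sqrt_lt_R0; lra).
  assert (L12 : Y1 <= Y2) by (apply sqrt_le_1_alt; lra).
  assert (M12 : X1 <= X2) by (apply sqrt_le_1_alt; lra).
  assert (SY : forall w Y, 0 <= w -> 0 < Y -> Y * Y = w + r -> sqrt (rho * squeeze_dist r w) = R0 * (w / Y)).
  { intros w Y Hw HY E. replace (rho * squeeze_dist r w) with ((R0 * (w / Y)) * (R0 * (w / Y))).
    - apply sqrt_square. apply Rmult_le_pos; [lra|]. apply Rdiv_le_0_compat; lra.
    - unfold squeeze_dist. rewrite <- E, <- QR. field. lra. }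
  unfold gap_weight_left. rewrite (SY y Y2), (SY x Y1), !sqrt_mult by lra. fold R0 X1 X2.
  rewrite !squeeze_dist_eq by lra.
  assert (E1 : x / Y1 = Y1 - r / Y1) by (replace x with (Y1 * Y1 - r) by lra; field; lra).
  assert (E2 : y / Y2 = Y2 - r / Y2) by (replace y with (Y2 * Y2 - r) by lra; field; lra).
  rewrite E1, E2, <- QY1, <- QY2.
  set (d := Y2 - Y1). set (e := X2 - X1).
  assert (T : / Y1 - / Y2 = d / (Y1 * Y2)) by (unfold d; field; lra).
  assert (Hd : 0 <= d / (Y1 * Y2)) by (apply Rdiv_le_0_compat; [unfold d; lra|nra]).
  assert (U1 : X1 <= 3 / 2 * Y1) by nra. assert (U2 : X2 <= 3 / 2 * Y2) by nra.
  assert (Ee : e * (X1 + X2) = d * (Y1 + Y2)) by (unfold d, e; lra).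
  assert (Hed : 2 / 3 * d <= e).
  { apply Rmult_le_reg_r with (X1 + X2); [lra|]. rewrite Ee.
    replace (2 / 3 * d * (X1 + X2)) with (d * (2 / 3 * (X1 + X2))) by ring.
    apply Rmult_le_compat_l; unfold d; lra. }
  assert (B : (X1 - Y1) - (X2 - Y2) = r * ((e + d) / ((X1 + Y1) * (X2 + Y2)))).
  { assert (A1 : X1 - Y1 = r / (X1 + Y1)).
    { replace r with (X1 * X1 - Y1 * Y1) by lra. field. lra. }
    assert (A2 : X2 - Y2 = r / (X2 + Y2)).
    { replace r with (X2 * X2 - Y2 * Y2) by lra. field. lra. }
    rewrite A1, A2. unfold d, e. field. lra. }
  assert (C : 1 / 4 * (d / (Y1 * Y2)) <= (e + d) / ((X1 + Y1) * (X2 + Y2))).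
  { apply le_div; [nra|].
    replace (1 / 4 * (d / (Y1 * Y2)) * ((X1 + Y1) * (X2 + Y2))) with
      (1 / 4 * d * ((X1 + Y1) * (X2 + Y2)) / (Y1 * Y2)) by (field; lra).
    apply div_le; [nra|].
    apply Rle_trans with (1 / 4 * d * (25 / 4 * (Y1 * Y2))).
    - apply Rmult_le_compat_l; [unfold d; lra|].
      replace (25 / 4 * (Y1 * Y2)) with ((5 / 2 * Y1) * (5 / 2 * Y2)) by field.
      apply Rmult_le_compat; lra.
    - replace (1 / 4 * d * (25 / 4 * (Y1 * Y2))) with ((25 / 16 * d) * (Y1 * Y2)) by field.
      apply Rmult_le_compat_r; [nra|]. unfold d in *. lra. }
  assert (RY : r <= R0 * Y1).
  { apply Rnot_lt_le. intros N. assert (r * r <= (R0 * Y1) * (R0 * Y1)); [|nra].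
    replace ((R0 * Y1) * (R0 * Y1)) with ((R0 * R0) * (Y1 * Y1)) by ring.
    apply Rmult_le_compat; lra. }
  assert (V1 : r * / Y1 <= R0) by (apply div_le; lra).
  assert (V0 : / Y2 <= / Y1) by (apply Rinv_le_contravar; lra).
  assert (V2 : r * (/ Y1 + / Y2) <= 2 * R0) by nra.
  set (t := d / (Y1 * Y2)) in *. set (b := (e + d) / ((X1 + Y1) * (X2 + Y2))) in *.
  (* Here the coefficient 8/5 is decided: [C] gives b >= t / 4, and 8/5 * (1 + 1/4) = 2. *)
  assert (Z : r * (/ Y1 + / Y2) * t <= 8 / 5 * R0 * (t + b)).
  { apply Rle_trans with (2 * R0 * t); [apply Rmult_le_compat_r; auto|].
    assert (0 <= R0 * (b - 1 / 4 * t)) by (apply Rmult_le_pos; lra). lra. }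
  replace (r * r / (Y2 * Y2)) with (r * r / (Y1 * Y1) - r * (r * (/ Y1 + / Y2) * t))
    by (rewrite <- T; field; lra).
  replace (r / Y2) with (r / Y1 - r * t) by (rewrite <- T; field; lra).
  assert (Z2 := Rmult_le_compat_l r _ _ ltac:(lra) Z).
  replace X2 with (X1 - Y1 + Y2 - r * b) by (rewrite <- B; ring).
  lra.
Qed.

Lemma exp_le_inv (x y : R) : exp x <= exp y -> x <= y.
Proof. intros H. apply Rnot_lt_le. intros N. apply exp_increasing in N. lra. Qed.

(* Potential that pays for the shrinking of the zone. *)
Definition potential (rho x : R) : R := 3 / 2 * rho * ln (1 + x / rho).

Lemma potential_0 (rho : R) : potential rho 0 = 0.
Proof. unfold potential, Rdiv. rewrite Rmult_0_l, Rplus_0_r, ln_1. ring. Qed.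

Lemma potential_diff (rho x y : R) : 0 < rho -> 0 <= x <= y ->
  3 / 2 * rho * ((y - x) / (y + rho)) <= potential rho y - potential rho x.
Proof.
  intros Hr H. unfold potential. rewrite <- Rmult_minus_distr_l. apply Rmult_le_compat_l; [lra|].
  assert (Px : 0 < 1 + x / rho) by (assert (0 <= x / rho) by (apply Rdiv_le_0_compat; lra); lra).
  assert (Py : 0 < 1 + y / rho) by (assert (0 <= y / rho) by (apply Rdiv_le_0_compat; lra); lra).
  assert (E : (1 + x / rho) / (1 + y / rho) = 1 - (y - x) / (y + rho)) by (field; lra).
  assert (L : ln ((1 + x / rho) / (1 + y / rho)) <= - ((y - x) / (y + rho))).
  { rewrite E. set (d := (y - x) / (y + rho)) in *.
    assert (0 < 1 - d) by (rewrite <- E; now apply Rdiv_lt_0_compat).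
    apply exp_le_inv. rewrite exp_ln by auto. apply Rle_trans with (2 := one_plus_le_exp (- d)). lra. }
  unfold Rdiv in L at 1. rewrite ln_mult, ln_Rinv in L by (auto; now apply Rinv_0_lt_compat). lra.
Qed.

Lemma potential_left (rho r w : R) : 0 < r <= rho -> 0 <= w ->
  r * r / (w + r) <= potential rho (w + 2 * r) - potential rho (squeeze_dist r w).
Proof.
  intros Hr Hw. assert (K0 : 0 <= squeeze_dist r w) by (apply Rdiv_le_0_compat; nra).
  assert (Q : 0 < r * r / (w + r) <= r).
  { split; [apply Rdiv_lt_0_compat; nra|apply div_le; nra]. }
  assert (Ek := squeeze_dist_eq r w ltac:(lra) Hw).
  apply Rle_trans with (2 := potential_diff rho (squeeze_dist r w) (w + 2 * r) ltac:(lra) ltac:(lra)).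
  replace (w + 2 * r - squeeze_dist r w) with (r * (3 * w + 2 * r) / (w + r)) by (unfold squeeze_dist; field; lra).
  replace (3 / 2 * rho * (r * (3 * w + 2 * r) / (w + r) / (w + 2 * r + rho))) with
    (r / (w + r) * (3 / 2 * rho * (3 * w + 2 * r) / (w + 2 * r + rho))) by (field; lra).
  replace (r * r / (w + r)) with (r / (w + r) * r) by (field; lra).
  apply Rmult_le_compat_l; [apply Rdiv_le_0_compat; lra|]. apply le_div; nra.
Qed.

Lemma potential_right (rho r w : R) : 0 < r <= rho -> 0 <= w ->
  r * r / (w + r) <= potential rho (squeeze_dist r w + 4 * r) - potential rho w.
Proof.
  intros Hr Hw. assert (K0 : 0 <= squeeze_dist r w) by (apply Rdiv_le_0_compat; nra).
  assert (Q : 0 < r * r / (w + r) <= r).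
  { split; [apply Rdiv_lt_0_compat; nra|apply div_le; nra]. }
  assert (Ek := squeeze_dist_eq r w ltac:(lra) Hw).
  apply Rle_trans with (2 := potential_diff rho w (squeeze_dist r w + 4 * r) ltac:(lra) ltac:(lra)).
  replace (squeeze_dist r w + 4 * r - w) with (r * (3 * w + 4 * r) / (w + r)) by (unfold squeeze_dist; field; lra).
  assert (U : squeeze_dist r w + 4 * r <= w + 4 * r) by lra.
  replace (3 / 2 * rho * (r * (3 * w + 4 * r) / (w + r) / (squeeze_dist r w + 4 * r + rho))) with
    (r / (w + r) * (3 / 2 * rho * (3 * w + 4 * r) / (squeeze_dist r w + 4 * r + rho))) by (field; lra).
  replace (r * r / (w + r)) with (r / (w + r) * r) by (field; lra).
  apply Rmult_le_compat_l; [apply Rdiv_le_0_compat; lra|]. apply le_div; [lra|].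
  apply Rle_trans with (r * (w + 4 * r + rho)); [apply Rmult_le_compat_l; lra|]. nra.
Qed.

Lemma potential_mono (rho x y : R) : 0 < rho -> 0 <= x <= y -> potential rho x <= potential rho y.
Proof.
  intros Hr H. assert (T := potential_diff rho x y Hr H).
  assert (0 <= 3 / 2 * rho * ((y - x) / (y + rho))).
  { apply Rmult_le_pos; [lra|]. apply Rdiv_le_0_compat; lra. }
  lra.
Qed.

Lemma potential_sqrt (rho x : R) : 0 < rho -> 0 <= x -> potential rho x <= 3 * sqrt (rho * x).
Proof.
  intros Hr Hx. unfold potential. set (q := sqrt (x / rho)).
  assert (Hq : q * q = x / rho) by (apply sqrt_sqrt, Rdiv_le_0_compat; lra).
  assert (Q0 : 0 <= q) by apply sqrt_pos.
  assert (E : sqrt (rho * x) = rho * q).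
  { replace (rho * x) with ((rho * q) * (rho * q)).
    - apply sqrt_square. nra.
    - replace (rho * q * (rho * q)) with (rho * rho * (q * q)) by ring. rewrite Hq. field. lra. }
  rewrite E, <- Hq.
  assert (L : ln (1 + q * q) <= 2 * q).
  { apply exp_le_inv. rewrite exp_ln by nra. replace (2 * q) with (q + q) by ring.
    rewrite exp_plus. assert (T := one_plus_le_exp q). nra. }
  assert (3 / 2 * rho * ln (1 + q * q) <= 3 / 2 * rho * (2 * q)) by (apply Rmult_le_compat_l; lra). lra.
Qed.

(** The sweep has reached [p]. A gap on the right has already been stretched by the doublings before
    it, and [gap_weight_right] discounts its length; a gap on the left will still be stretched, and
    [gap_weight_left] charges for that in advance. The ratio 37/100 of [rho] to [D] used below lies
    between 7/19, which forces every doubled gap to have r <= rho, and 5/13, below which 13/5 rho <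
    D. In [sw_len] the potentials account for the length lost so far; there is equality at p = u for
    L = v - u. *)
Record sweep (D rho L : R) (l : list R) (u v p : R) : Prop := {
  sw_u : In u l;
  sw_v : In v l;
  sw_p : In p l;
  sw_le : u <= p <= v;
  sw_lt : u < v;
  sw_L : v - u <= L;
  sw_right : forall a b, p <= a -> a < b -> b <= v -> free l a b ->
    gap_weight_right (4 / 7 * rho) (b - p) - gap_weight_right (4 / 7 * rho) (a - p) <= D;
  sw_left : forall a b, u <= a -> a < b -> b <= p -> free l a b ->
    gap_weight_left rho (p - a) - gap_weight_left rho (p - b) <= 13 / 5 * rho;
  sw_len : L - potential rho (p - u) - potential rho L + potential rho (v - p) <= v - u
}.

Lemma next_point (l : list R) (p v : R) : p < v -> In v l ->
  exists q, In q l /\ p < q <= v /\ free l p q.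
Proof.
  intros Hpv Hv.
  assert (H : forall m, (forall x, In x m -> In x l) -> exists q, In q l /\ p < q <= v /\
    forall x, In x m -> p < x -> q <= x).
  { induction m as [|y m IH]; intros Hm.
    - exists v. split; [auto|]. split; [lra|]. intros x [].
    - destruct IH as [q [Q1 [Q2 Q3]]]; [intros; apply Hm; now right|].
      destruct (classic (p < y < q)) as [H|H].
      + exists y. split; [apply Hm; now left|]. split; [lra|].
        intros x [<-|Hx] Hpx; [lra|]. specialize (Q3 x Hx Hpx). lra.
      + exists q. split; [auto|]. split; [auto|].
        intros x [<-|Hx] Hpx; [|auto]. apply Rnot_lt_le. intros N. apply H. lra. }
  destruct (H l ltac:(auto)) as [q [Q1 [Q2 Q3]]]. exists q. split; [auto|]. split; [auto|].
  intros x Hx Hpx. specialize (Q3 x Hx ltac:(lra)). lra.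
Qed.

Section Step.
Variables (D rho L : R) (l : list R) (u v p q s r : R).
Hypotheses (HD : 0 < D) (Hrho : rho = 37 / 100 * D) (HS : sweep D rho L l u v p).
Hypotheses (Hq : In q l) (Hpq : p < q <= v) (Hfr : free l p q).
Hypotheses (Es : s = (p + q) / 2) (Er : r = (q - p) / 4).
Let l' := dlist s r l.
Let wu := stretch_dist r (p - u).
Let wv := stretch_dist r (v - q).
Let u' := s - r - wu.
Let v' := s + r + wv.
Let p' := s + r.

(** A gap starting at [p] with r > rho would have weight at least 19/7 rho, which exceeds D. *)
Lemma sweep_step_r : 0 < r <= rho.
Proof.
  split; [lra|]. apply Rnot_lt_le. intros N.
  assert (A := sw_right _ _ _ _ _ _ _ HS p q ltac:(lra) ltac:(lra) ltac:(lra) Hfr).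
  replace (p - p) with 0 in A by ring. rewrite gap_weight_right_0 in A.
  assert (B := gap_weight_right_mono (4 / 7 * rho) (4 * rho) (q - p) ltac:(lra) ltac:(lra)).
  assert (C := gap_weight_right_4rho rho ltac:(lra)). lra.
Qed.

Lemma sweep_step_l (y : R) : In y l -> y - s <= - 2 * r \/ 2 * r <= y - s.
Proof.
  intros Hy. destruct (Rle_or_lt y p); [left; lra|]. right.
  destruct (Rle_or_lt q y); [lra|]. elim (Hfr y Hy). lra.
Qed.

Lemma sweep_step_spec (x : R) : In x l' <-> x = s \/ (x <> s /\ In (x + r * r / (x - s)) l).
Proof. apply dlist_spec; [apply sweep_step_r|exact sweep_step_l]. Qed.

Lemma sweep_step_right (w : R) : 0 <= w -> (In (s + r + w) l' <-> In (q + squeeze_dist r w) l).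
Proof.
  intros Hw. assert (R0 := sweep_step_r). rewrite sweep_step_spec.
  replace (s + r + w + r * r / (s + r + w - s)) with (q + squeeze_dist r w).
  - split; [intros [H|[_ H]]; [lra|auto]|intros H; right; split; [lra|auto]].
  - rewrite squeeze_dist_eq by lra. replace (s + r + w - s) with (w + r) by ring. lra.
Qed.

Lemma sweep_step_left (w : R) : 0 <= w -> (In (s - r - w) l' <-> In (p - squeeze_dist r w) l).
Proof.
  intros Hw. assert (R0 := sweep_step_r). rewrite sweep_step_spec.
  replace (s - r - w + r * r / (s - r - w - s)) with (p - squeeze_dist r w).
  - split; [intros [H|[_ H]]; [lra|auto]|intros H; right; split; [lra|auto]].
  - rewrite squeeze_dist_eq by lra. replace (s - r - w - s) with (- (w + r)) by ring.
    replace (r * r / - (w + r)) with (- (r * r / (w + r))) by (field; lra). lra.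
Qed.

Lemma sweep_step_wu : 0 <= wu /\ squeeze_dist r wu = p - u.
Proof. assert (B := sw_le _ _ _ _ _ _ _ HS). apply stretch_dist_spec; [apply sweep_step_r|lra]. Qed.

Lemma sweep_step_wv : 0 <= wv /\ squeeze_dist r wv = v - q.
Proof. apply stretch_dist_spec; [apply sweep_step_r|lra]. Qed.

Lemma sweep_step_free_right (x y : R) : 0 <= x < y -> free l' (s + r + x) (s + r + y) ->
  free l (q + squeeze_dist r x) (q + squeeze_dist r y).
Proof.
  intros Hxy H z Hz [Z1 Z2]. assert (R0 := sweep_step_r).
  assert (K : 0 <= squeeze_dist r x) by (apply Rdiv_le_0_compat; nra).
  destruct (stretch_dist_spec r (z - q) ltac:(lra) ltac:(lra)) as [A B].
  apply (H (s + r + stretch_dist r (z - q))).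
  - apply sweep_step_right; auto. rewrite B. now replace (q + (z - q)) with z by ring.
  - split; apply Rplus_lt_compat_l; apply squeeze_dist_lt_inv with r; lra.
Qed.

Lemma sweep_step_free_left (x y : R) : 0 <= y < x -> free l' (s - r - x) (s - r - y) ->
  free l (p - squeeze_dist r x) (p - squeeze_dist r y).
Proof.
  intros Hxy H z Hz [Z1 Z2]. assert (R0 := sweep_step_r).
  assert (K : 0 <= squeeze_dist r y) by (apply Rdiv_le_0_compat; nra).
  destruct (stretch_dist_spec r (p - z) ltac:(lra) ltac:(lra)) as [A B].
  apply (H (s - r - stretch_dist r (p - z))).
  - apply sweep_step_left; auto. rewrite B. now replace (p - (p - z)) with z by ring.
  - assert (y < stretch_dist r (p - z)) by (apply squeeze_dist_lt_inv with r; lra).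
    assert (stretch_dist r (p - z) < x) by (apply squeeze_dist_lt_inv with r; lra). lra.
Qed.

Lemma sweep_step_kk_lt (x y : R) : 0 <= x < y -> squeeze_dist r x < squeeze_dist r y.
Proof.
  intros H. assert (R0 := sweep_step_r). apply Rnot_le_lt. intros N.
  assert (E : squeeze_dist r x = squeeze_dist r y) by (assert (T := squeeze_dist_le r x y ltac:(lra) ltac:(lra)); lra).
  assert (F : stretch_dist r (squeeze_dist r x) = stretch_dist r (squeeze_dist r y)) by now rewrite E.
  rewrite !stretch_dist_kk in F by lra. lra.
Qed.

(** Every gap on the right of [p'] comes from one beyond [q], with no larger weight by
    [gap_weight_right_kk]; every old gap on the left is controlled by [gap_weight_left_kk]. Only the
    two new gaps beside [s] need a separate bound. *)
Lemma sweep_step_sweep : sweep D rho L l' u' v' p'.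
Proof.
  assert (R0 := sweep_step_r). destruct sweep_step_wu as [U1 U2]. destruct sweep_step_wv as [V1 V2].
  assert (B := sw_le _ _ _ _ _ _ _ HS).
  assert (S1 : In (s - r) l').
  { replace (s - r) with (s - r - 0) by ring. apply sweep_step_left; [lra|].
    unfold squeeze_dist. replace (p - 0 * 0 / (0 + r)) with p by (field; lra). exact (sw_p _ _ _ _ _ _ _ HS). }
  assert (S2 : In (s + r) l').
  { replace (s + r) with (s + r + 0) by ring. apply sweep_step_right; [lra|].
    unfold squeeze_dist. replace (q + 0 * 0 / (0 + r)) with q by (field; lra). exact Hq. }
  assert (S0 : In s l') by now left.
  assert (Q1 : 0 < r * r / (wu + r)) by (apply Rdiv_lt_0_compat; nra).
  assert (Q2 : 0 < r * r / (wv + r)) by (apply Rdiv_lt_0_compat; nra).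
  assert (Eu : u' - u = r * r / (wu + r)) by (unfold u'; rewrite squeeze_dist_eq in U2 by lra; lra).
  assert (Ev : v - v' = r * r / (wv + r)) by (unfold v'; rewrite squeeze_dist_eq in V2 by lra; lra).
  constructor.
  - apply sweep_step_left; auto. rewrite U2. replace (p - (p - u)) with u by ring.
    exact (sw_u _ _ _ _ _ _ _ HS).
  - apply sweep_step_right; auto. rewrite V2. replace (q + (v - q)) with v by ring.
    exact (sw_v _ _ _ _ _ _ _ HS).
  - exact S2.
  - unfold u', v', p'. lra.
  - unfold u', v', p'. lra.
  - assert (T := sw_L _ _ _ _ _ _ _ HS). lra.
  - intros a b Ha Hab Hb Hf. unfold p', v' in *.
    assert (Ka := squeeze_dist_le r (a - (s + r)) (b - (s + r)) ltac:(lra) ltac:(lra)).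
    assert (Kb := squeeze_dist_le r (b - (s + r)) wv ltac:(lra) ltac:(lra)).
    assert (Kl := sweep_step_kk_lt (a - (s + r)) (b - (s + r)) ltac:(lra)).
    assert (K0 : 0 <= squeeze_dist r (a - (s + r))) by (apply Rdiv_le_0_compat; nra).
    assert (G := gap_weight_right_kk (4 / 7 * rho) r (a - (s + r)) (b - (s + r)) ltac:(lra) ltac:(lra) ltac:(lra)).
    apply Rle_trans with (1 := G).
    assert (F := sweep_step_free_right (a - (s + r)) (b - (s + r)) ltac:(lra)).
    replace (s + r + (a - (s + r))) with a in F by ring.
    replace (s + r + (b - (s + r))) with b in F by ring. specialize (F Hf).
    assert (T := sw_right _ _ _ _ _ _ _ HS (q + squeeze_dist r (a - (s + r))) (q + squeeze_dist r (b - (s + r)))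
      ltac:(lra) ltac:(lra) ltac:(lra) F).
    replace (q + squeeze_dist r (b - (s + r)) - p) with (squeeze_dist r (b - (s + r)) + 4 * r) in T by lra.
    replace (q + squeeze_dist r (a - (s + r)) - p) with (squeeze_dist r (a - (s + r)) + 4 * r) in T by lra.
    exact T.
  - intros a b Ha Hab Hb Hf. unfold p', u' in *.
    destruct (Rle_or_lt b (s - r)) as [C|C].
    + assert (Kb := squeeze_dist_le r (s - r - a) wu ltac:(lra) ltac:(lra)).
      assert (Kl := sweep_step_kk_lt (s - r - b) (s - r - a) ltac:(lra)).
      assert (K0 : 0 <= squeeze_dist r (s - r - b)) by (apply Rdiv_le_0_compat; nra).
      assert (G := gap_weight_left_kk rho r (s - r - b) (s - r - a) ltac:(lra) ltac:(lra)).
      replace (s - r - a + 2 * r) with (s + r - a) in G by ring.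
      replace (s - r - b + 2 * r) with (s + r - b) in G by ring.
      apply Rle_trans with (1 := G).
      assert (F := sweep_step_free_left (s - r - a) (s - r - b) ltac:(lra)).
      replace (s - r - (s - r - a)) with a in F by ring.
      replace (s - r - (s - r - b)) with b in F by ring. specialize (F Hf).
      assert (T := sw_left _ _ _ _ _ _ _ HS (p - squeeze_dist r (s - r - a)) (p - squeeze_dist r (s - r - b))
        ltac:(lra) ltac:(lra) ltac:(lra) F).
      replace (p - (p - squeeze_dist r (s - r - a))) with (squeeze_dist r (s - r - a)) in T by ring.
      replace (p - (p - squeeze_dist r (s - r - b))) with (squeeze_dist r (s - r - b)) in T by ring.
      exact T.
    (* A new gap lies between s - r and s or between s and s + r. By subadditivity its weight is at
       most that of the distance [r], hence of [rho], and this is where 13/5 = 1 + 8/5 comes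
       from. *)
    + assert (F1 := Hf _ S1). assert (F0 := Hf _ S0).
      assert (T := gap_weight_left_sub rho (s + r - b) (b - a) ltac:(lra) ltac:(lra) ltac:(lra)).
      replace (s + r - b + (b - a)) with (s + r - a) in T by ring.
      apply Rle_trans with (1 := T). rewrite <- gap_weight_left_rho by lra. apply gap_weight_left_le; [lra|].
      destruct (Rlt_or_le a (s - r)); [elim F1; lra|].
      destruct (Rle_or_lt b s); [lra|]. destruct (Rle_or_lt s a); [lra|]. elim F0. lra.
  (* The ends move inwards by r^2 / (wu + r) and r^2 / (wv + r). The first loss is paid by the
     potential of the part behind, which grows, the second by that of the part ahead, which
     decreases. *)
  - assert (T := sw_len _ _ _ _ _ _ _ HS).
    assert (T1 := potential_left rho r wu ltac:(lra) U1). rewrite U2 in T1.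
    assert (T2 := potential_right rho r wv ltac:(lra) V1). rewrite V2 in T2.
    replace (v - q + 4 * r) with (v - p) in T2 by lra.
    replace (p' - u') with (wu + 2 * r) by (unfold p', u'; ring).
    replace (v' - p') with wv by (unfold p', v'; ring). lra.
Qed.

(** Termination of the sweep: the points ahead correspond to the old ones beyond [q], so [q] drops
    out of the list that covers them. The list [m] is used since [l] itself grows. *)
Lemma sweep_step_measure (m : list R) : (forall x, In x l -> p < x <= v -> In x m) ->
  exists m', (length m' < length m)%nat /\ forall x, In x l' -> p' < x <= v' -> In x m'.
Proof.
  intros Hm. exists (map (fun y => s + r + stretch_dist r (y - q)) (remove Req_EM_T q m)). split.
  - rewrite length_map. apply remove_length_lt. apply Hm; auto.
  - intros x Hx [X1 X2]. unfold p', v' in *. assert (R0 := sweep_step_r). destruct sweep_step_wv as [V1 V2].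
    set (w := x - (s + r)). assert (Hw : 0 < w) by (unfold w; lra).
    assert (Ex : x = s + r + w) by (unfold w; ring). rewrite Ex in Hx.
    apply sweep_step_right in Hx; [|lra]. apply in_map_iff. exists (q + squeeze_dist r w). split.
    + replace (q + squeeze_dist r w - q) with (squeeze_dist r w) by ring. rewrite stretch_dist_kk by lra. auto.
    + assert (K0 : 0 < squeeze_dist r w) by (apply Rdiv_lt_0_compat; nra).
      assert (K1 := squeeze_dist_le r w wv ltac:(lra) ltac:(unfold w; lra)).
      apply in_in_remove; [lra|]. apply Hm; auto. lra.
Qed.

Lemma sweep_step_trans (G : C -> Chat) (Y : C -> C) : admissible G Y l ->
  exists G' Y' J, admissible G' Y' l' /\ trans (dmap s r) J (r * r) G Y u v G' Y' u' v'.
Proof.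
  intros HO. assert (R0 := sweep_step_r). destruct sweep_step_wu as [U1 U2]. destruct sweep_step_wv as [V1 V2].
  assert (B := sw_le _ _ _ _ _ _ _ HS).
  destruct (trans_double G Y u v s r u' v') as [J HJ]; try (unfold u', v'; lra).
  - rewrite squeeze_dist_eq in U2 by lra. unfold u'. replace (s - (s - r - wu)) with (wu + r) by ring. lra.
  - rewrite squeeze_dist_eq in V2 by lra. unfold v'. replace (s + r + wv - s) with (wv + r) by ring. lra.
  - exists (pullG G (dmap s r) (dpole s)), (pullY Y (dmap s r) (dmap' s r)), J. split; auto.
    apply pull_admissible with (l := l); auto. apply dbl_pullable.
    + lra.
    + replace (s - 2 * r) with p by lra. exact (sw_p _ _ _ _ _ _ _ HS).
    + now replace (s + 2 * r) with q by lra.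
    + exact sweep_step_l.
    + apply (ok_l _ _ _ HO).
Qed.
End Step.

(** * Repeated sweeps of a zone *)

Definition mesh (l : list R) (u v D : R) : Prop :=
  forall a b, u <= a -> a < b -> b <= v -> free l a b -> b - a <= D.

Lemma sweep_all (D rho L : R) (n : nat) : 0 < D -> rho = 37 / 100 * D ->
  forall G Y l u v p m, admissible G Y l -> sweep D rho L l u v p -> (length m <= n)%nat ->
  (forall x, In x l -> p < x <= v -> In x m) ->
  exists f J K G' Y' l' u' v', admissible G' Y' l' /\ trans f J K G Y u v G' Y' u' v' /\
    sweep D rho L l' u' v' v'.
Proof.
  intros HD Hrho. induction n as [|n IH]; intros G Y l u v p m HO HS Hn Hm;
    destruct (Rle_lt_or_eq_dec p v (proj2 (sw_le _ _ _ _ _ _ _ HS))) as [Hpv|Hpv].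
  - destruct m; [|simpl in Hn; lia]. elim (Hm v); [apply (sw_v _ _ _ _ _ _ _ HS)|lra].
  - subst p. exists (fun z => z), (fun z => z), 0, G, Y, l, u, v.
    split; [auto|]. split; [|auto]. apply trans_refl. apply (sw_lt _ _ _ _ _ _ _ HS).
  - destruct (next_point l p v Hpv (sw_v _ _ _ _ _ _ _ HS)) as [q [Q1 [Q2 Q3]]].
    set (s := (p + q) / 2). set (r := (q - p) / 4).
    destruct (sweep_step_trans D rho L l u v p q s r HD Hrho HS Q1 Q2 Q3 eq_refl eq_refl G Y HO)
      as [G1 [Y1 [J1 [HO1 HT1]]]].
    assert (HS1 := sweep_step_sweep D rho L l u v p q s r HD Hrho HS Q1 Q2 Q3 eq_refl eq_refl).
    destruct (sweep_step_measure D rho L l u v p q s r HD Hrho HS Q1 Q2 Q3 eq_refl eq_refl m Hm) as [m' [M1 M2]].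
    destruct (IH _ _ _ _ _ _ m' HO1 HS1 ltac:(lia) M2) as [f [J [K [G2 [Y2 [l2 [u2 [v2 [A1 [A2 A3]]]]]]]]]].
    do 8 eexists. split; [exact A1|]. split; [|exact A3]. exact (trans_comp _ _ _ _ _ _ _ _ _ _ _ _ _ _ _ _ _ _ HT1 A2).
  - subst p. exists (fun z => z), (fun z => z), 0, G, Y, l, u, v.
    split; [auto|]. split; [|auto]. apply trans_refl. apply (sw_lt _ _ _ _ _ _ _ HS).
Qed.

(** After a complete sweep every gap has length at most 13/5 * 37/100 D = 0.962 D. The length lost
    is at most twice the potential of L = v - u, that is 6 sqrt (rho L), and sqrt (37/100) <= 61/100
    gives 366/100. *)
Lemma one_round (D : R) (G : C -> Chat) (Y : C -> C) (l : list R) (u v : R) : 0 < D ->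
  admissible G Y l -> In u l -> In v l -> u < v -> mesh l u v D ->
  exists f J K G' Y' l' u' v', admissible G' Y' l' /\ In u' l' /\ In v' l' /\
    trans f J K G Y u v G' Y' u' v' /\ mesh l' u' v' (97 / 100 * D) /\
    (v - u) - 366 / 100 * sqrt (D * (v - u)) <= v' - u'.
Proof.
  intros HD HO Hu Hv Huv Hm. set (rho := 37 / 100 * D).
  assert (HS : sweep D rho (v - u) l u v u).
  { constructor; auto; try lra.
    - intros a b Ha Hab Hb Hf.
      apply Rle_trans with ((b - u) - (a - u)); [apply gap_weight_right_lip; unfold rho; lra|].
      specialize (Hm a b Ha Hab Hb Hf). lra.
    - intros a b Ha Hab Hb Hf. lra.
    - replace (u - u) with 0 by ring. rewrite potential_0. lra. }
  destruct (sweep_all D rho (v - u) (length l) HD eq_refl G Y l u v u l HO HS (le_n _) ltac:(auto))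
    as [f [J [K [G' [Y' [l' [u' [v' [A1 [A2 A3]]]]]]]]]].
  exists f, J, K, G', Y', l', u', v'. split; [auto|].
  split; [apply (sw_u _ _ _ _ _ _ _ A3)|]. split; [apply (sw_v _ _ _ _ _ _ _ A3)|].
  split; [auto|]. split.
  - intros a b Ha Hab Hb Hf. assert (T := sw_left _ _ _ _ _ _ _ A3 a b Ha Hab Hb Hf).
    assert (T2 := gap_weight_left_expand rho (v' - b) (v' - a) ltac:(unfold rho; lra) ltac:(lra)). unfold rho in T, T2. lra.
  - assert (T := sw_len _ _ _ _ _ _ _ A3). assert (Z := tr_zone _ _ _ _ _ _ _ _ _ _ _ A2).
    replace (v' - v') with 0 in T by ring. rewrite potential_0 in T.
    assert (P1 := potential_mono rho (v' - u') (v - u) ltac:(unfold rho; lra) ltac:(lra)).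
    assert (P2 := potential_sqrt rho (v - u) ltac:(unfold rho; lra) ltac:(lra)).
    assert (S : sqrt (rho * (v - u)) <= 61 / 100 * sqrt (D * (v - u))).
    { assert (S0 := sqrt_pos (D * (v - u))).
      rewrite <- (sqrt_square (61 / 100 * sqrt (D * (v - u)))) by lra. apply sqrt_le_1_alt.
      assert (E := sqrt_sqrt (D * (v - u)) ltac:(nra)). unfold rho. nra. }
    lra.
Qed.

(** The losses are proportional to the square root of the mesh, hence dominated by a geometric
    series with ratio 985/1000, which is above sqrt (97/100). Its sum is 3.66 / 0.015 = 244, rounded
    up to 250. *)
Lemma many_rounds (D : R) (G : C -> Chat) (Y : C -> C) (l : list R) (u v : R) (n : nat) : 0 < D ->
  admissible G Y l -> In u l -> In v l -> u < v -> mesh l u v D -> 1000000 * D <= v - u ->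
  exists f J K G' Y' l' u' v', admissible G' Y' l' /\ In u' l' /\ In v' l' /\
    trans f J K G Y u v G' Y' u' v' /\ mesh l' u' v' (D * (97 / 100) ^ n) /\
    (v - u) - 250 * (1 - (985 / 1000) ^ n) * sqrt (D * (v - u)) <= v' - u'.
Proof.
  intros HD HO Hu Hv Huv Hm HDL. induction n as [|n IH].
  - exists (fun z => z), (fun z => z), 0, G, Y, l, u, v. rewrite !pow_O, Rmult_1_r.
    repeat (split; [auto; fail|]). split; [now apply trans_refl|]. split; [auto|]. lra.
  - destruct IH as [f [J [K [G1 [Y1 [l1 [u1 [v1 [A1 [A2 [A3 [A4 [A5 A6]]]]]]]]]]]]].
    assert (Z := tr_zone _ _ _ _ _ _ _ _ _ _ _ A4).
    assert (P : 0 < (97 / 100) ^ n) by (apply pow_lt; lra).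
    assert (HDn : 0 < D * (97 / 100) ^ n) by nra.
    destruct (one_round _ G1 Y1 l1 u1 v1 HDn A1 A2 A3 ltac:(lra) A5)
      as [f2 [J2 [K2 [G2 [Y2 [l2 [u2 [v2 [B1 [B2 [B3 [B4 [B5 B6]]]]]]]]]]]]].
    do 8 eexists. split; [exact B1|]. split; [exact B2|]. split; [exact B3|].
    split; [exact (trans_comp _ _ _ _ _ _ _ _ _ _ _ _ _ _ _ _ _ _ A4 B4)|]. split.
    + replace (D * (97 / 100) ^ S n) with (97 / 100 * (D * (97 / 100) ^ n)) by (simpl; ring). exact B5.
    + assert (P9 : 0 < (985 / 1000) ^ n) by (apply pow_lt; lra).
      set (S0 := sqrt (D * (v - u))) in *. assert (HS0 : 0 <= S0) by apply sqrt_pos.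
      assert (ES0 : S0 * S0 = D * (v - u)) by (apply sqrt_sqrt; nra).
      assert (X : sqrt (D * (97 / 100) ^ n * (v1 - u1)) <= (985 / 1000) ^ n * S0).
      { rewrite <- (sqrt_square ((985 / 1000) ^ n * S0)) by nra. apply sqrt_le_1_alt.
        replace ((985 / 1000) ^ n * S0 * ((985 / 1000) ^ n * S0)) with
          (((985 / 1000) ^ n * (985 / 1000) ^ n) * (S0 * S0)) by ring.
        rewrite ES0, <- Rpow_mult_distr.
        assert (Y0 : (97 / 100) ^ n <= (985 / 1000 * (985 / 1000)) ^ n) by (apply pow_incr; lra).
        assert (D * (97 / 100) ^ n * (v1 - u1) <= D * (97 / 100) ^ n * (v - u)) by (apply Rmult_le_compat_l; lra).
        assert (D * (v - u) * (97 / 100) ^ n <= D * (v - u) * (985 / 1000 * (985 / 1000)) ^ n)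
          by (apply Rmult_le_compat_l; nra). lra. }
      replace ((985 / 1000) ^ S n) with (985 / 1000 * (985 / 1000) ^ n) by (simpl; ring).
      assert (0 <= (985 / 1000) ^ n * S0) by nra. lra.
Qed.

(** If 1000000 D <= v - u then sqrt (D (v - u)) is at most a thousandth of the zone, so all rounds
    together lose at most a quarter of it, whatever [eps] is. *)
Lemma fill (D eps : R) (G : C -> Chat) (Y : C -> C) (l : list R) (u v : R) : 0 < D -> 0 < eps ->
  admissible G Y l -> In u l -> In v l -> u < v -> mesh l u v D -> 1000000 * D <= v - u ->
  exists f J K G' Y' l' u' v', admissible G' Y' l' /\ In u' l' /\ In v' l' /\
    trans f J K G Y u v G' Y' u' v' /\ mesh l' u' v' eps /\ (v - u) / 2 <= v' - u'.
Proof.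
  intros HD He HO Hu Hv Huv Hm HDL.
  destruct (pow_lt_1_zero (97 / 100) ltac:(rewrite Rabs_pos_eq; lra) (eps / D)) as [n Hn];
    [apply Rdiv_lt_0_compat; lra|].
  specialize (Hn n (le_n n)). rewrite Rabs_pos_eq in Hn by (apply pow_le; lra).
  destruct (many_rounds D G Y l u v n HD HO Hu Hv Huv Hm HDL)
    as [f [J [K [G1 [Y1 [l1 [u1 [v1 [A1 [A2 [A3 [A4 [A5 A6]]]]]]]]]]]]].
  exists f, J, K, G1, Y1, l1, u1, v1. repeat (split; [auto; fail|]). split.
  - intros a b Ha Hab Hb Hf. specialize (A5 a b Ha Hab Hb Hf).
    assert (D * (97 / 100) ^ n <= D * (eps / D)) by (apply Rmult_le_compat_l; lra).
    replace (D * (eps / D)) with eps in H by (field; lra). lra.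
  - assert (P9 : 0 < (985 / 1000) ^ n) by (apply pow_lt; lra).
    assert (S : sqrt (D * (v - u)) <= (v - u) / 1000).
    { rewrite <- (sqrt_square ((v - u) / 1000)) by lra. apply sqrt_le_1_alt. nra. }
    assert (HS0 := sqrt_pos (D * (v - u))). nra.
Qed.

(** * The complex exponential *)

Definition cexp (z : C) : C := (exp (Re z) * cos (Im z), exp (Re z) * sin (Im z)).

Lemma cexp_Cmod (z : C) : Cmod (cexp z) = exp (Re z).
Proof.
  unfold cexp, Cmod. simpl.
  replace (_ + _) with (exp (Re z) * exp (Re z)).
  - apply sqrt_square. left. apply exp_pos.
  - assert (S := sin2_cos2 (Im z)). unfold Rsqr in S.
    replace (exp (Re z) * exp (Re z)) with
      (exp (Re z) * exp (Re z) * (sin (Im z) * sin (Im z) + cos (Im z) * cos (Im z))) by (rewrite S; ring).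
    ring.
Qed.

Lemma cexp_plus (z w : C) : cexp (z + w) = (cexp z * cexp w)%C.
Proof.
  unfold cexp, Re, Im. apply injective_projections; simpl; rewrite exp_plus.
  - rewrite cos_plus. ring.
  - rewrite sin_plus. ring.
Qed.

Lemma lim_at_0 (f : R -> R) (l eps : R) : derivable_pt_lim f 0 l -> 0 < eps ->
  exists d, 0 < d /\ forall h, Rabs h < d -> Rabs (f h - f 0 - l * h) <= eps * Rabs h.
Proof.
  intros H He. destruct (H eps He) as [d Hd]. exists d. split; [apply cond_pos|].
  intros h Hh. destruct (Req_dec h 0) as [->|N].
  - replace (f 0 - f 0 - l * 0) with 0 by ring. rewrite Rabs_R0. lra.
  - specialize (Hd h N Hh). rewrite Rplus_0_l in Hd.
    replace (f h - f 0 - l * h) with (((f h - f 0) / h - l) * h) by (field; auto).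
    rewrite Rabs_mult. apply Rmult_le_compat_r; [apply Rabs_pos|lra].
Qed.

Lemma cexp_deriv_0 : cderiv cexp 0 1.
Proof.
  apply cderiv_eps. intros eps He. set (e := Rmin 1 (eps / 20)).
  assert (E1 : e <= 1) by apply Rmin_l. assert (E2 : e <= eps / 20) by apply Rmin_r.
  assert (E0 : 0 < e) by (apply Rmin_glb_lt; lra).
  destruct (lim_at_0 exp 1 e) as [d1 [D1 K1]]; auto.
  { assert (T := derivable_pt_lim_exp 0). rewrite exp_0 in T. exact T. }
  destruct (lim_at_0 cos 0 e) as [d2 [D2 K2]]; auto.
  { assert (T := derivable_pt_lim_cos 0). rewrite sin_0, Ropp_0 in T. exact T. }
  destruct (lim_at_0 sin 1 e) as [d3 [D3 K3]]; auto.
  { assert (T := derivable_pt_lim_sin 0). rewrite cos_0 in T. exact T. }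
  exists (Rmin (Rmin d1 d2) (Rmin d3 e)). split; [apply Rmin_glb_lt; apply Rmin_glb_lt; auto|].
  intros w Hw. assert (A1 := Rmin_l (Rmin d1 d2) (Rmin d3 e)).
  assert (A2 := Rmin_r (Rmin d1 d2) (Rmin d3 e)).
  assert (A3 := Rmin_l d1 d2). assert (A4 := Rmin_r d1 d2).
  assert (A5 := Rmin_l d3 e). assert (A6 := Rmin_r d3 e).
  replace (w - 0)%C with w in * by ring.
  assert (Ra := re_le_Cmod w). assert (Rb := im_le_Cmod w). set (n := Cmod w) in *.
  unfold Re in Ra. unfold Im in Rb.
  destruct w as [a b]. unfold Re, Im in *. simpl in Ra, Rb.
  change (Rabs a <= n) in Ra.
  specialize (K1 a ltac:(lra)). specialize (K2 b ltac:(lra)). specialize (K3 b ltac:(lra)).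
  rewrite exp_0 in K1. rewrite cos_0 in K2. rewrite sin_0 in K3.
  set (x := exp a - 1 - 1 * a) in *. set (y := cos b - 1 - 0 * b) in *. set (z := sin b - 0 - 1 * b) in *.
  assert (Hx : Rabs x <= e * n) by nra. assert (Hy : Rabs y <= e * n) by nra.
  assert (Hz : Rabs z <= e * n) by nra.
  apply Rabs_le_between in Hx. apply Rabs_le_between in Hy. apply Rabs_le_between in Hz.
  apply Rabs_le_between in Ra. apply Rabs_le_between in Rb.
  apply Rle_trans with (1 := Cmod_le_abs _).
  assert (B1 : Rabs (Re (cexp (a, b) - cexp 0 - 1 * (a, b))%C) <= 5 * e * n).
  { replace (Re (cexp (a, b) - cexp 0 - 1 * (a, b))%C) with (x + y + (x + a) * y).
    - assert (en : e * n <= n) by nra. assert (n1 : n <= 1) by lra.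
      assert (Q : Rabs ((x + a) * y) <= 2 * (e * n)).
      { rewrite Rabs_mult. apply Rmult_le_compat; try apply Rabs_pos; apply Rabs_le; lra. }
      apply Rabs_le_between in Q. apply Rabs_le. lra.
    - unfold x, y, cexp. simpl. rewrite exp_0, cos_0. ring. }
  assert (B2 : Rabs (Im (cexp (a, b) - cexp 0 - 1 * (a, b))%C) <= 5 * e * n).
  { replace (Im (cexp (a, b) - cexp 0 - 1 * (a, b))%C) with (z + (x + a) * (b + z)).
    - apply Rabs_le. assert (n * n <= e * n) by nra. assert (e * n <= n) by nra.
      assert (-(2 * n) <= x + a <= 2 * n) by lra. assert (-(2 * n) <= b + z <= 2 * n) by lra.
      assert (Q : Rabs ((x + a) * (b + z)) <= 2 * n * (2 * n)).
      { rewrite Rabs_mult. apply Rmult_le_compat; try apply Rabs_pos; apply Rabs_le; lra. }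
      apply Rabs_le_between in Q. lra.
    - unfold x, z, cexp. simpl. rewrite exp_0, sin_0. ring. }
  assert (0 <= n) by apply Cmod_ge_0. nra.
Qed.

Lemma cexp_cdiff (z : C) : cdiff cexp z.
Proof.
  assert (S : cderiv (fun w => w - z)%C z (1 + 0)%C)
    by (apply cderiv_plus; [apply cderiv_id|apply cderiv_const]).
  apply cdiff_ext_loc with (f := fun w => (cexp z * cexp (w - z))%C) (r := 1); [lra| |].
  - intros w _. rewrite <- cexp_plus. f_equal. ring.
  - apply cdiff_mult; [apply cdiff_const|]. exists (1 * (1 + 0))%C. apply cderiv_comp; auto.
    replace (z - z)%C with (RtoC 0) by ring. exact cexp_deriv_0.
Qed.

(** * A two-constant estimate *)

(* The weight is at most 0 on the real line outside of the zone of half-length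
   [sqrt 5 * rho] and of order 1/rho inside; it stays positive far up as rho tends to 0. *)
Definition weight (c rho : R) (z : C) : R :=
  (Im z + rho) / ((Re z - c) * (Re z - c) + (Im z + rho) * (Im z + rho)) -
  3 / 4 * ((Im z + 2 * rho) / ((Re z - c) * (Re z - c) + (Im z + 2 * rho) * (Im z + 2 * rho))).

(** A holomorphic function with real part [weight]: i / (z - a) has as real part a Poisson kernel
    with its pole [a] below the real line. *)
Definition wexpo (c rho : R) (z : C) : C :=
  (Ci * (/ (z - (c, (- rho)%R)) - RtoC (3 / 4) * / (z - (c, (- (2 * rho))%R))))%C.

Lemma wexpo_Re (c rho : R) (z : C) : 0 < rho -> 0 <= Im z -> Re (wexpo c rho z) = weight c rho z.
Proof.
  intros Hr Hz. destruct z as [x y]. unfold wexpo, weight, Re, Im in *. simpl in *.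
  field. split; (apply Rgt_not_eq, Rplus_le_lt_0_compat; [apply Rle_0_sqr|apply Rmult_lt_0_compat; lra]).
Qed.

Lemma wexpo_cdiff (c rho : R) (z : C) : 0 < rho -> 0 <= Im z -> cdiff (wexpo c rho) z.
Proof.
  intros Hr Hz.
  assert (N : forall d, 0 < d -> (z - (c, (- d)%R))%C <> 0%C).
  { intros d Hd E. assert (T : Im (z - (c, (- d)%R))%C = 0) by now rewrite E.
    rewrite Cminus_Im in T. unfold Im at 2 in T. simpl in T. lra. }
  unfold wexpo. apply cdiff_mult; [apply cdiff_const|]. apply cdiff_minus.
  - apply cdiff_inv; [|apply N; lra]. apply cdiff_minus; [apply cdiff_id|apply cdiff_const].
  - apply cdiff_mult; [apply cdiff_const|].
    apply cdiff_inv; [|apply N; lra]. apply cdiff_minus; [apply cdiff_id|apply cdiff_const].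
Qed.

Lemma sq_plus_pos (a b : R) : 0 < b -> 0 < a * a + b * b.
Proof. intros H. apply Rplus_le_lt_0_compat; [apply Rle_0_sqr|now apply Rmult_lt_0_compat]. Qed.

Lemma weight_le (c rho : R) (z : C) : 0 < rho -> 0 <= Im z -> weight c rho z <= / rho.
Proof.
  intros Hr Hz. destruct z as [x y]. unfold weight, Re, Im in *. simpl in *.
  assert (A : 0 <= (y + 2 * rho) / ((x - c) * (x - c) + (y + 2 * rho) * (y + 2 * rho)))
    by (apply Rdiv_le_0_compat; [lra|apply sq_plus_pos; lra]).
  assert (B : (y + rho) / ((x - c) * (x - c) + (y + rho) * (y + rho)) <= / rho).
  { apply div_le; [apply sq_plus_pos; lra|]. apply Rmult_le_reg_l with rho; auto.
    rewrite <- Rmult_assoc, Rinv_r by lra. assert (T := Rle_0_sqr (x - c)). unfold Rsqr in T. nra. }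
  lra.
Qed.

Lemma weight_outside (c rho x : R) : 0 < rho -> 5 * (rho * rho) <= (x - c) * (x - c) ->
  weight c rho (RtoC x) <= 0.
Proof.
  intros Hr H. unfold weight, Re, Im. simpl. set (X := (x - c) * (x - c)) in *.
  assert (H0 : 0 < rho * rho) by nra.
  replace ((0 + rho) / (X + (0 + rho) * (0 + rho)) -
    3 / 4 * ((0 + 2 * rho) / (X + (0 + 2 * rho) * (0 + 2 * rho)))) with
   (- (rho * (X - 5 * (rho * rho)) / (2 * (X + rho * rho) * (X + 4 * (rho * rho))))) by (field; nra).
  assert (0 <= rho * (X - 5 * (rho * rho)) / (2 * (X + rho * rho) * (X + 4 * (rho * rho)))); [|lra].
  apply Rdiv_le_0_compat; nra.
Qed.

Lemma weight_ge (c rho : R) (z : C) : 0 < rho -> -1 <= c <= 1 -> 4 * rho <= Im z ->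
  Im z / 8 / ((Rabs (Re z) + 1) * (Rabs (Re z) + 1) + 4 * (Im z * Im z)) <= weight c rho z.
Proof.
  intros Hr Hc Hy. destruct z as [x y]. unfold weight, Re, Im in *. simpl in *.
  set (D1 := (x - c) * (x - c) + (y + rho) * (y + rho)).
  set (D2 := (x - c) * (x - c) + (y + 2 * rho) * (y + 2 * rho)).
  assert (P1 : 0 < D1) by (apply sq_plus_pos; lra). assert (P12 : D1 <= D2) by (unfold D1, D2; nra).
  assert (A : (y + 2 * rho) / D2 <= (y + 2 * rho) / D1)
    by (apply Rmult_le_compat_l; [lra|now apply Rinv_le_contravar]).
  assert (B : y / 8 / D1 <= (y + rho) / D1 - 3 / 4 * ((y + 2 * rho) / D1)).
  { replace ((y + rho) / D1 - 3 / 4 * ((y + 2 * rho) / D1)) with ((y / 4 - rho / 2) / D1) by (field; lra).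
    apply Rmult_le_compat_r; [left; now apply Rinv_0_lt_compat|lra]. }
  assert (C : y / 8 / ((Rabs x + 1) * (Rabs x + 1) + 4 * (y * y)) <= y / 8 / D1).
  { apply Rmult_le_compat_l; [lra|]. apply Rinv_le_contravar; auto. unfold D1.
    assert (Rabs (x - c) <= Rabs x + 1).
    { unfold Rminus. apply Rle_trans with (1 := Rabs_triang _ _). rewrite Rabs_Ropp.
      assert (Rabs c <= 1) by (apply Rabs_le; lra). lra. }
    assert (E : (x - c) * (x - c) = Rabs (x - c) * Rabs (x - c)).
    { rewrite <- Rabs_mult. symmetry. apply Rabs_pos_eq, Rle_0_sqr. }
    rewrite E. assert (P := Rabs_pos (x - c)).
    replace (4 * (y * y)) with ((2 * y) * (2 * y)) by ring.
    apply Rplus_le_compat; apply Rmult_le_compat; lra. }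
  lra.
Qed.

Lemma choice_fun (A B : Type) (R : A -> B -> Prop) :
  (forall x, exists y, R x y) -> exists f, forall x, R x (f x).
Proof.
  intros H. exists (fun x => proj1_sig (constructive_indefinite_description _ (H x))).
  intros x. exact (proj2_sig (constructive_indefinite_description _ (H x))).
Qed.

Lemma prev_point (l : list R) (u p : R) : u < p -> In u l ->
  exists q, In q l /\ u <= q < p /\ free l q p.
Proof.
  intros Hup Hu.
  destruct (next_point (map Ropp l) (- p) (- u) ltac:(lra)) as [q [Q1 [Q2 Q3]]].
  - now apply in_map.
  - apply in_map_iff in Q1. destruct Q1 as [y [<- Hy]]. exists y. split; [auto|]. split; [lra|].
    intros x Hx Hc. apply (Q3 (- x)); [now apply in_map|lra].
Qed.

Lemma gap_bound_far (l : list R) (u x m : R) : (forall y, In y l -> -1 <= y <= 1) -> In u l -> 0 <= m ->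
  gap_bound l x m -> ~ In x l -> m <= 2 * (1 + Rabs x).
Proof.
  intros Hb Hu Hm [H1 [H2 H3]] Hx. assert (Bu := Hb u Hu).
  assert (X := Rle_abs x). assert (X' := Rle_abs (- x)). rewrite Rabs_Ropp in X'.
  destruct (classic (forall b, In b l -> b < x)) as [A|A].
  { specialize (H2 u Hu A). lra. }
  destruct (classic (forall b, In b l -> x < b)) as [B|B].
  { specialize (H3 u Hu B). lra. }
  apply not_all_ex_not in A. destruct A as [b A]. apply imply_to_and in A. destruct A as [A1 A2].
  apply not_all_ex_not in B. destruct B as [a B]. apply imply_to_and in B. destruct B as [B1 B2].
  assert (b <> x) by (intros ->; auto). assert (a <> x) by (intros ->; auto).
  assert (Bb := Hb b A1). assert (Ba := Hb a B1).
  specialize (H1 a b B1 A1 ltac:(lra)).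
  assert (m * (b - a) <= 2 * (b - x) * (b - a)) by nra.
  assert (m <= 2 * (b - x)) by (apply Rmult_le_reg_r with (b - a); lra). lra.
Qed.

(** For the neighbours a, b of [x] in [l] the product (x - a) (b - x) is at most (b - a)^2 / 4. *)
Lemma gap_bound_zone (l : list R) (u v x m d : R) : In u l -> In v l -> u < x < v -> ~ In x l ->
  mesh l u v d -> gap_bound l x m -> m <= d / 2.
Proof.
  intros Hu Hv Hx Hn Hm [H1 _].
  destruct (next_point l x v ltac:(lra) Hv) as [b [B1 [B2 B3]]].
  destruct (prev_point l u x ltac:(lra) Hu) as [a [A1 [A2 A3]]].
  specialize (H1 a b A1 B1 ltac:(lra)).
  assert (F : free l a b).
  { intros y Hy Hc. destruct (Rtotal_order y x) as [K|[K|K]].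
    - apply (A3 y Hy). lra.
    - subst; auto.
    - apply (B3 y Hy). lra. }
  assert (T := Hm a b ltac:(lra) ltac:(lra) ltac:(lra) F).
  assert (S := Rle_0_sqr ((x - a) - (b - x))). unfold Rsqr in S.
  assert (m <= (b - a) / 2) by (apply Rmult_le_reg_r with (b - a); lra). lra.
Qed.

Lemma Cmod_plus_i_sq (z : C) : Cmod (z + Ci) * Cmod (z + Ci) = Re z * Re z + (Im z + 1) * (Im z + 1).
Proof.
  destruct z as [x y]. unfold Cmod. simpl. rewrite sqrt_sqrt; [|apply Rplus_le_le_0_compat; rewrite Rmult_1_r; apply Rle_0_sqr]. unfold Re, Im; simpl. ring.
Qed.

Lemma Cmod_sq (z : C) : Cmod z * Cmod z = Re z * Re z + Im z * Im z.
Proof.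
  destruct z as [x y]. unfold Cmod. simpl. rewrite sqrt_sqrt; [|apply Rplus_le_le_0_compat; rewrite Rmult_1_r; apply Rle_0_sqr]. unfold Re, Im; simpl. ring.
Qed.

Section TwoConstant.
Variables (G : C -> Chat) (Y : C -> C) (l : list R) (u v del : R) (h : C -> C).
Hypotheses (HO : admissible G Y l) (Hu : In u l) (Hv : In v l) (Huv : u < v).
Hypotheses (Hm : mesh l u v del) (Hdel : 0 < del <= 1).
Hypothesis Hh : forall z, 0 < Im z -> cdiff h z.
Hypothesis Hb : forall z, 0 < Im z -> Cmod (h z) * Rmax 1 (Cmod (finite_part G z)) <= 1.
Let c := (u + v) / 2.
Let rho := (v - u) / 5.
Let N := rho * ln (/ del).
Let A (z : C) : C := (cexp (RtoC N * wexpo c rho z) / ((z + Ci) * (z + Ci)))%C.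
Let Q (z : C) : C := (h z * Y z * A z)%C.

Lemma tc_N : 0 <= N.
Proof.
  unfold N. apply Rmult_le_pos; [unfold rho; lra|]. rewrite <- ln_1. apply ln_le; [lra|].
  rewrite <- Rinv_1 at 1. apply Rinv_le_contravar; lra.
Qed.

Lemma tc_neq (z : C) : 0 <= Im z -> (z + Ci)%C <> 0%C.
Proof.
  intros Hz E. assert (T : Im (z + Ci)%C = 0) by now rewrite E.
  rewrite Cplus_Im in T. unfold Im at 2 in T. simpl in T. lra.
Qed.

Lemma tc_A_cdiff (z : C) : 0 <= Im z -> cdiff A z.
Proof.
  intros Hz. assert (Hrho : 0 < rho) by (unfold rho; lra). unfold A. apply cdiff_div.
  - apply (cdiff_comp cexp (fun z => RtoC N * wexpo c rho z)%C); [|apply cexp_cdiff].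
    apply cdiff_mult; [apply cdiff_const|]. apply wexpo_cdiff; auto.
  - apply cdiff_mult; (apply cdiff_plus; [apply cdiff_id|apply cdiff_const]).
  - apply Cmult_neq_0; now apply tc_neq.
Qed.

Lemma tc_A_Cmod (z : C) : 0 <= Im z ->
  Cmod (A z) = exp (N * weight c rho z) / (Cmod (z + Ci) * Cmod (z + Ci)).
Proof.
  intros Hz. assert (Hrho : 0 < rho) by (unfold rho; lra). unfold A.
  rewrite Cmod_div, cexp_Cmod, Cmod_mult by (apply Cmult_neq_0; now apply tc_neq).
  replace (Re (RtoC N * wexpo c rho z)) with (N * Re (wexpo c rho z)).
  - now rewrite wexpo_Re.
  - unfold Re. simpl. ring.
Qed.

Lemma tc_hY (z : C) : 0 < Im z -> Cmod (h z * Y z) <= dist_ratio G Y z.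
Proof.
  intros Hz. unfold dist_ratio. assert (M := Rmax_l 1 (Cmod (finite_part G z))).
  rewrite Cmod_mult. apply le_div; [lra|]. specialize (Hb z Hz). assert (P := Cmod_ge_0 (Y z)). nra.
Qed.

Lemma tc_h1 (z : C) : 0 < Im z -> Cmod (h z) <= 1.
Proof.
  intros Hz. assert (M := Rmax_l 1 (Cmod (finite_part G z))). specialize (Hb z Hz).
  assert (P := Cmod_ge_0 (h z)). nra.
Qed.

(** In the zone the ratio is at most del / 2, and N is chosen such that exp (N / rho) = 1 / del
    compensates exactly this. Elsewhere the weight is not positive, and the factor (z + i)^-2
    absorbs the linear growth of the ratio. The zone reaches 5/2 rho to either side of [c], beyond
    sqrt 5 * rho. *)
Lemma tc_mA (x : R) : ~ In x l -> dist_ratio G Y (RtoC x) * Cmod (A (RtoC x)) <= 4.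
Proof.
  intros Hx. assert (gap_bound := ok_HB _ _ _ HO x Hx). assert (M0 := mm_ge_0 G Y (RtoC x)).
  assert (Hrho : 0 < rho) by (unfold rho; lra). assert (N0 := tc_N).
  rewrite tc_A_Cmod by (unfold Im; simpl; lra). rewrite Cmod_plus_i_sq. unfold Re at 1 2, Im. simpl.
  replace (x * x + (0 + 1) * (0 + 1)) with (1 + x * x) by ring.
  assert (Px : 0 < 1 + x * x) by nra.
  destruct (Rlt_or_le ((x - c) * (x - c)) (5 * (rho * rho))) as [Hz|Hz].
  - assert (Hux : u < x < v) by (unfold c, rho in Hz; split; nra).
    assert (T := gap_bound_zone _ _ _ _ _ _ Hu Hv Hux Hx Hm gap_bound).
    assert (E : exp (N * weight c rho (RtoC x)) <= / del).
    { apply Rle_trans with (exp (ln (/ del))).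
      - destruct (Rle_lt_or_eq_dec (N * weight c rho (RtoC x)) (ln (/ del))) as [K|K].
        + replace (ln (/ del)) with (N * / rho) by (unfold N; field; lra).
          apply Rmult_le_compat_l; auto. apply weight_le; [auto|unfold Im; simpl; lra].
        + left. now apply exp_increasing.
        + right. now rewrite K.
      - right. apply exp_ln. apply Rinv_0_lt_compat; lra. }
    assert (Pe := exp_pos (N * weight c rho (RtoC x))).
    apply Rle_trans with (del / 2 * / del).
    + apply Rmult_le_compat; auto; [apply Rdiv_le_0_compat; lra|]. apply Rle_trans with (2 := E).
      apply div_le; auto. nra.
    + replace (del / 2 * / del) with (/ 2) by (field; lra). lra.
  - assert (W := weight_outside c rho x Hrho Hz).
    assert (E : exp (N * weight c rho (RtoC x)) <= 1).
    { assert (S : N * weight c rho (RtoC x) <= 0) by nra.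
      rewrite <- exp_0. destruct S as [S|S]; [left; now apply exp_increasing|right; now rewrite S]. }
    assert (T := gap_bound_far _ _ _ _ (ok_l _ _ _ HO) Hu M0 gap_bound Hx).
    assert (Pe := exp_pos (N * weight c rho (RtoC x))).
    apply Rle_trans with (2 * (1 + Rabs x) * (1 / (1 + x * x))).
    + apply Rmult_le_compat; auto; [apply Rdiv_le_0_compat; lra|].
      apply Rmult_le_compat_r; [left; now apply Rinv_0_lt_compat|auto].
    + replace (2 * (1 + Rabs x) * (1 / (1 + x * x))) with (2 * (1 + Rabs x) / (1 + x * x)) by (field; lra).
      apply div_le; auto. assert (Ex : x * x = Rabs x * Rabs x).
      { rewrite <- Rabs_mult. symmetry. apply Rabs_pos_eq, Rle_0_sqr. }
      rewrite Ex. nra.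
Qed.

(** No boundary behaviour of [h] is known. So its bounds |h| <= 1 and |h G| <= 1 are used above the
    line, the first if |G(x)| <= 1 and the second otherwise, and the remaining factor is continuous
    at [x]. At a point of [l] the ratio itself tends to 0. *)
Lemma tc_near (x : R) : exists d, 0 < d /\
  forall z, 0 < Im z -> Cmod (z - RtoC x) < d -> Cmod (Q z) <= 5.
Proof.
  assert (CA : ccont A (RtoC x)) by (apply cdiff_ccont, tc_A_cdiff; unfold Im; simpl; lra).
  destruct (classic (In x l)) as [Hx|Hx].
  - destruct (ok_near _ _ _ HO x Hx) as [K [d1 [D1 K1]]].
    destruct (CA 1 Rlt_0_1) as [d2 [D2 K2]].
    set (B := Cmod (A (RtoC x)) + 1). assert (B0 : 1 <= B) by (assert (T := Cmod_ge_0 (A (RtoC x))); unfold B; lra).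
    set (K0 := Rmax 0 K). assert (K00 : 0 <= K0) by apply Rmax_l. assert (KK : K <= K0) by apply Rmax_r.
    assert (P3 : 0 < 5 / ((K0 + 1) * B)) by (apply Rdiv_lt_0_compat; nra).
    exists (Rmin (Rmin d1 d2) (5 / ((K0 + 1) * B))).
    split; [apply Rmin_glb_lt; [apply Rmin_glb_lt; auto|auto]|]. intros z Hz Hd.
    assert (M1 := Rmin_l (Rmin d1 d2) (5 / ((K0 + 1) * B))).
    assert (M2 := Rmin_r (Rmin d1 d2) (5 / ((K0 + 1) * B))).
    assert (M3 := Rmin_l d1 d2). assert (M4 := Rmin_r d1 d2).
    assert (Nz : z <> RtoC x) by (intros ->; unfold Im in Hz; simpl in Hz; lra).
    assert (P := Cmod_minus_pos _ _ Nz).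
    specialize (K1 z ltac:(lra)). specialize (K2 z ltac:(lra)).
    assert (HA : Cmod (A z) <= B).
    { assert (T := Cmod_triangle (A z - A (RtoC x)) (A (RtoC x))).
      replace (A z - A (RtoC x) + A (RtoC x))%C with (A z) in T by ring. unfold B. lra. }
    unfold Q. rewrite Cmod_mult. assert (T := tc_hY z Hz).
    assert (QA := Cmod_ge_0 (A z)). assert (QY := Cmod_ge_0 (h z * Y z)).
    set (w := Cmod (z - RtoC x)) in *.
    assert (T2 : w * ((K0 + 1) * B) <= 5).
    { assert (w <= 5 / ((K0 + 1) * B)) by lra.
      apply Rmult_le_compat_r with (r := (K0 + 1) * B) in H; [|nra].
      replace (5 / ((K0 + 1) * B) * ((K0 + 1) * B)) with 5 in H by (field; nra). exact H. }
    apply Rle_trans with ((K0 + 1) * w * B); [|lra].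
    apply Rmult_le_compat; auto. nra.
  - assert (HmA := tc_mA x Hx).
    assert (Hz0 : ~ inE l (RtoC x)) by (intros [y [H1 H2]]; apply RtoC_inj in H2; now subst).
    destruct (ok_Y _ _ _ HO _ Hz0) as [YD YN].
    assert (GN : G (RtoC x) <> CInfinity).
    { intros E. apply (ok_omit _ _ _ HO _ Hz0). unfold zero_one_infty; auto. }
    assert (GC : ccont (finite_part G) (RtoC x)) by (now apply cdiff_ccont, (ok_diff _ _ _ HO)).
    assert (YA : ccont (fun z => Y z * A z)%C (RtoC x)) by (apply ccont_mult; auto; now apply cdiff_ccont).
    destruct (Rle_or_lt (Cmod (finite_part G (RtoC x))) 1) as [L|L].
    + unfold dist_ratio in HmA. rewrite Rmax_left in HmA by auto.
      destruct (YA 1 Rlt_0_1) as [d [D K]]. exists d. split; auto. intros z Hz Hd.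
      specialize (K z Hd).
      assert (T := Cmod_triangle (Y z * A z - Y (RtoC x) * A (RtoC x)) (Y (RtoC x) * A (RtoC x))).
      replace (Y z * A z - Y (RtoC x) * A (RtoC x) + Y (RtoC x) * A (RtoC x))%C
        with (Y z * A z)%C in T by ring.
      rewrite (Cmod_mult (Y (RtoC x))) in T.
      unfold Q. replace (h z * Y z * A z)%C with (h z * (Y z * A z))%C by ring.
      rewrite Cmod_mult. assert (H1 := tc_h1 z Hz). assert (QA := Cmod_ge_0 (Y z * A z)). nra.
    + unfold dist_ratio in HmA. rewrite Rmax_right in HmA by lra.
      assert (FN : finite_part G (RtoC x) <> 0%C) by (apply Cmod_gt_0; lra).
      assert (YG : ccont (fun z => Y z * A z * / finite_part G z)%C (RtoC x))
        by (apply ccont_mult; auto; now apply ccont_inv).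
      destruct (YG 1 Rlt_0_1) as [d [D K]]. destruct (ccont_bounds _ _ GC FN) as [d2 [D2 K2]].
      exists (Rmin d d2). split; [now apply Rmin_glb_lt|]. intros z Hz Hd.
      assert (M1 := Rmin_l d d2). assert (M2 := Rmin_r d d2).
      specialize (K z ltac:(lra)). specialize (K2 z ltac:(lra)).
      assert (FZ : finite_part G z <> 0%C) by (apply Cmod_gt_0; lra).
      set (B0 := (Y (RtoC x) * A (RtoC x) * / finite_part G (RtoC x))%C) in *.
      assert (T := Cmod_triangle (Y z * A z * / finite_part G z - B0) B0).
      replace (Y z * A z * / finite_part G z - B0 + B0)%C
        with (Y z * A z * / finite_part G z)%C in T by ring.
      assert (EB : Cmod B0 <= 4).
      { unfold B0. rewrite !Cmod_mult, Cmod_inv by auto. unfold Rdiv in HmA. lra. }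
      unfold Q. replace (h z * Y z * A z)%C with
        ((h z * finite_part G z) * (Y z * A z * / finite_part G z))%C by (field; auto).
      rewrite (Cmod_mult (h z * finite_part G z)), (Cmod_mult (h z)).
      assert (H1 := Hb z Hz). assert (R1 := Rmax_r 1 (Cmod (finite_part G z))).
      assert (P1 := Cmod_ge_0 (h z)).
      assert (H2 : Cmod (h z) * Cmod (finite_part G z) <= 1) by nra.
      assert (P2 := Cmod_ge_0 (Y z * A z * / finite_part G z)).
      assert (P3 : 0 <= Cmod (h z) * Cmod (finite_part G z)) by (apply Rmult_le_pos; apply Cmod_ge_0).
      nra.
Qed.

Lemma tc_far : exists R0, forall z, 0 < Im z -> R0 <= Cmod z -> Cmod (Q z) <= 5.
Proof.
  assert (Hrho : 0 < rho) by (unfold rho; lra). assert (N0 := tc_N).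
  destruct (ok_inf _ _ _ HO) as [K [r H]].
  set (K0 := Rmax 0 K). assert (K00 : 0 <= K0) by apply Rmax_l. assert (KK : K <= K0) by apply Rmax_r.
  set (B := exp (N * / rho)). assert (B0 : 0 < B) by apply exp_pos.
  exists (Rmax r (K0 * B + 1)). intros z Hz Hr.
  assert (M1 := Rmax_l r (K0 * B + 1)). assert (M2 := Rmax_r r (K0 * B + 1)).
  specialize (H z ltac:(lra)). assert (T := tc_hY z Hz).
  unfold Q. rewrite Cmod_mult, tc_A_Cmod by lra.
  assert (W : exp (N * weight c rho z) <= B).
  { assert (S : N * weight c rho z <= N * / rho) by (apply Rmult_le_compat_l; auto; apply weight_le; lra).
    unfold B. destruct S as [S|S]; [left; now apply exp_increasing|right; now rewrite S]. }
  assert (Sq : Cmod z * Cmod z <= Cmod (z + Ci) * Cmod (z + Ci)) by (rewrite Cmod_plus_i_sq, Cmod_sq; nra).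
  set (n := Cmod z) in *. set (D := Cmod (z + Ci) * Cmod (z + Ci)) in *.
  assert (n1 : 1 <= n) by nra. assert (D1 : 0 < D) by nra.
  assert (Pe := exp_pos (N * weight c rho z)).
  apply Rle_trans with (K0 * n * (B / (n * n))).
  - apply Rmult_le_compat; [apply Cmod_ge_0|apply Rdiv_le_0_compat; lra|nra|].
    apply Rmult_le_compat; [lra|left; now apply Rinv_0_lt_compat|auto|].
    apply Rinv_le_contravar; nra.
  - replace (K0 * n * (B / (n * n))) with (K0 * B / n) by (field; lra). apply div_le; lra.
Qed.

(** The maximum principle on a large rectangle with its lower side slightly above the real line:
    [tc_far] covers the other three sides, [tc_near] and compactness the lower one. *)
Lemma tc_Q (p : C) : 0 < Im p -> Cmod (Q p) <= 5.
Proof.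
  intros Hp. destruct tc_far as [R0 HR].
  set (a := Rmax (Cmod p + 1) R0). assert (A1 : Cmod p + 1 <= a) by apply Rmax_l.
  assert (A2 : R0 <= a) by apply Rmax_r.
  (* The factor 2 leaves room for the horizontal distance to the centre of the covering interval as
     well as for the height of the lower side. *)
  assert (CH : forall x, exists d : posreal, forall z, 0 < Im z -> Cmod (z - RtoC x) < 2 * d -> Cmod (Q z) <= 5).
  { intros x. destruct (tc_near x) as [d [D H]]. assert (D2 : 0 < d / 2) by lra.
    exists (mkposreal _ D2). simpl. intros z Hz Hd. apply H; lra. }
  apply (choice_fun _ _ (fun x (d : posreal) => forall z, 0 < Im z -> Cmod (z - RtoC x) < 2 * d -> Cmod (Q z) <= 5)) in CH.
  destruct CH as [delta Hdelta].
  destruct (compactness_value_1d (- a) a delta) as [d Hd].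
  set (eta := Rmin (d / 2) (Im p / 2)). assert (d0 := cond_pos d).
  assert (E0 : 0 < eta) by (apply Rmin_glb_lt; lra).
  assert (E1 : eta <= d / 2) by apply Rmin_l. assert (E2 : eta <= Im p / 2) by apply Rmin_r.
  assert (Rp := re_le_Cmod p). assert (Ip := im_le_Cmod p).
  apply Rle_trans with (r3 := a - 1) in Rp; [|lra]. apply Rle_trans with (r3 := a - 1) in Ip; [|lra].
  apply Rabs_le_between in Rp. apply Rabs_le_between in Ip.
  apply (maximum_modulus Q (- a) a eta a 5 p).
  - unfold interior. unfold Re, Im in *. lra.
  - intros z [Z1 Z2]. assert (Hz : 0 < Im z) by lra. unfold Q.
    apply cdiff_mult; [apply cdiff_mult; [now apply Hh|]|apply tc_A_cdiff; lra].
    apply (ok_Y _ _ _ HO). intros [x [_ ->]]. unfold Im in Hz; simpl in Hz; lra.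
  - intros z [[Z1 Z2] Z3]. assert (Hz : 0 < Im z) by lra.
    assert (Rz := re_le_Cmod z). assert (Iz := im_le_Cmod z).
    destruct (Rlt_or_le (Cmod z) R0) as [L|L]; [|now apply HR].
    destruct Z3 as [Z3|[Z3|[Z3|Z3]]].
    + exfalso. change (fst z) with (Re z) in Rz. rewrite Z3, Rabs_Ropp in Rz.
      assert (T := Rle_abs a). lra.
    + exfalso. change (fst z) with (Re z) in Rz. rewrite Z3 in Rz. assert (T := Rle_abs a). lra.
    + apply NNPP. intros Hn. apply (Hd (Re z) Z1). intros [t [T1 [T2 T3]]]. apply Hn.
      apply (Hdelta t); auto.
      apply Rle_lt_trans with (1 := Cmod_le_abs _). rewrite Cminus_R_Im, Z3, Cminus_Re.
      rewrite (Rabs_pos_eq eta) by lra. change (Re (RtoC t)) with t. lra.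
    + exfalso. rewrite Z3 in Iz. assert (T := Rle_abs a). lra.
Qed.

Lemma two_constant (p : C) : 0 < Im p ->
  Cmod (h p * Y p) <= 5 * (Cmod (p + Ci) * Cmod (p + Ci)) * exp (- (N * weight c rho p)).
Proof.
  intros Hp. assert (T := tc_Q p Hp). unfold Q in T. rewrite Cmod_mult, tc_A_Cmod in T by lra.
  assert (P := proj1 (Cmod_gt_0 _) (tc_neq p ltac:(lra))).
  rewrite exp_Ropp. set (E := exp (N * weight c rho p)) in *. assert (E0 : 0 < E) by apply exp_pos.
  set (n := Cmod (p + Ci)) in *. apply le_div; auto.
  replace (Cmod (h p * Y p) * E) with (Cmod (h p * Y p) * (E / (n * n)) * (n * n)) by (field; lra).
  apply Rmult_le_compat_r; [nra|auto].
Qed.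
End TwoConstant.

(** * The sequence of functions *)

Record state : Type := State {
  sG : C -> Chat; sY : C -> C; sl : list R; su : R; sv : R }.

(** The condition on [D] is the one under which [fill] keeps half of the zone. *)
Definition good (S : state) : Prop :=
  admissible (sG S) (sY S) (sl S) /\ In (su S) (sl S) /\ In (sv S) (sl S) /\ su S < sv S /\
  exists D, 0 < D /\ mesh (sl S) (su S) (sv S) D /\ 1000000 * D <= sv S - su S.

Definition strans (f J : C -> C) (K : R) (S S' : state) : Prop :=
  trans f J K (sG S) (sY S) (su S) (sv S) (sG S') (sY S') (su S') (sv S').

(* The points over 0, 1, infinity are so dense somewhere that [two_constant] wins by
   a factor [exp (- n)]. *)
Definition dense (n : nat) (lam : R) (S : state) : Prop := exists a b del,
  In a (sl S) /\ In b (sl S) /\ a < b /\ b - a <= lam /\ 0 < del <= 1 /\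
  mesh (sl S) a b del /\ INR n <= (b - a) / 5 * ln (/ del).

Lemma trans_shrink (f J : C -> C) (K : R) (G : C -> Chat) (Y : C -> C) (u v : R)
    (G' : C -> Chat) (Y' : C -> C) (u' v' w : R) : u' < w <= v' ->
  trans f J K G Y u v G' Y' u' v' -> trans f J K G Y u v G' Y' u' w.
Proof.
  intros Hw H. assert (Z := tr_zone _ _ _ _ _ _ _ _ _ _ _ H).
  assert (k := tr_K _ _ _ _ _ _ _ _ _ _ _ H). constructor; try apply H.
  - lra.
  - split; [lra|]. apply Rle_trans with (1 := proj2 k). apply Rmult_le_compat_l; lra.
Qed.

(** The whole filled zone provides the density, while only a short piece at its left end becomes the
    next zone. *)
Lemma next_state (S : state) (n : nat) : good S -> exists S' f J K, good S' /\
  strans f J K S S' /\ sv S' - su S' <= (sv S - su S) / 8 /\ dense n (sv S - su S) S'.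
Proof.
  intros [HO [Hu [Hv [Huv [D [HD [Hm HDL]]]]]]]. set (lam := sv S - su S) in *.
  assert (Hl : 0 < lam) by (unfold lam; lra).
  (* The exponential gives ln (1 / eps) >= 10 n / lam, enough for [dense] as at least half of the
     zone remains. The last bound makes the next zone, which is longer than lam / 16, at least
     1000000 eps long. *)
  set (eps := Rmin 1 (Rmin (exp (- (10 * INR n / lam))) (lam / 16000000))).
  assert (E1 : eps <= 1) by apply Rmin_l.
  assert (E2 : eps <= exp (- (10 * INR n / lam))).
  { eapply Rle_trans; [apply Rmin_r|apply Rmin_l]. }
  assert (E3 : eps <= lam / 16000000).
  { eapply Rle_trans; [apply Rmin_r|apply Rmin_r]. }
  assert (E0 : 0 < eps).
  { apply Rmin_glb_lt; [lra|]. apply Rmin_glb_lt; [apply exp_pos|lra]. }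
  destruct (fill D eps _ _ _ _ _ HD E0 HO Hu Hv Huv Hm HDL)
    as [f [J [K [G1 [Y1 [l1 [u1 [v1 [A1 [A2 [A3 [A4 [A5 A6]]]]]]]]]]]]].
  fold lam in A6. assert (Z := tr_zone _ _ _ _ _ _ _ _ _ _ _ A4).
  assert (W : exists w, In w l1 /\ u1 + lam / 16 < w < u1 + lam / 8).
  { apply NNPP. intros H. assert (F : free l1 (u1 + lam / 16) (u1 + lam / 8)).
    { intros x Hx Hc. apply H. now exists x. }
    assert (T := A5 (u1 + lam / 16) (u1 + lam / 8) ltac:(lra) ltac:(lra) ltac:(lra) F). lra. }
  destruct W as [w [W1 W2]].
  exists (State G1 Y1 l1 u1 w), f, J, K. split; [|split; [|split]].
  - split; [auto|]. simpl. split; [auto|]. split; [auto|]. split; [lra|].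
    exists eps. split; [auto|]. split; [|lra]. intros a b Ha Hab Hb Hf. apply A5; auto. lra.
  - apply trans_shrink with (v' := v1); [simpl; lra|exact A4].
  - simpl. lra.
  - exists u1, v1, eps. simpl. split; [auto|]. split; [auto|]. split; [lra|].
    split; [unfold lam; lra|]. split; [lra|]. split; [auto|].
    assert (L : 10 * INR n / lam <= ln (/ eps)).
    { rewrite ln_Rinv by auto. assert (T := ln_le _ _ E0 E2). rewrite ln_exp in T. lra. }
    apply Rle_trans with (lam / 10 * (10 * INR n / lam)); [right; field; lra|].
    assert (0 <= 10 * INR n / lam).
    { apply Rdiv_le_0_compat; [|auto]. assert (T := pos_INR n). lra. }
    apply Rmult_le_compat; lra.
Qed.

Lemma state_sequence : exists (S : nat -> state) (f J : nat -> C -> C) (K : nat -> R),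
  forall n, good (S n) /\ strans (f n) (J n) (K n) (S n) (S (Datatypes.S n)) /\
    sv (S (Datatypes.S n)) - su (S (Datatypes.S n)) <= (sv (S n) - su (S n)) / 8 /\
    dense n (sv (S n) - su (S n)) (S (Datatypes.S n)).
Proof.
  assert (S0 : exists S, good S).
  { destruct (initial_state (/ 1000000) ltac:(lra)) as [G [Y [l [H1 [H2 [H3 H4]]]]]].
    exists (State G Y l (-1) 1). split; [auto|]. simpl. split; [auto|]. split; [auto|].
    split; [lra|]. exists (/ 1000000). split; [lra|]. split; [exact H4|lra]. }
  destruct S0 as [S0 H0].
  destruct (choice_fun (nat * {S | good S}) ({S | good S} * ((C -> C) * (C -> C) * R))
    (fun x y => let S := proj1_sig (snd x) in let S' := proj1_sig (fst y) in
       strans (fst (fst (snd y))) (snd (fst (snd y))) (snd (snd y)) S S' /\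
       sv S' - su S' <= (sv S - su S) / 8 /\ dense (fst x) (sv S - su S) S')) as [nxt Hn].
  { intros [n [S HS]]. destruct (next_state S n HS) as [S' [f [J [K [A [B [C D]]]]]]].
    exists (exist _ S' A, (f, J, K)). simpl. auto. }
  set (T := fix T n := match n with O => exist good S0 H0 | Datatypes.S m => fst (nxt (m, T m)) end).
  exists (fun n => proj1_sig (T n)), (fun n => fst (fst (snd (nxt (n, T n))))),
    (fun n => snd (fst (snd (nxt (n, T n))))), (fun n => snd (snd (nxt (n, T n)))).
  intros n. split; [exact (proj2_sig (T n))|]. exact (Hn (n, T n)).
Qed.

(** * Limits of the changes of variable *)

Lemma R_limit (s b : nat -> R) : (forall j m, Rabs (s (m + j)%nat - s j) <= b j) ->
  (forall eps, 0 < eps -> exists N, forall j, (N <= j)%nat -> b j <= eps) ->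
  exists L, forall j, Rabs (s j - L) <= b j.
Proof.
  intros H Hb. destruct (Rcomplete.R_complete s) as [L HL].
  - intros eps He. destruct (Hb (eps / 3) ltac:(lra)) as [N HN]. exists N. intros n m Hn Hm.
    assert (A := H N (n - N)%nat). assert (B := H N (m - N)%nat).
    rewrite Nat.sub_add in A, B by lia. specialize (HN N (le_n N)).
    unfold Rdist. apply Rabs_le_between in A. apply Rabs_le_between in B.
    apply Rabs_lt_between. lra.
  - exists L. intros j. apply le_epsilon. intros eps He. destruct (HL eps He) as [N HN].
    specialize (HN (N + j)%nat ltac:(lia)). unfold Rdist in HN. specialize (H j N).
    apply Rabs_le_between in H. apply Rabs_lt_between in HN. apply Rabs_le. lra.
Qed.

Lemma C_limit (s : nat -> C) (b : nat -> R) : (forall j m, Cmod (s (m + j)%nat - s j) <= b j) ->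
  (forall eps, 0 < eps -> exists N, forall j, (N <= j)%nat -> b j <= eps) ->
  exists L, forall j, Cmod (s j - L) <= b j.
Proof.
  intros H Hb.
  destruct (R_limit (fun j => Re (s j)) b) as [x Hx]; auto.
  { intros j m. rewrite <- Cminus_Re. apply Rle_trans with (2 := H j m). apply re_le_Cmod. }
  destruct (R_limit (fun j => Im (s j)) b) as [y Hy]; auto.
  { intros j m. rewrite <- Cminus_Im. apply Rle_trans with (2 := H j m). apply im_le_Cmod. }
  exists (x, y). intros j. apply le_epsilon. intros eps He.
  destruct (Hb (eps / 2) ltac:(lra)) as [N HN]. specialize (HN (N + j)%nat ltac:(lia)).
  specialize (H j N). rewrite Cmod_minus_sym in H.
  assert (E : Cmod (s (N + j)%nat - (x, y)) <= eps).
  { apply Rle_trans with (1 := Cmod_le_abs _). rewrite Cminus_Re, Cminus_Im.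
    change (Re (x, y)) with x. change (Im (x, y)) with y.
    specialize (Hx (N + j)%nat). specialize (Hy (N + j)%nat). lra. }
  assert (T2 := Cmod_tri_minus (s j) (s (N + j)%nat) (x, y)). lra.
Qed.

Lemma C_limit_unique (s : nat -> C) (b : nat -> R) (L L' : C) :
  (forall eps, 0 < eps -> exists N, forall j, (N <= j)%nat -> b j <= eps) ->
  (forall j, Cmod (s j - L) <= b j) -> (forall j, Cmod (s j - L') <= b j) -> L = L'.
Proof.
  intros Hb H H'. apply NNPP. intros N. assert (P := Cmod_minus_pos _ _ N).
  destruct (Hb (Cmod (L - L') / 3) ltac:(lra)) as [j Hj]. specialize (Hj j (le_n j)).
  assert (T := Cmod_tri_minus L (s j) L'). specialize (H j). specialize (H' j).
  rewrite Cmod_minus_sym in H. lra.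
Qed.

Section Limit.
Variables (S : nat -> state) (f J : nat -> C -> C) (K : nat -> R).
Hypothesis HS : forall n, good (S n) /\ strans (f n) (J n) (K n) (S n) (S (Datatypes.S n)) /\
    sv (S (Datatypes.S n)) - su (S (Datatypes.S n)) <= (sv (S n) - su (S n)) / 8.

Let lam (n : nat) : R := sv (S n) - su (S n).

(** The composition of f_n, ..., f_(n+j-1), where f_n is applied last. Indices are written j + n so
    that they reduce by recursion on j. *)
Fixpoint comp_f (n j : nat) : C -> C :=
  match j with O => fun z => z | Datatypes.S j => fun z => comp_f n j (f (j + n) z) end.
Fixpoint comp_J (n j : nat) : C -> C :=
  match j with O => fun z => z | Datatypes.S j => fun z => J (j + n) (comp_J n j z) end.
Fixpoint comp_K (n j : nat) : R :=
  match j with O => 0 | Datatypes.S j => comp_K n j + K (j + n) end.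

Lemma lam_pos (n : nat) : 0 < lam n.
Proof. destruct (HS n) as [[_ [_ [_ [H _]]]] _]. unfold lam. lra. Qed.

Lemma comp_f_trans (n j : nat) : strans (comp_f n j) (comp_J n j) (comp_K n j) (S n) (S (j + n)).
Proof.
  induction j as [|j IH].
  - apply trans_refl. assert (T := lam_pos n). unfold lam in T. simpl. lra.
  - exact (trans_comp _ _ _ _ _ _ _ _ _ _ _ _ _ _ _ _ _ _ IH (proj1 (proj2 (HS (j + n)%nat)))).
Qed.

Lemma comp_f_split (n j m : nat) (z : C) : comp_f n (m + j) z = comp_f n j (comp_f (j + n) m z).
Proof.
  revert z. induction m as [|m IH]; intros z; [reflexivity|]. simpl.
  rewrite IH, Nat.add_assoc. reflexivity.
Qed.

Lemma comp_J_split (n j m : nat) (z : C) : comp_J n (m + j) z = comp_J (j + n) m (comp_J n j z).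
Proof.
  induction m as [|m IH]; [reflexivity|]. simpl. now rewrite IH, Nat.add_assoc.
Qed.

Lemma lam_small (n : nat) (eps : R) : 0 < eps ->
  exists N, forall j, (N <= j)%nat -> lam (j + n) <= eps.
Proof.
  intros He.
  assert (G : forall j, lam (j + n) <= lam n * (/ 8) ^ j).
  { induction j as [|j IH]; [simpl; lra|].
    assert (T := proj2 (proj2 (HS (j + n)%nat))). fold (lam (j + n)) in T.
    change (lam (Datatypes.S (j + n)) <= lam (j + n) / 8) in T. simpl. lra. }
  destruct (pow_lt_1_zero (/ 8) ltac:(rewrite Rabs_pos_eq; lra) (eps / lam n)) as [N HN].
  { apply Rdiv_lt_0_compat; auto. apply lam_pos. }
  exists N. intros j Hj. apply Rle_trans with (1 := G j). specialize (HN j Hj).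
  rewrite Rabs_pos_eq in HN by (apply pow_le; lra). assert (P := lam_pos n).
  apply Rmult_lt_compat_l with (r := lam n) in HN; auto.
  replace (lam n * (eps / lam n)) with eps in HN by (field; lra). lra.
Qed.

Lemma zone_mono (n j : nat) : su (S n) <= su (S (j + n)) /\ sv (S (j + n)) <= sv (S n).
Proof. assert (Z := tr_zone _ _ _ _ _ _ _ _ _ _ _ (comp_f_trans n j)). lra. Qed.

Lemma lam_mono (n j : nat) : lam (j + n) <= lam n.
Proof. assert (Z := zone_mono n j). unfold lam. lra. Qed.

Lemma common_point : exists t, forall n, su (S n) <= t <= sv (S n).
Proof.
  assert (H : forall n m, su (S n) <= sv (S m)).
  { intros n m. destruct (zone_mono n m) as [A _]. destruct (zone_mono m n) as [_ B].
    rewrite Nat.add_comm in B. assert (T := lam_pos (m + n)). unfold lam in T. lra. }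
  destruct (completeness (fun x => exists n, x = su (S n))) as [t [T1 T2]].
  - exists (sv (S 0)). intros x [n ->]. apply H.
  - exists (su (S 0)). now exists 0%nat.
  - exists t. intros n. split; [apply T1; now exists n|]. apply T2. intros x [m ->]. apply H.
Qed.

Variable ts : R.
Hypothesis Hts : forall n, su (S n) <= ts <= sv (S n).

(** The factor 6 leaves room for a displacement by lam / 4 within the region of distance at least
    21/4 lam, in which the estimates for the compositions hold. *)
Definition off_zone (n : nat) (z : C) : Prop := 6 * lam n <= Cmod (z - RtoC ts).

Lemma far_of (n : nat) (z : C) (d : R) : d <= Cmod (z - RtoC ts) -> far (su (S n)) (sv (S n)) (d - lam n) z.
Proof.
  intros H x Hx. assert (T := Cmod_tri_minus z (RtoC x) (RtoC ts)).
  rewrite <- RtoC_minus, Cmod_R in T. assert (B := Hts n).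
  assert (Rabs (x - ts) <= lam n) by (apply Rabs_le; unfold lam; lra). lra.
Qed.

Lemma comp_K_bound (n j : nat) : 0 <= comp_K n j <= lam n * lam n.
Proof.
  destruct (tr_K _ _ _ _ _ _ _ _ _ _ _ (comp_f_trans n j)) as [A B]. split; auto.
  apply Rle_trans with (1 := B). fold (lam n) (lam (j + n)). assert (P := lam_pos n).
  assert (Q := lam_pos (j + n)). apply Rmult_le_compat_l; lra.
Qed.

(* Constants for e = 4 lam: K / e <= lam / 4 and exp (K / e^2) <= 16 / 15. *)
Lemma off_zone_consts (n j : nat) : 0 < 4 * lam n /\ comp_K n j / (4 * lam n) <= lam n / 4 /\
  1 <= exp (comp_K n j / (4 * lam n * (4 * lam n))) <= 16 / 15.
Proof.
  assert (P := lam_pos n). destruct (comp_K_bound n j) as [A B].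
  split; [lra|]. split; [apply div_le; nra|].
  assert (X : 0 <= comp_K n j / (4 * lam n * (4 * lam n)) <= / 16).
  { split; [apply Rdiv_le_0_compat; nra|apply div_le; nra]. }
  set (x := comp_K n j / (4 * lam n * (4 * lam n))) in *.
  split; [assert (T := one_plus_le_exp x); lra|].
  assert (T := one_plus_le_exp (- x)). rewrite exp_Ropp in T.
  assert (E := exp_pos x). apply Rmult_le_compat_r with (r := exp x) in T; [|lra].
  rewrite Rinv_l in T by lra. nra.
Qed.

(** Here 21/4 = 1 + 4 + 1/4: the length of the zone around [ts], the distance e = 4 lam, and the
    displacement K / e. *)
Lemma comp_f_far (n j : nat) (z : C) : 21 / 4 * lam n <= Cmod (z - RtoC ts) ->
  cdiff (comp_f n j) z /\ Cmod (comp_f n j z - z) <= lam n / 4 /\ sG (S (j + n)) z = sG (S n) (comp_f n j z) /\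
  Cmod (sY (S n) (comp_f n j z)) <= 16 / 15 * Cmod (sY (S (j + n)) z) /\
  comp_f n j (Cconj z) = Cconj (comp_f n j z).
Proof.
  intros Hz. destruct (off_zone_consts n j) as [E0 [E1 E2]]. assert (P := lam_pos n).
  assert (F : far (su (S n)) (sv (S n)) (4 * lam n + comp_K n j / (4 * lam n)) z).
  { apply far_mono with (4 := far_of n z _ Hz); lra. }
  destruct (tr_far _ _ _ _ _ _ _ _ _ _ _ (comp_f_trans n j) _ z E0 F) as [A1 [A2 [A3 [A4 A5]]]].
  split; [auto|]. split; [lra|]. split; [auto|]. split; [|auto].
  apply Rle_trans with (1 := A4). apply Rmult_le_compat_r; [apply Cmod_ge_0|lra].
Qed.

Lemma comp_f_two (n j : nat) (z w : C) : 21 / 4 * lam n <= Cmod (z - RtoC ts) ->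
  21 / 4 * lam n <= Cmod (w - RtoC ts) ->
  Cmod (comp_f n j z - comp_f n j w - (z - w)) <= / 15 * Cmod (z - w).
Proof.
  intros Hz Hw. destruct (off_zone_consts n j) as [E0 [E1 E2]]. assert (P := lam_pos n).
  assert (F : forall y, 21 / 4 * lam n <= Cmod (y - RtoC ts) ->
    far (su (S n)) (sv (S n)) (4 * lam n + comp_K n j / (4 * lam n)) y).
  { intros y Hy. apply far_mono with (4 := far_of n y _ Hy); lra. }
  apply Rle_trans with (1 := tr_two _ _ _ _ _ _ _ _ _ _ _ (comp_f_trans n j) _ z w E0 (F z Hz) (F w Hw)).
  apply Rmult_le_compat_r; [apply Cmod_ge_0|lra].
Qed.

Lemma off_zone_mono (n j : nat) (z : C) : off_zone n z -> off_zone (j + n) z.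
Proof. unfold off_zone. intros H. assert (T := lam_mono n j). lra. Qed.

(** The further maps act first and move [z] by at most lam (j + n) / 4; the composition of the first
    j maps is Lipschitz with constant 16/15. *)
Lemma comp_f_cauchy (n j m : nat) (z : C) : off_zone n z -> Cmod (comp_f n (m + j) z - comp_f n j z) <= lam (j + n).
Proof.
  intros Hz. rewrite comp_f_split. assert (P := lam_pos n). assert (Pj := lam_pos (j + n)).
  assert (M := lam_mono n j).
  assert (Hzj := off_zone_mono n j z Hz). unfold off_zone in Hz, Hzj.
  destruct (comp_f_far (j + n) m z ltac:(lra)) as [_ [A _]]. set (w := comp_f (j + n) m z) in *.
  assert (Hw : 21 / 4 * lam n <= Cmod (w - RtoC ts)).
  { assert (T := Cmod_tri_minus z w (RtoC ts)). rewrite Cmod_minus_sym in A. lra. }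
  assert (B := comp_f_two n j w z Hw ltac:(lra)).
  assert (T := Cmod_triangle (comp_f n j w - comp_f n j z - (w - z)) (w - z)).
  replace (comp_f n j w - comp_f n j z - (w - z) + (w - z))%C with (comp_f n j w - comp_f n j z)%C in T by ring. lra.
Qed.

Lemma Phi_exists : exists Phi : nat -> C -> C, forall n z, off_zone n z ->
  forall j, Cmod (comp_f n j z - Phi n z) <= lam (j + n).
Proof.
  assert (H : forall x : nat * C, exists L, off_zone (fst x) (snd x) ->
    forall j, Cmod (comp_f (fst x) j (snd x) - L) <= lam (j + fst x)).
  { intros [n z]. simpl. destruct (classic (off_zone n z)) as [Hz|Hz].
    - destruct (C_limit (fun j => comp_f n j z) (fun j => lam (j + n))) as [L HL].
      + intros j m. now apply comp_f_cauchy.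
      + intros eps He. now apply lam_small.
      + exists L. auto.
    - exists z. intros; contradiction. }
  apply choice_fun in H. destruct H as [P HP]. exists (fun n z => P (n, z)).
  intros n z. exact (HP (n, z)).
Qed.

Lemma lam2_small (n : nat) (y eps : R) : 0 < y -> 0 < eps ->
  exists N, forall j, (N <= j)%nat -> lam (j + n) * lam (j + n) / y <= eps.
Proof.
  intros Hy He. destruct (lam_small n (Rmin 1 (eps * y))) as [N HN].
  { apply Rmin_glb_lt; nra. }
  exists N. intros j Hj. specialize (HN j Hj). assert (P := lam_pos (j + n)).
  assert (A := Rmin_l 1 (eps * y)). assert (B := Rmin_r 1 (eps * y)). apply div_le; nra.
Qed.

(** The right inverses only raise imaginary parts, so, unlike the compositions themselves, they
    converge on the whole upper half-plane. *)
Lemma eta_exists : exists eta : nat -> C -> C, forall n t, 0 < Im t ->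
  forall j, Cmod (comp_J n j t - eta n t) <= lam (j + n) * lam (j + n) / Im t.
Proof.
  assert (H : forall x : nat * C, exists L, 0 < Im (snd x) ->
    forall j, Cmod (comp_J (fst x) j (snd x) - L) <= lam (j + fst x) * lam (j + fst x) / Im (snd x)).
  { intros [n t]. simpl. destruct (Rlt_or_le 0 (Im t)) as [Ht|Ht].
    - destruct (C_limit (fun j => comp_J n j t) (fun j => lam (j + n) * lam (j + n) / Im t)) as [L HL].
      + intros j m. rewrite comp_J_split.
        destruct (tr_J _ _ _ _ _ _ _ _ _ _ _ (comp_f_trans n j) t Ht) as [A1 _].
        destruct (tr_J _ _ _ _ _ _ _ _ _ _ _ (comp_f_trans (j + n) m) (comp_J n j t) ltac:(lra)) as [_ [A2 _]].
        apply Rle_trans with (1 := A2). destruct (comp_K_bound (j + n) m) as [B1 B2].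
        apply Rmult_le_compat; [auto|left; apply Rinv_0_lt_compat; lra|auto|].
        apply Rinv_le_contravar; lra.
      + intros eps He. now apply lam2_small.
      + exists L. auto.
    - exists t. intros; lra. }
  apply choice_fun in H. destruct H as [P HP]. exists (fun n z => P (n, z)).
  intros n z. exact (HP (n, z)).
Qed.

Variables Phi eta : nat -> C -> C.
Hypothesis HPhi : forall n z, off_zone n z -> forall j, Cmod (comp_f n j z - Phi n z) <= lam (j + n).
Hypothesis Heta : forall n t, 0 < Im t ->
  forall j, Cmod (comp_J n j t - eta n t) <= lam (j + n) * lam (j + n) / Im t.

Lemma Phi_near (n : nat) (z : C) : off_zone n z -> Cmod (Phi n z - z) <= lam n / 4.
Proof.
  intros Hz. apply le_epsilon. intros eps He. destruct (lam_small n eps He) as [j Hj].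
  specialize (Hj j (le_n j)). assert (A := HPhi n z Hz j). assert (P := lam_pos n).
  destruct (comp_f_far n j z) as [_ [B _]]; [unfold off_zone in Hz; lra|].
  assert (T := Cmod_tri_minus (Phi n z) (comp_f n j z) z). rewrite Cmod_minus_sym in A. lra.
Qed.

Lemma Phi_far (n j : nat) (z : C) : off_zone n z -> 21 / 4 * lam n <= Cmod (Phi (j + n) z - RtoC ts).
Proof.
  intros Hz. assert (A := Phi_near (j + n) z (off_zone_mono n j z Hz)). assert (M := lam_mono n j).
  assert (P := lam_pos n). unfold off_zone in Hz.
  assert (T := Cmod_tri_minus z (Phi (j + n) z) (RtoC ts)). rewrite Cmod_minus_sym in A. lra.
Qed.

Lemma Phi_two (n : nat) (z w : C) : off_zone n z -> off_zone n w ->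
  Cmod (Phi n z - Phi n w - (z - w)) <= / 15 * Cmod (z - w).
Proof.
  intros Hz Hw. apply le_epsilon. intros eps He.
  destruct (lam_small n (eps / 2) ltac:(lra)) as [j Hj].
  specialize (Hj j (le_n j)). assert (A := HPhi n z Hz j). assert (B := HPhi n w Hw j).
  assert (P := lam_pos n). unfold off_zone in Hz, Hw.
  assert (D := comp_f_two n j z w ltac:(lra) ltac:(lra)).
  assert (T := Cmod_triangle (comp_f n j z - comp_f n j w - (z - w)) ((Phi n z - comp_f n j z) - (Phi n w - comp_f n j w))).
  assert (T2 := Cmod_minus_le (Phi n z - comp_f n j z) (Phi n w - comp_f n j w)).
  rewrite Cmod_minus_sym in A, B.
  replace (comp_f n j z - comp_f n j w - (z - w) + (Phi n z - comp_f n j z - (Phi n w - comp_f n j w)))%C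
    with (Phi n z - Phi n w - (z - w))%C in T by ring. lra.
Qed.

Lemma Phi_inj (n : nat) (z w : C) : off_zone n z -> off_zone n w -> Phi n z = Phi n w -> z = w.
Proof.
  intros Hz Hw E. assert (T := Phi_two n z w Hz Hw). rewrite E in T.
  replace (Phi n w - Phi n w - (z - w))%C with (- (z - w))%C in T by ring. rewrite Cmod_opp in T.
  apply NNPP. intros N. assert (P := Cmod_minus_pos _ _ N). lra.
Qed.

Lemma off_zone_conj (n : nat) (z : C) : off_zone n z -> off_zone n (Cconj z).
Proof.
  unfold off_zone. intros H. replace (Cconj z - RtoC ts)%C with (Cconj (z - RtoC ts)).
  - now rewrite Cmod_conj.
  - now rewrite Cminus_conj, Cconj_R.
Qed.

(** With injectivity this symmetry shows that only real points have real images, so the points of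
    the limit over 0, 1, infinity remain real. *)
Lemma Phi_conj (n : nat) (z : C) : off_zone n z -> Phi n (Cconj z) = Cconj (Phi n z).
Proof.
  intros Hz. apply (C_limit_unique (fun j => comp_f n j (Cconj z)) (fun j => lam (j + n))).
  - intros eps He. now apply lam_small.
  - intros j. apply HPhi. now apply off_zone_conj.
  - intros j. assert (P := lam_pos n).
    destruct (comp_f_far n j z) as [_ [_ [_ [_ E]]]]; [unfold off_zone in Hz; lra|].
    rewrite E, <- Cminus_conj, Cmod_conj. now apply HPhi.
Qed.

Lemma Phi_comp (n j : nat) (z : C) : off_zone n z -> Phi n z = comp_f n j (Phi (j + n) z).
Proof.
  intros Hz. apply (C_limit_unique (fun m => comp_f n (m + j) z) (fun m => 2 * lam (m + (j + n)))).
  - intros eps He. destruct (lam_small (j + n) (eps / 2) ltac:(lra)) as [N HN]. exists N.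
    intros m Hm. specialize (HN m Hm). lra.
  - intros m. assert (A := HPhi n z Hz (m + j)%nat). rewrite <- Nat.add_assoc in A.
    assert (P := lam_pos (m + (j + n))). lra.
  - intros m. rewrite comp_f_split. assert (A := HPhi (j + n) z (off_zone_mono n j z Hz) m).
    assert (F := Phi_far n j z Hz). assert (P := lam_pos n). assert (Pm := lam_pos (m + (j + n))).
    assert (Hzj := off_zone_mono n j z Hz). unfold off_zone in Hz, Hzj. assert (M := lam_mono n j).
    assert (Pj := lam_pos (j + n)).
    destruct (comp_f_far (j + n) m z ltac:(lra)) as [_ [B _]].
    set (w := comp_f (j + n) m z) in *. set (y := Phi (j + n) z) in *.
    assert (Hw : 21 / 4 * lam n <= Cmod (w - RtoC ts)).
    { assert (T := Cmod_tri_minus z w (RtoC ts)). rewrite Cmod_minus_sym in B. lra. }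
    assert (D := comp_f_two n j w y Hw F).
    assert (T := Cmod_triangle (comp_f n j w - comp_f n j y - (w - y)) (w - y)).
    replace (comp_f n j w - comp_f n j y - (w - y) + (w - y))%C with (comp_f n j w - comp_f n j y)%C in T by ring. lra.
Qed.

Lemma Phi_G (n j : nat) (z : C) : off_zone n z -> sG (S (j + n)) (Phi (j + n) z) = sG (S n) (Phi n z).
Proof.
  intros Hz. rewrite (Phi_comp n j z Hz). apply (comp_f_far n j). now apply Phi_far.
Qed.

Lemma Phi_Y (n j : nat) (z : C) : off_zone n z ->
  Cmod (sY (S n) (Phi n z)) <= 16 / 15 * Cmod (sY (S (j + n)) (Phi (j + n) z)).
Proof.
  intros Hz. rewrite (Phi_comp n j z Hz). apply (comp_f_far n j). now apply Phi_far.
Qed.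

Lemma Phi_cdiff (n : nat) (z : C) : 6 * lam n < Cmod (z - RtoC ts) -> cdiff (Phi n) z.
Proof.
  intros Hz. set (r := (Cmod (z - RtoC ts) - 6 * lam n) / 2).
  assert (HA : forall w, in_square z r w -> off_zone n w).
  { intros w Hw. apply in_square_dist in Hw. unfold off_zone.
    assert (T := Cmod_tri_minus z w (RtoC ts)). rewrite Cmod_minus_sym in Hw. unfold r in Hw. lra. }
  apply (cdiff_limit (comp_f n) (Phi n) z r).
  - unfold r; lra.
  - intros j w Hw. assert (P := lam_pos n). assert (T := HA w Hw). unfold off_zone in T.
    apply (comp_f_far n j). lra.
  - intros eps He. destruct (lam_small n eps He) as [N HN]. exists N. intros j w Hj Hw.
    apply Rle_trans with (1 := HPhi n w (HA w Hw) j). now apply HN.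
Qed.

Lemma Im_dist (z w : C) : Im z - Cmod (w - z) <= Im w.
Proof.
  assert (T := im_le_Cmod (w - z)). rewrite Cminus_Im in T. apply Rabs_le_between in T. lra.
Qed.

Lemma Im_le_dist_R (z : C) (x : R) : Im z <= Cmod (z - RtoC x).
Proof.
  assert (T := im_le_Cmod (z - RtoC x)). rewrite Cminus_R_Im in T.
  apply Rle_trans with (2 := T). apply Rle_abs.
Qed.

Lemma comp_J_spec (n j : nat) (t : C) : 0 < Im t -> Im t <= Im (comp_J n j t) /\ cdiff (comp_J n j) t /\
  sG (S (j + n)) (comp_J n j t) = sG (S n) t /\ comp_f n j (comp_J n j t) = t.
Proof.
  intros Ht. destruct (tr_J _ _ _ _ _ _ _ _ _ _ _ (comp_f_trans n j) t Ht) as [A1 [A2 [A3 [A4 A5]]]]. auto.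
Qed.

Lemma eta_Im (n : nat) (t : C) : 0 < Im t -> Im t <= Im (eta n t).
Proof.
  intros Ht. apply le_epsilon. intros eps He. destruct (lam2_small n (Im t) eps Ht He) as [j Hj].
  specialize (Hj j (le_n j)). assert (A := Heta n t Ht j). destruct (comp_J_spec n j t Ht) as [B _].
  assert (T := Im_dist (comp_J n j t) (eta n t)). rewrite Cmod_minus_sym in A. lra.
Qed.

Lemma eta_cdiff (n : nat) (t : C) : 0 < Im t -> cdiff (eta n) t.
Proof.
  intros Ht. assert (HI : forall w, in_square t (Im t / 2) w -> Im t / 2 <= Im w).
  { intros w Hw. unfold in_square, in_rect in Hw. lra. }
  apply (cdiff_limit (comp_J n) (eta n) t (Im t / 2)).
  - lra.
  - intros j w Hw. apply (comp_J_spec n j). specialize (HI w Hw). lra.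
  - intros eps He. destruct (lam2_small n (Im t / 2) eps ltac:(lra) He) as [N HN]. exists N.
    intros j w Hj Hw. specialize (HI w Hw). apply Rle_trans with (1 := Heta n w ltac:(lra) j).
    apply Rle_trans with (2 := HN j Hj). assert (P := lam_pos (j + n)).
    apply Rmult_le_compat_l; [nra|]. apply Rinv_le_contravar; lra.
Qed.

Lemma eta_Jc (n j : nat) (t : C) : 0 < Im t -> eta n t = eta (j + n) (comp_J n j t).
Proof.
  intros Ht. destruct (comp_J_spec n j t Ht) as [B _].
  apply (C_limit_unique (fun m => comp_J n (m + j) t) (fun m => lam (m + (j + n)) * lam (m + (j + n)) / Im t)).
  - intros eps He. now apply lam2_small.
  - intros m. rewrite Nat.add_assoc. now apply Heta.
  - intros m. rewrite comp_J_split. apply Rle_trans with (1 := Heta (j + n) (comp_J n j t) ltac:(lra) m).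
    assert (P := lam_pos (m + (j + n))). apply Rmult_le_compat_l; [nra|]. apply Rinv_le_contravar; lra.
Qed.

Lemma Phi_eta (n : nat) (t : C) : 7 * lam n <= Im t -> Phi n (eta n t) = t.
Proof.
  intros Ht. assert (P := lam_pos n). assert (Ht0 : 0 < Im t) by lra.
  assert (E := eta_Im n t Ht0). assert (Q := Im_le_dist_R (eta n t) ts).
  assert (HA : off_zone n (eta n t)) by (unfold off_zone; lra).
  apply (C_limit_unique (fun j => comp_f n j (eta n t))
    (fun j => lam (j + n) + 2 * (lam (j + n) * lam (j + n) / Im t))).
  - intros eps He. destruct (lam_small n (eps / 2) ltac:(lra)) as [N1 H1].
    destruct (lam2_small n (Im t) (eps / 4) Ht0 ltac:(lra)) as [N2 H2].
    exists (N1 + N2)%nat. intros j Hj. specialize (H1 j ltac:(lia)). specialize (H2 j ltac:(lia)). lra.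
  - intros j. assert (A := HPhi n _ HA j). assert (Pj := lam_pos (j + n)).
    assert (0 <= lam (j + n) * lam (j + n) / Im t) by (apply Rdiv_le_0_compat; nra). lra.
  - intros j. destruct (comp_J_spec n j t Ht0) as [B1 [_ [_ B2]]]. assert (A := Heta n t Ht0 j).
    assert (Q2 := Im_le_dist_R (comp_J n j t) ts). rewrite Cmod_minus_sym in A.
    assert (D := comp_f_two n j (eta n t) (comp_J n j t) ltac:(lra) ltac:(lra)). rewrite B2 in D.
    assert (T := Cmod_triangle (comp_f n j (eta n t) - t - (eta n t - comp_J n j t)) (eta n t - comp_J n j t)).
    replace (comp_f n j (eta n t) - t - (eta n t - comp_J n j t) + (eta n t - comp_J n j t))%C
      with (comp_f n j (eta n t) - t)%C in T by ring.
    assert (Pj := lam_pos (j + n)). assert (C0 := Cmod_ge_0 (eta n t - comp_J n j t)). lra.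
Qed.

(** Any stage whose zone is far enough from [z] may be used, by [Phi_G]. At [ts] there is none, and
    the value is arbitrary. *)
Definition limit_G (z : C) : Chat :=
  let n := epsilon (inhabits 0%nat) (fun n => off_zone n z) in sG (S n) (Phi n z).

Lemma limit_G_eq (n : nat) (z : C) : off_zone n z -> limit_G z = sG (S n) (Phi n z).
Proof.
  intros Hz. unfold limit_G. assert (Hm := epsilon_spec (inhabits 0%nat) (fun n => off_zone n z) (ex_intro _ n Hz)).
  set (m := epsilon _ _) in *. rewrite <- (Phi_G n m z Hz), <- (Phi_G m n z Hm).
  now rewrite Nat.add_comm.
Qed.

Lemma off_zone_exists (z : C) : z <> RtoC ts -> exists n, 6 * lam n < Cmod (z - RtoC ts).
Proof.
  intros Hz. assert (P := Cmod_minus_pos _ _ Hz).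
  destruct (lam_small 0 (Cmod (z - RtoC ts) / 7) ltac:(lra)) as [N HN].
  exists (N + 0)%nat. specialize (HN N (le_n N)). lra.
Qed.

(** This holds even close to the zone of stage n, where Phi n is not controlled: at a late stage the
    zone is short compared with Im t, and the finite composition of right inverses in between
    preserves the functions exactly. *)
Lemma limit_G_eta (n : nat) (t : C) : 0 < Im t -> limit_G (eta n t) = sG (S n) t.
Proof.
  intros Ht. destruct (lam_small n (Im t / 7) ltac:(lra)) as [j Hj]. specialize (Hj j (le_n j)).
  destruct (comp_J_spec n j t Ht) as [B1 [_ [B2 _]]]. assert (P := lam_pos (j + n)).
  rewrite (eta_Jc n j t Ht), <- B2.
  assert (E := eta_Im (j + n) (comp_J n j t) ltac:(lra)).
  assert (Q := Im_le_dist_R (eta (j + n) (comp_J n j t)) ts).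
  rewrite (limit_G_eq (j + n)) by (unfold off_zone; lra). now rewrite Phi_eta by lra.
Qed.

Lemma Phi_Im (n : nat) (p : C) : 8 * lam n <= Im p -> off_zone n p /\ Im p - lam n / 4 <= Im (Phi n p).
Proof.
  intros Hp. assert (P := lam_pos n). assert (Q := Im_le_dist_R p ts).
  assert (HA : off_zone n p) by (unfold off_zone; lra). split; auto.
  assert (T := Phi_near n p HA). assert (T2 := Im_dist p (Phi n p)). lra.
Qed.

Lemma eta_Phi (n : nat) (p : C) : 8 * lam n <= Im p -> eta n (Phi n p) = p.
Proof.
  intros Hp. destruct (Phi_Im n p Hp) as [HA HI]. assert (P := lam_pos n).
  assert (E := eta_Im n (Phi n p) ltac:(lra)). assert (Q := Im_le_dist_R (eta n (Phi n p)) ts).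
  apply (Phi_inj n); auto; [unfold off_zone; lra|]. apply Phi_eta. lra.
Qed.

Hypothesis Hdense : forall n, dense n (lam n) (S (Datatypes.S n)).

(** By [limit_G_eta], h composed with eta n is a multiplier for the function of stage n, and
    [two_constant] applies to it in the dense interval of that stage. At the point Phi n p the
    exponent grows with n, while |Y| stays bounded below by [Phi_Y]. *)
Lemma multiplier_zero (h : C -> C) : (forall z, 0 < Im z -> cdiff h z) ->
  (forall z, 0 < Im z -> Cmod (h z) * Rmax 1 (Cmod (finite_part limit_G z)) <= 1) ->
  forall p, 0 < Im p -> h p = 0%C.
Proof.
  intros Hh Hb p Hp.
  destruct (lam_small 0 (Im p / 8) ltac:(lra)) as [m0 Hm0]. specialize (Hm0 m0 (le_n m0)).
  set (m := (m0 + 0)%nat) in *.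
  destruct (Phi_Im m p ltac:(lra)) as [HA HI]. assert (Pm := lam_pos m).
  assert (HY : 0 < Cmod (sY (S m) (Phi m p))).
  { apply Cmod_gt_0. destruct (HS m) as [[HO _] _]. apply (ok_Y _ _ _ HO).
    intros [x [_ E]]. rewrite E in HI. unfold Im at 2 in HI. simpl in HI. lra. }
  set (y0 := Cmod (sY (S m) (Phi m p))) in *.
  set (B := Cmod p + 1 + lam m). assert (B1 : 1 < B) by (assert (T := Cmod_ge_0 p); unfold B; lra).
  set (w0 := Im p / 16 / ((B + 1) * (B + 1) + 4 * (B * B))).
  assert (W0 : 0 < w0) by (unfold w0; apply Rdiv_lt_0_compat; nra).
  (* [w0] bounds the weight at the moving points Phi n p from below uniformly in the stage, by
     [weight_ge]. The linear bound 1 + x <= exp x is enough to let k tend to infinity. *)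
  assert (Main : forall k : nat, Cmod (h p) * (15 / 16 * y0) * (1 + INR k * w0) <= 5 * (B * B)).
  { intros k. set (n := (k + m)%nat). set (n1 := Datatypes.S n).
    assert (L1 : lam n1 <= lam m) by exact (lam_mono m (Datatypes.S k)).
    assert (L0 : lam n <= lam m) by exact (lam_mono m k).
    assert (P1 := lam_pos n1). assert (P0 := lam_pos n).
    destruct (Phi_Im n1 p ltac:(lra)) as [HA1 HI1].
    set (q := Phi n1 p) in *.
    assert (Hq : Cmod (q - p) <= lam m / 4) by (assert (T := Phi_near n1 p HA1); fold q in T; lra).
    assert (Cq : Cmod q + 1 <= B).
    { assert (T := Cmod_triangle p (q - p)). replace (p + (q - p))%C with q in T by ring. unfold B. lra. }
    destruct (HS n1) as [[HO _] _].
    destruct (Hdense n) as [a [b [del [Da [Db [Dab [Dlam [Ddel [Dm DN]]]]]]]]]. fold n1 in Da, Db, Dm.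
    assert (TC := two_constant (sG (S n1)) (sY (S n1)) (sl (S n1)) a b del (fun t => h (eta n1 t))
      HO Da Db Dab Dm Ddel).
    assert (E1 : forall z, 0 < Im z -> cdiff (fun t => h (eta n1 t)) z).
    { intros z Hz. assert (T := eta_Im n1 z Hz). apply cdiff_comp; [now apply eta_cdiff|apply Hh; lra]. }
    assert (E2 : forall z, 0 < Im z ->
      Cmod (h (eta n1 z)) * Rmax 1 (Cmod (finite_part (sG (S n1)) z)) <= 1).
    { intros z Hz. assert (T := eta_Im n1 z Hz). specialize (Hb (eta n1 z) ltac:(lra)).
      unfold finite_part in *. now rewrite limit_G_eta in Hb. }
    specialize (TC E1 E2 q ltac:(lra)). unfold q in TC at 1. rewrite eta_Phi in TC by lra.
    fold q in TC.
    assert (YL : 15 / 16 * y0 <= Cmod (sY (S n1) q)).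
    { assert (T := Phi_Y m (Datatypes.S k) p HA). fold y0 in T.
      change (y0 <= 16 / 15 * Cmod (sY (S n1) q)) in T. lra. }
    assert (QI : Cmod (q + Ci) <= B).
    { assert (T := Cmod_triangle q Ci). rewrite Cmod_Ci in T. lra. }
    set (c := (a + b) / 2) in *. set (rho := (b - a) / 5) in *.
    assert (Bc : -1 <= c <= 1).
    { assert (X1 := ok_l _ _ _ HO a Da). assert (X2 := ok_l _ _ _ HO b Db). unfold c. lra. }
    assert (WG := weight_ge c rho q ltac:(unfold rho; lra) Bc ltac:(unfold rho; lra)).
    assert (Wq : w0 <= weight c rho q).
    { apply Rle_trans with (2 := WG). unfold w0.
      assert (Rq := re_le_Cmod q). assert (Iq := im_le_Cmod q).
      change (Rabs (Re q) <= Cmod q) in Rq. assert (Iq2 := Rle_abs (Im q)).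
      assert (R0 := Rabs_pos (Re q)).
      assert (Iq1 : Im p / 2 <= Im q) by lra. set (Y := Im q) in *. set (X := Rabs (Re q)) in *.
      apply Rmult_le_compat; [lra|left; apply Rinv_0_lt_compat; nra|lra|].
      apply Rinv_le_contravar; nra. }
    assert (NW : INR k * w0 <= rho * ln (/ del) * weight c rho q).
    { apply Rmult_le_compat; [apply pos_INR|lra| |auto]. apply Rle_trans with (2 := DN).
      apply le_INR. unfold n. lia. }
    rewrite Cmod_mult in TC.
    set (x := rho * ln (/ del) * weight c rho q) in *.
    assert (X0 : 0 <= INR k * w0) by (apply Rmult_le_pos; [apply pos_INR|lra]).
    assert (EX := one_plus_le_exp x). rewrite exp_Ropp in TC. assert (Ep := exp_pos x).
    assert (H0 := Cmod_ge_0 (h p)).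
    assert (TC2 : Cmod (h p) * Cmod (sY (S n1) q) * exp x <= 5 * (Cmod (q + Ci) * Cmod (q + Ci))).
    { apply Rmult_le_compat_r with (r := exp x) in TC; [|lra].
      replace (5 * (Cmod (q + Ci) * Cmod (q + Ci)) * / exp x * exp x)
        with (5 * (Cmod (q + Ci) * Cmod (q + Ci))) in TC by (field; lra). exact TC. }
    assert (QI0 := Cmod_ge_0 (q + Ci)).
    apply Rle_trans with (5 * (Cmod (q + Ci) * Cmod (q + Ci))).
    - apply Rle_trans with (2 := TC2). apply Rmult_le_compat; [nra|lra|nra|lra].
    - apply Rmult_le_compat_l; [lra|]. apply Rmult_le_compat; lra. }
  apply NNPP. intros N. apply Cmod_gt_0 in N.
  set (g := Cmod (h p) * (15 / 16 * y0)) in *. assert (G0 : 0 < g) by (unfold g; nra).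
  destruct (INR_archimed (g * w0) (5 * (B * B)) ltac:(nra)) as [k Hk].
  specialize (Main k). assert (INR k * (g * w0) <= 5 * (B * B)) by nra. lra.
Qed.
End Limit.

(** * The meromorphic function F *)

Lemma locally_of_Cmod (z0 : C) (d : R) (P : C -> Prop) : 0 < d ->
  (forall w, Cmod (w - z0) < d -> P w) -> locally z0 P.
Proof.
  intros Hd H. assert (D2 : 0 < d / 2) by lra. exists (mkposreal _ D2). intros w [H1 H2].
  apply H. apply Rle_lt_trans with (1 := Cmod_le_abs _). rewrite Cminus_Re, Cminus_Im.
  change (Rabs (Re w - Re z0) < d / 2) in H1. change (Rabs (Im w - Im z0) < d / 2) in H2. lra.
Qed.

Lemma punctured_of_Cmod (z0 : C) (d : R) (P : C -> Prop) : 0 < d ->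
  (forall w, 0 < Cmod (w - z0) < d -> P w) -> locally' z0 P.
Proof.
  intros Hd H. apply locally_of_Cmod with (d := d); auto. intros w Hw Hn. apply H.
  split; auto. now apply Cmod_minus_pos.
Qed.

(* A value of modulus at least 1 is never the dummy value 0 at infinity. *)
Lemma pole_criterion (F : C -> Chat) (z0 : C) :
  (forall M, exists d, 0 < d /\ forall w, 0 < Cmod (w - z0) < d -> M <= Cmod (finite_part F w)) ->
  locally' z0 (fun z => F z <> CInfinity) /\
  filterlim (fun z => Cmod (finite_part F z)) (locally' z0) (Rbar_locally p_infty).
Proof.
  intros H. split.
  - destruct (H 1) as [d [D K]]. apply punctured_of_Cmod with (d := d); auto.
    intros w Hw E. specialize (K w Hw). unfold finite_part in K. rewrite E, Cmod_0 in K. lra.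
  - intros P [M HM]. destruct (H (M + 1)) as [d [D K]].
    apply punctured_of_Cmod with (d := d); auto. intros w Hw. apply HM. specialize (K w Hw). lra.
Qed.

Lemma Cinv_cdiff (z : C) : z <> 0%C -> cdiff (fun w => / w)%C z.
Proof. intros H. now apply (cdiff_inv (fun w => w)); [apply cdiff_id|]. Qed.

Lemma admissible_finite_near (G : C -> Chat) (Y : C -> C) (l : list R) (w0 : C) : admissible G Y l ->
  G w0 <> CInfinity -> exists d, 0 < d /\ forall w, Cmod (w - w0) < d -> G w <> CInfinity.
Proof.
  intros HO H0. destruct (inE_dec_near l w0) as [d [D K]]. exists d. split; auto.
  intros w Hw E. destruct (classic (w = w0)) as [->|N]; [contradiction|].
  apply (ok_omit _ _ _ HO w); [|unfold zero_one_infty; auto].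
  apply K. split; auto. now apply Cmod_minus_pos.
Qed.

Section Final.
Variables (S : nat -> state) (f J : nat -> C -> C) (K : nat -> R).
Hypothesis HS : forall n, good (S n) /\ strans (f n) (J n) (K n) (S n) (S (Datatypes.S n)) /\
    sv (S (Datatypes.S n)) - su (S (Datatypes.S n)) <= (sv (S n) - su (S n)) / 8.
Let lam (n : nat) : R := sv (S n) - su (S n).
Hypothesis Hdense : forall n, dense n (lam n) (S (Datatypes.S n)).
Variable ts : R.
Hypothesis Hts : forall n, su (S n) <= ts <= sv (S n).
Variables Phi eta : nat -> C -> C.
Hypothesis HPhi : forall n z, off_zone S ts n z -> forall j, Cmod (comp_f f n j z - Phi n z) <= lam (j + n).
Hypothesis Heta : forall n t, 0 < Im t ->
  forall j, Cmod (comp_J J n j t - eta n t) <= lam (j + n) * lam (j + n) / Im t.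
Let Gi := limit_G S ts Phi.

(** It maps the upper half-plane onto itself and infinity to [ts], so the only point where the limit
    is not controlled disappears from the plane. *)
Definition moebius (z : C) : C := (RtoC ts - / z)%C.

Definition limit_function (z : C) : Chat :=
  match excluded_middle_informative (z = 0%C) with
  | left _ => CInfinity
  | right _ => Gi (moebius z)
  end.

Lemma limit_function_0 : limit_function 0%C = CInfinity.
Proof. unfold limit_function. now destruct (excluded_middle_informative _). Qed.

Lemma limit_function_eq (z : C) : z <> 0%C -> limit_function z = Gi (moebius z).
Proof. intros H. unfold limit_function. now destruct (excluded_middle_informative _). Qed.

Lemma moebius_dist (z : C) : z <> 0%C -> Cmod (moebius z - RtoC ts) = / Cmod z.
Proof.
  intros H. unfold moebius. replace (RtoC ts - / z - RtoC ts)%C with (- / z)%C by ring.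
  now rewrite Cmod_opp, Cmod_inv.
Qed.

Lemma moebius_neq (z : C) : z <> 0%C -> moebius z <> RtoC ts.
Proof.
  intros H E. assert (T := moebius_dist z H). rewrite E in T.
  replace (RtoC ts - RtoC ts)%C with (RtoC 0) in T by ring. rewrite Cmod_0 in T.
  assert (P := Rinv_0_lt_compat _ (proj1 (Cmod_gt_0 _) H)). lra.
Qed.

Lemma moebius_cdiff (z : C) : z <> 0%C -> cdiff moebius z.
Proof. intros H. apply cdiff_minus; [apply cdiff_const|now apply Cinv_cdiff]. Qed.

Lemma moebius_inj (z w : C) : z <> 0%C -> w <> 0%C -> moebius z = moebius w -> z = w.
Proof.
  intros Hz Hw E. unfold moebius in E.
  assert (E2 : (/ z)%C = (/ w)%C).
  { replace (/ z)%C with (RtoC ts - (RtoC ts - / z))%C by ring. rewrite E. ring. }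
  replace z with (/ / z)%C by (field; auto). rewrite E2. field. auto.
Qed.

Lemma moebius_Im (z : C) : z <> 0%C -> Im (moebius z) = Im z / (Re z ^ 2 + Im z ^ 2).
Proof.
  intros H. unfold moebius. rewrite Cminus_Im, Cinv_Im. unfold Im at 1; simpl. unfold Rdiv. ring.
Qed.

Lemma norm2_pos (z : C) : z <> 0%C -> 0 < Re z ^ 2 + Im z ^ 2.
Proof.
  intros H. apply Cmod_gt_0 in H. assert (T := Cmod_sq z). simpl. nra.
Qed.

Lemma moebius_Im_pos (z : C) : 0 < Im z -> 0 < Im (moebius z).
Proof.
  intros H. assert (N := Im_pos_neq_0 z H). rewrite moebius_Im by auto.
  apply Rdiv_lt_0_compat; auto. now apply norm2_pos.
Qed.

(* Near a point other than 0, [limit_function] is one of the functions of the sequence composed with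
   an injective holomorphic map. *)
Lemma limit_function_local (z0 : C) : z0 <> 0%C -> exists n d, 0 < d /\ forall z, Cmod (z - z0) < d ->
  z <> 0%C /\ off_zone S ts n (moebius z) /\ limit_function z = sG (S n) (Phi n (moebius z)) /\
  cdiff (fun w => Phi n (moebius w)) z.
Proof.
  intros H0. destruct (off_zone_exists S f J K HS ts (moebius z0) (moebius_neq z0 H0)) as [n Hn].
  destruct (cdiff_ccont _ _ (moebius_cdiff z0 H0) (Cmod (moebius z0 - RtoC ts) - 6 * lam n)) as [d [D KK]].
  { unfold lam. lra. }
  assert (P0 := proj1 (Cmod_gt_0 _) H0).
  exists n, (Rmin d (Cmod z0)). split; [now apply Rmin_glb_lt|]. intros z Hz.
  assert (A := Rmin_l d (Cmod z0)). assert (B := Rmin_r d (Cmod z0)).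
  specialize (KK z ltac:(lra)).
  assert (Nz : z <> 0%C).
  { intros ->. replace (0 - z0)%C with (- z0)%C in Hz by ring. rewrite Cmod_opp in Hz. lra. }
  assert (L : 6 * lam n < Cmod (moebius z - RtoC ts)).
  { assert (T := Cmod_tri_minus (moebius z0) (moebius z) (RtoC ts)).
    rewrite Cmod_minus_sym in KK. lra. }
  assert (HA : off_zone S ts n (moebius z)) by (apply Rlt_le; exact L).
  split; [auto|]. split; [auto|]. split.
  - rewrite limit_function_eq by auto. unfold Gi. now apply (limit_G_eq S f J K HS ts Hts Phi HPhi).
  - apply cdiff_comp; [now apply moebius_cdiff|].
    now apply (Phi_cdiff S f J K HS ts Hts Phi HPhi).
Qed.

(** Such a point has a real image under Phi n, so it and its conjugate have the same image and
    coincide by injectivity. *)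
Lemma limit_function_real (z : C) : zero_one_infty (limit_function z) -> Im z = 0.
Proof.
  intros H. destruct (classic (z = 0%C)) as [->|Nz]; [reflexivity|].
  destruct (limit_function_local z Nz) as [n [d [D L]]].
  destruct (L z) as [_ [HA [E _]]].
  { replace (z - z)%C with (RtoC 0) by ring. now rewrite Cmod_0. }
  rewrite E in H. destruct (HS n) as [[HO _] _].
  assert (Hl : inE (sl (S n)) (Phi n (moebius z))).
  { apply NNPP. intros N. now apply (ok_omit _ _ _ HO _ N). }
  destruct Hl as [x [_ Ex]].
  assert (EC : Cconj (moebius z) = moebius z).
  { apply (Phi_inj S f J K HS ts Hts Phi HPhi n); auto.
    - now apply off_zone_conj.
    - rewrite (Phi_conj S f J K HS ts Hts Phi HPhi) by auto. rewrite Ex. apply Cconj_R. }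
  assert (I0 : Im (moebius z) = 0).
  { assert (T : Im (Cconj (moebius z)) = Im (moebius z)) by now rewrite EC.
    change (- Im (moebius z) = Im (moebius z)) in T. lra. }
  rewrite moebius_Im in I0 by auto. assert (P := norm2_pos z Nz).
  replace (Im z) with (Im z / (Re z ^ 2 + Im z ^ 2) * (Re z ^ 2 + Im z ^ 2)) by (field; lra).
  rewrite I0. ring.
Qed.

Lemma limit_function_meromorphic (U : C -> Prop) : meromorphic_on U limit_function.
Proof.
  intros z0 _. destruct (classic (z0 = 0%C)) as [->|N0].
  (* Near 0 the Moebius map is large, so stage 0 applies: Phi 0 is close to the identity there and
     the initial function tends to infinity. *)
  - rewrite limit_function_0. apply pole_criterion. intros M.
    destruct (HS 0%nat) as [[HO _] _]. destruct (ok_Ginf _ _ _ HO M) as [r Hr].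
    assert (P : 0 < lam 0) by exact (lam_pos S f J K HS 0).
    set (R0 := Rmax (6 * lam 0) (Rabs ts + lam 0 + Rabs r)).
    assert (A1 : 6 * lam 0 <= R0) by apply Rmax_l.
    assert (A2 : Rabs ts + lam 0 + Rabs r <= R0) by apply Rmax_r.
    assert (R1 : 0 < R0) by lra.
    exists (/ R0). split; [now apply Rinv_0_lt_compat|]. intros z Hz.
    replace (z - 0)%C with z in Hz by ring. assert (Nz : z <> 0%C) by (apply Cmod_gt_0; lra).
    assert (Dz := moebius_dist z Nz).
    assert (L : R0 <= / Cmod z).
    { rewrite <- (Rinv_inv R0). apply Rinv_le_contravar; lra. }
    assert (HA : off_zone S ts 0 (moebius z)) by (change (6 * lam 0 <= Cmod (moebius z - RtoC ts)); lra).
    replace (finite_part limit_function z) with (finite_part (sG (S 0%nat)) (Phi 0%nat (moebius z))).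
    + apply Hr. assert (T : Cmod (Phi 0%nat (moebius z) - moebius z) <= lam 0 / 4) by exact (Phi_near S f J K HS ts Hts Phi HPhi 0 _ HA).
      assert (T2 := Cmod_lower (moebius z - RtoC ts) (RtoC ts + (Phi 0%nat (moebius z) - moebius z))).
      replace (moebius z - RtoC ts + (RtoC ts + (Phi 0%nat (moebius z) - moebius z)))%C
        with (Phi 0%nat (moebius z)) in T2 by ring.
      assert (T3 := Cmod_triangle (RtoC ts) (Phi 0%nat (moebius z) - moebius z)).
      rewrite Cmod_R in T3. assert (T4 := Rle_abs r). lra.
    + unfold finite_part. rewrite limit_function_eq by auto. unfold Gi.
      now rewrite (limit_G_eq S f J K HS ts Hts Phi HPhi 0).
  - destruct (limit_function_local z0 N0) as [n [d [D L]]]. destruct (HS n) as [[HO _] _].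
    assert (Z0 : Cmod (z0 - z0) < d).
    { replace (z0 - z0)%C with (RtoC 0) by ring. now rewrite Cmod_0. }
    destruct (L z0 Z0) as [_ [HA0 [E0 C0]]].
    assert (FP : forall z, Cmod (z - z0) < d -> finite_part limit_function z = finite_part (sG (S n)) (Phi n (moebius z))).
    { intros z Hz. destruct (L z Hz) as [_ [_ [E _]]]. unfold finite_part. now rewrite E. }
    assert (CC := cdiff_ccont _ _ C0).
    destruct (limit_function z0) eqn:EF.
    + assert (NI : sG (S n) (Phi n (moebius z0)) <> CInfinity) by (rewrite <- E0; discriminate).
      destruct (admissible_finite_near _ _ _ _ HO NI) as [d1 [D1 K1]].
      destruct (CC d1 D1) as [d2 [D2 K2]]. split.
      * apply locally_of_Cmod with (d := Rmin d d2); [now apply Rmin_glb_lt|]. intros w Hw.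
        assert (A := Rmin_l d d2). assert (B := Rmin_r d d2).
        destruct (L w ltac:(lra)) as [_ [_ [E _]]]. rewrite E. apply K1, K2. lra.
      * apply cdiff_complex_differentiable.
        apply cdiff_ext_loc with (f := fun w => finite_part (sG (S n)) (Phi n (moebius w))) (r := d); auto.
        -- intros w Hw. now rewrite FP.
        -- apply (cdiff_comp (finite_part (sG (S n))) (fun w => Phi n (moebius w))); auto.
           now apply (ok_diff _ _ _ HO).
    + apply pole_criterion. intros M. destruct (ok_pole _ _ _ HO _ (eq_sym E0) M) as [d1 [D1 K1]].
      destruct (CC d1 D1) as [d2 [D2 K2]].
      exists (Rmin d d2). split; [now apply Rmin_glb_lt|]. intros w Hw.
      assert (A := Rmin_l d d2). assert (B := Rmin_r d d2).
      destruct (L w ltac:(lra)) as [Nw [HA [E _]]]. rewrite FP by lra. apply K1. split.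
      (* Injectivity prevents the composition from returning to the pole. *)
      * apply Cmod_minus_pos. intros E2.
        apply (Phi_inj S f J K HS ts Hts Phi HPhi n) in E2; auto. apply moebius_inj in E2; auto.
        rewrite E2 in Hw. replace (z0 - z0)%C with (RtoC 0) in Hw by ring. rewrite Cmod_0 in Hw. lra.
      * apply K2. lra.
Qed.

(** If F = h1 / h2 then |h2| max (1, |F|) is the larger of |h1| and |h2|, hence bounded. So h2 / M,
    transported by the inverse of the Moebius map, is a multiplier and must vanish. *)
Lemma limit_function_not_nevanlinna : ~ nevanlinna_class limit_function.
Proof.
  intros [_ [h1 [h2 [D1 [[M1 B1] [D2 [[M2 B2] [[p [Hp Np]] E]]]]]]]].
  set (M := Rmax 1 (Rmax M1 M2)).
  assert (A0 : 1 <= M) by apply Rmax_l.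
  assert (A1 : M1 <= M) by (eapply Rle_trans; [apply Rmax_l|apply Rmax_r]).
  assert (A2 : M2 <= M) by (eapply Rle_trans; [apply Rmax_r|apply Rmax_r]).
  set (back := fun t : C => (- / (t - RtoC ts))%C).
  assert (NM : RtoC M <> 0%C) by (intros X; apply RtoC_inj in X; lra).
  assert (Nt : forall t, 0 < Im t -> (t - RtoC ts)%C <> 0%C).
  { intros t Ht. apply Im_pos_neq_0. now rewrite Cminus_R_Im. }
  assert (Hback : forall t, 0 < Im t -> 0 < Im (back t)).
  { intros t Ht. unfold back. assert (P := norm2_pos _ (Nt t Ht)).
    replace (Im (- / (t - RtoC ts))%C) with (Im (t - RtoC ts)%C / (Re (t - RtoC ts)%C ^ 2 + Im (t - RtoC ts)%C ^ 2)).
    - rewrite Cminus_R_Im at 1. now apply Rdiv_lt_0_compat.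
    - change (Im (- / (t - RtoC ts))%C) with (- Im (/ (t - RtoC ts))%C). rewrite Cinv_Im. field. lra. }
  assert (Mback : forall t, 0 < Im t -> moebius (back t) = t).
  { intros t Ht. unfold moebius, back. assert (T := Nt t Ht). field. auto. }
  assert (Z := multiplier_zero S f J K HS ts Hts Phi eta HPhi Heta Hdense (fun t => h2 (back t) / RtoC M)%C).
  apply Np. assert (Np0 := Im_pos_neq_0 p Hp).
  replace (h2 p) with (h2 (back (moebius p)) / RtoC M * RtoC M)%C.
  - rewrite Z; [ring| | |now apply moebius_Im_pos].
    + intros t Ht. apply cdiff_div; [|apply cdiff_const|auto]. apply cdiff_comp.
      * unfold back. apply cdiff_opp, cdiff_inv; [|now apply Nt].
        apply cdiff_minus; [apply cdiff_id|apply cdiff_const].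
      * apply cdiff_complex_differentiable, D2. now apply Hback.
    + intros t Ht. assert (Hb := Hback t Ht). set (z := back t) in *.
      assert (X2 := B2 z Hb). assert (C0 := Cmod_ge_0 (h2 z)).
      rewrite Cmod_div, Cmod_R, (Rabs_pos_eq M) by (auto; lra).
      destruct (classic (h2 z = 0%C)) as [Hz|Hz].
      * rewrite Hz, Cmod_0. unfold Rdiv. rewrite !Rmult_0_l. lra.
      * specialize (E z Hb Hz). rewrite limit_function_eq in E by now apply Im_pos_neq_0.
        unfold z in E at 1. rewrite Mback in E by auto. unfold Gi in E.
        unfold finite_part. rewrite E. assert (X1 := B1 z Hb).
        replace (Cmod (h2 z) / M * Rmax 1 (Cmod (h1 z / h2 z))) with
          (Cmod (h2 z) * Rmax 1 (Cmod (h1 z / h2 z)) / M) by (field; lra).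
        apply div_le; [lra|]. rewrite Rmult_1_l, Cmod_div by auto.
        assert (P2 := proj1 (Cmod_gt_0 _) Hz).
        unfold Rmax at 1. destruct (Rle_dec 1 (Cmod (h1 z) / Cmod (h2 z))).
        -- replace (Cmod (h2 z) * (Cmod (h1 z) / Cmod (h2 z))) with (Cmod (h1 z)) by (field; lra). lra.
        -- lra.
  - replace (back (moebius p)) with p; [field; auto|]. unfold back, moebius.
    replace (RtoC ts - / p - RtoC ts)%C with (- / p)%C by ring. field. exact Np0.
Qed.
End Final.

Theorem theorem1p2 :
  exists F : C -> Chat,
    meromorphic_on (fun _ : C => True) F /\
    ~ (exists c : Chat, forall z : C, F z = c) /\
    (forall z : C, upper_half_plane z -> ~ zero_one_infty (F z)) /\
    ~ nevanlinna_class F /\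
    (forall z : C, zero_one_infty (F z) -> Im z = 0).
Proof.
  destruct state_sequence as [S [f [J [K H]]]].
  assert (HS : forall n, good (S n) /\ strans (f n) (J n) (K n) (S n) (S (Datatypes.S n)) /\
    sv (S (Datatypes.S n)) - su (S (Datatypes.S n)) <= (sv (S n) - su (S n)) / 8).
  { intros n. destruct (H n) as [A [B [D _]]]. auto. }
  destruct (common_point S f J K HS) as [ts Hts].
  destruct (Phi_exists S f J K HS ts Hts) as [Phi HPhi].
  destruct (eta_exists S f J K HS) as [eta Heta].
  assert (Hreal := limit_function_real S f J K HS ts Hts Phi HPhi).
  exists (limit_function S ts Phi). split; [|split; [|split; [|split]]].
  - exact (limit_function_meromorphic S f J K HS ts Hts Phi HPhi _).
  (* The value at 0 is infinity. A constant function would also be infinite at i, which is not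
     real. *)
  - intros [c Hc]. assert (E : limit_function S ts Phi Ci = CInfinity) by (rewrite Hc, <- (Hc 0%C); apply limit_function_0).
    assert (X := Hreal Ci). rewrite E in X. unfold zero_one_infty, Im in X. simpl in X.
    specialize (X ltac:(auto)). lra.
  - intros z Hz X. apply Hreal in X. unfold upper_half_plane in Hz. lra.
  - apply (limit_function_not_nevanlinna S f J K HS) with (eta := eta); auto. intros n. apply H.
  - exact Hreal.
Qed.
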